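(* (Multiplicative Decomposition) For each integer $N\neq0$, the Hilbert space $\mathcal{H}_N$ has an orthogonal direct sum decomposition $$\mathcal{H}_N=\bigoplus_{d\,\mid\,|N|}\Big(\bigoplus_{\chi\ (\mathrm{mod}\ d)}\mathcal{H}_{N,d}(\chi)\Big),$$ where $d$ runs over the positive divisors of $|N|$ and $\chi$ runs over all Dirichlet characters modulo $d$, primitive and imprimitive. Each $\mathcal{H}_{N,d}(\chi)$ is invariant under the $H(\mathbb{R})$-action on $\mathcal{H}_N$ and is an irreducible representation of $H(\mathbb{R})$ with central character $e^{2\pi i Nz}$.
   Context: $H(\mathbb{R})$ is the real Heisenberg group of triples $[a,c,z]\in\mathbb{R}^3$ with law $[a,c,z]\circ[a',c',z']=[a+a',c+c',z+z'+ca']$ and Haar measure $d\mu=da\,dc\,dz$; $H(\mathbb{Z})$ is the subgroup of integer triples. $L^2(H(\mathbb{Z})\backslash H(\mathbb{R}),d\mu)$ consists of left $H(\mathbb{Z})$-invariant functions on $H(\mathbb{R})$ square-integrable over $[0,1]^3$, with right action $\rho_h(F)(g)=F(gh)$. $\mathcal{H}_N$ is its closed subspace of $F$ with $F(a,c,z)=e^{2\pi i Nz}F(a,c,0)$ a.e. For $d\mid N$, $d\ge1$, and a (primitive or imprimitive) Dirichlet character $\chi$ mod $d$, the twisted Weil–Brezin map $\mathcal{W}_{N,d}(\chi):L^2(\mathbb{R},dx)\to\mathcal{H}_N$ is the isometric extension of the map defined on Schwartz functions $f$ by $$\mathcal{W}_{N,d}(\chi)(f)(a,c,z)=\sqrt{C_{N,d}}\,e^{2\pi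 i Nz}\sum_{n\in\mathbb{Z}}\chi\Big(\frac{nd}{N}\Big)f(n+Nc)e^{2\pi i na},\quad C_{N,d}=\frac{N}{\phi(d)},$$ with $\chi(r)=0$ if $r\notin\mathbb{Z}$ (principal square root when $N<0$), $\phi$ being Euler's function. $\mathcal{H}_{N,d}(\chi)$ is the image of this map, a closed subspace of $\mathcal{H}_N$. *)

(* Defs.v *)
From HB Require Import structures.
From mathcomp Require Import all_boot all_order all_algebra.
From mathcomp Require Import all_classical all_reals all_analysis.
From mathcomp Require Export complex.

Set Implicit Arguments.
Unset Strict Implicit.
Unset Printing Implicit Defensive.

Import Order.TTheory GRing.Theory Num.Theory.
Import numFieldNormedType.Exports.

Local Open Scope classical_set_scope.
Local Open Scope ring_scope.
Local Open Scope complex_scope.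

Section ComplexL2.
Context {R : realType}.

Definition sqmod (z : R[i]) : R := complex.Re z ^+ 2 + complex.Im z ^+ 2.

(* e(t) = exp(2 pi i t) *)
Definition expi2pi (t : R) : R[i] := cos (2 * pi * t) +i* sin (2 * pi * t).

(* Bilateral series, summed along the symmetric partial sums
   u(-M) + ... + u(M).  It is only used for absolutely convergent series, for
   which the order of summation is irrelevant. *)
Definition symm_psum (u : int -> R[i]) (M : nat) : R[i] :=
  \sum_(k < (2 * M).+1) u (k%:Z - M%:Z).

Definition sumZ (u : int -> R[i]) : R[i] :=
  limn (fun M => complex.Re (symm_psum u M)) +i*
  limn (fun M => complex.Im (symm_psum u M)).

Section measure.
Context {d : measure_display} {T : measurableType d}.
Variable mu : {measure set T -> \bar R}.

(* [D] is a domain of integration.  Elements of L^2 are represented by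
   measurable functions; two functions stand for the same element when they
   agree almost everywhere. *)
Definition sq_integrable (D : set T) (f : T -> R[i]) : Prop :=
  [/\ measurable_fun setT (fun x => complex.Re (f x)),
      measurable_fun setT (fun x => complex.Im (f x)) &
      (\int[mu]_(x in D) (sqmod (f x))%:E < +oo)%E].

Definition L2dist2 (D : set T) (f g : T -> R[i]) : \bar R :=
  (\int[mu]_(x in D) (sqmod (f x - g x))%:E)%E.

Definition L2cvg (D : set T) (u : nat -> T -> R[i]) (f : T -> R[i]) : Prop :=
  (fun n => L2dist2 D (u n) f) @ \oo --> 0%E.

Definition L2inner (D : set T) (f g : T -> R[i]) : R[i] :=
  (\int[mu]_(x in D) complex.Re (f x * conjc (g x))) +i*
  (\int[mu]_(x in D) complex.Im (f x * conjc (g x))).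

End measure.

Definition real_schwartz (f : R -> R) : Prop :=
  (forall n (x : R), derivable (derive1n n f) x 1) /\
  (forall k n : nat, exists B : R, forall x : R, `|x ^+ k * derive1n n f x| <= B).

Definition schwartz (f : R -> R[i]) : Prop :=
  real_schwartz (fun x => complex.Re (f x)) /\
  real_schwartz (fun x => complex.Im (f x)).

(* Every Dirichlet character modulo [d], primitive or not, extended by 0 to the
   integers that are not coprime to [d].  For [d = 1] the only one is the
   constant function 1. *)
Definition dirichlet_character (d : nat) (chi : int -> R[i]) : Prop :=
  [/\ (forall n : int, chi (n + d%:Z) = chi n),
      (forall m n : int, chi (m * n) = chi m * chi n) &
      (forall n : int, (chi n != 0) = coprimez n d%:Z)].

End ComplexL2.

Section Heisenberg.
Context {R : realType}.

(* The triple [a, c, z] is encoded as ((a, c), z). *)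
Definition heis : Type := (R * R * R)%type.

Definition hmul (g h : heis) : heis :=
  let: (a, c, z) := g in let: (a', c', z') := h in
  (a + a', c + c', z + z' + c * a').

Definition hone : heis := (0, 0, 0).

Definition leb : {sigma_finite_measure set (measurableTypeR R) -> \bar R} :=
  lebesgue_measure.

Definition haar : {measure set
    (measurableTypeR R * measurableTypeR R * measurableTypeR R)%type ->
    \bar R} :=
  ((leb \x leb) \x leb)%E.

Definition cube : set (R * R * R) :=
  [set g | [/\ 0 <= g.1.1 <= 1, 0 <= g.1.2 <= 1 & 0 <= g.2 <= 1]].

Definition heq (F G : heis -> R[i]) : Prop := {ae haar, forall g, F g = G g}.

(* Left invariance is required almost everywhere for each element of H(Z), so
   that membership only depends on the class of [F]. *)
Definition L2H : set (heis -> R[i]) :=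
  [set F | sq_integrable haar cube F /\
    forall a c z : int,
      heq (fun g => F (hmul (a%:~R, c%:~R, z%:~R) g)) F].

(* The condition F(a, c, z) = e(N z) F(a, c, 0) evaluates [F] on a null set, so
   it is imposed on some representative [G] of the class of [F]. *)
Definition HN (N : int) : set (heis -> R[i]) :=
  [set F | L2H F /\ exists G, [/\ L2H G, heq F G &
    {ae haar, forall g : R * R * R,
       G g = expi2pi (N%:~R * g.2) * G (g.1, 0)}]].

Definition rho (h : heis) (F : heis -> R[i]) : heis -> R[i] :=
  fun g => F (hmul g h).

Definition closed_subspace (V : set (heis -> R[i])) : Prop :=
  [/\ V `<=` L2H,
      V (fun=> 0),
      (forall (k : R[i]) F G, V F -> V G -> V (fun g => k * F g + G g)) &
      (forall (u : nat -> heis -> R[i]) F,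
         (forall n, V (u n)) -> L2H F -> L2cvg haar cube u F -> V F)].

(* Internal orthogonal direct sum of a finite family of closed subspaces;
   uniqueness of the components follows from orthogonality. *)
Definition orthogonal_direct_sum (H : set (heis -> R[i])) (I : choiceType)
    (A : set I) (V : I -> set (heis -> R[i])) : Prop :=
  [/\ finite_set A,
      (forall i, A i -> closed_subspace (V i)),
      (forall i j, A i -> A j -> i != j ->
         forall F G, V i F -> V j G -> L2inner haar cube F G = 0) &
      H = [set F | L2H F /\ exists f : I -> heis -> R[i],
             (forall i, A i -> V i (f i)) /\
             heq F (fun g => \sum_(i \in A) f i g)]].

Definition rho_invariant (V : set (heis -> R[i])) : Prop :=
  forall h F, V F -> V (rho h F).

(* The right action of H(R) restricts to a (strongly continuous) unitary
   representation on [V]. *)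
Definition unitary_rep (V : set (heis -> R[i])) : Prop :=
  [/\ closed_subspace V /\ rho_invariant V,
      (forall F, V F -> heq (rho hone F) F),
      (forall h h' F, V F -> heq (rho (hmul h h') F) (rho h (rho h' F))),
      (forall h F G, V F -> V G ->
         L2inner haar cube (rho h F) (rho h G) = L2inner haar cube F G) &
      (forall F, V F -> forall h0 : R * R * R,
         L2dist2 haar cube (rho h F) (rho h0 F) @[h --> h0] --> 0%E)].

Definition irreducible_rep (V : set (heis -> R[i])) : Prop :=
  [/\ unitary_rep V,
      (exists F, V F /\ ~ heq F (fun=> 0)) &
      (forall W, closed_subspace W -> rho_invariant W -> W `<=` V ->
         (forall F, W F -> heq F (fun=> 0)) \/ W = V)].

Definition has_central_character (V : set (heis -> R[i])) (omega : R -> R[i]) :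
    Prop :=
  forall (t : R) F, V F ->
    heq (rho (0, 0, t) F) (fun g => omega t * F g).

(* chi(n d / N), with the convention chi(r) = 0 when r is not an integer *)
Definition chi_ratio (N : int) (d : nat) (chi : int -> R[i]) (n : int) : R[i] :=
  if (N %| n * d%:Z)%Z then chi ((n * d%:Z) %/ N)%Z else 0.

(* [sqrtC] is the principal square root: it is +i sqrt |x| at a negative x. *)
Definition WB_schwartz (N : int) (d : nat) (chi : int -> R[i]) (f : R -> R[i]) :
    heis -> R[i] := fun g =>
  let: (a, c, z) := g in
  sqrtC (N%:~R / (totient d)%:R) * expi2pi (N%:~R * z) *
  sumZ (fun n => chi_ratio N d chi n * f (n%:~R + N%:~R * c) *
                 expi2pi (n%:~R * a)).

(* Graph of the isometric extension of [WB_schwartz] to L^2(R), i.e. of its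
   extension by continuity: [f] is an L^2-limit of Schwartz functions [u k] whose
   images converge to [F] in L^2. *)
Definition WB (N : int) (d : nat) (chi : int -> R[i])
    (f : R -> R[i]) (F : heis -> R[i]) : Prop :=
  [/\ sq_integrable leb setT f, L2H F &
      exists u : nat -> R -> R[i],
        [/\ (forall k, schwartz (u k)), L2cvg leb setT u f &
            L2cvg haar cube (fun k => WB_schwartz N d chi (u k)) F]].

Definition HNd (N : int) (d : nat) (chi : int -> R[i]) : set (heis -> R[i]) :=
  [set F | exists f : R -> R[i], WB N d chi f F].

End Heisenberg.
Arguments heis R : clear implicits.

(* Main.v *)
(* Let Z be the space of functions th on R^2 with th(b+1,c) = th(b,c) and
   th(b,c+1) = e(-b) th(b,c) that are square integrable on the unit square.
   For X : Z/N -> C put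
     J_X th (a,c,z) = e(Nz) sum_(n < |N|) X(n) e(na) th(Na, c + n/N).
   Then <J_X th, J_Y eta> = (sum_n X(n) conj Y(n)) <th, eta>, and right
   translation by H(R) becomes, through J_X, the action
   th |-> e(be + c al) th(b + al, c + ga) on Z.  A finite Fourier transform in
   the variable a writes every F in H_N as a sum of J_X th with X ranging over
   point masses; the functions n |-> chi(nd/N), for d | N and chi modulo d, form
   an orthogonal basis of the functions on Z/N, whence the decomposition.

   Z is irreducible: if eta is orthogonal to the orbit of th, then translating
   by integer parameters shows that all Fourier coefficients of the integrable
   function th(. + v) conj(eta) vanish, so this product is 0 a.e. for each v, and
   integrating its square modulus over v gives |th|^2 |eta|^2 = 0.

   Finally H_{N,d}(chi) = J_X(Z) for X(n) = chi(nd/N).  The Weil-Brezin image of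
   a Schwartz function u is a multiple of J_X th_u with
   th_u(b,c) = sum_(N | l) u(l + Nc) e(lb/N).  The th_u of Gaussian type form an
   invariant subspace, hence a dense one, and the Bessel inequality
   int |u|^2 <= |N| |th_u|^2 lifts convergence in Z to convergence in L^2(R). *)

From HB Require Import structures.
Require Import Defs.
From mathcomp Require Import all_boot all_order all_algebra.
From mathcomp Require Import all_classical all_reals all_analysis.
From mathcomp Require Import cyclic measurable_realfun ring lra zify.

Set Implicit Arguments.
Unset Strict Implicit.
Unset Printing Implicit Defensive.

Import Order.TTheory GRing.Theory Num.Theory.
Import numFieldNormedType.Exports.

Local Open Scope classical_set_scope.
Local Open Scope ring_scope.
Local Open Scope complex_scope.

(** * Complex numbers and changes of variables *)

(** Two features of the setting shape the proof. Elements of L2 are functions, not classes, and the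
    invariances in [L2H] and [HN] hold only almost everywhere, whereas theta functions are handled
    through exact quasi-periodicity. So the Zak space consists of exactly quasi-periodic functions,
    [quasi] repairs a function known only almost everywhere, and [VX], the image of J_X, is
    saturated under [heq]. Norms occur only squared ([nrm2]), without the usual triangle inequality;
    factors 2 and the parameter t of [nrm2_young] take its place, and limits are taken along
    sequences whose increments are below 4^-n.

    For X of positive [znorm], J_X is a multiple of an isometry, so closedness, strong continuity
    and irreducibility of every H_{N,d}(chi) come from one and the same representation. Its
    irreducibility is used in the form that a nonzero invariant subspace is dense. For theta
    functions of Gaussians this gives surjectivity onto J_X(Z) without inverting the Weil-Brezin
    transform; for vectors with continuous orbit it gives strong continuity. *)

Section ComplexBasics.
Context {R : realType}.
Implicit Types (z w : R[i]) (t : R).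

Lemma complexE2 z w : complex.Re z = complex.Re w ->
  complex.Im z = complex.Im w -> z = w.
Proof. by case: z w => [a b] [c d] /= -> ->. Qed.

Lemma cReD z w : complex.Re (z + w) = complex.Re z + complex.Re w.
Proof. by case: z; case: w. Qed.
Lemma cImD z w : complex.Im (z + w) = complex.Im z + complex.Im w.
Proof. by case: z; case: w. Qed.
Lemma cReN z : complex.Re (- z) = - complex.Re z.
Proof. by case: z. Qed.
Lemma cImN z : complex.Im (- z) = - complex.Im z.
Proof. by case: z. Qed.
Lemma cReM z w : complex.Re (z * w) =
  complex.Re z * complex.Re w - complex.Im z * complex.Im w.
Proof. by case: z; case: w. Qed.
Lemma cImM z w : complex.Im (z * w) =
  complex.Re z * complex.Im w + complex.Im z * complex.Re w.
Proof. by case: z => a b; case: w => c d. Qed.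
Lemma cReJ z : complex.Re (conjc z) = complex.Re z.
Proof. by case: z. Qed.
Lemma cImJ z : complex.Im (conjc z) = - complex.Im z.
Proof. by case: z. Qed.
Lemma cRe_sum (I : Type) (r : seq I) (P : pred I) (F : I -> R[i]) :
  complex.Re (\sum_(i <- r | P i) F i) = \sum_(i <- r | P i) complex.Re (F i).
Proof. by apply: (big_morph _ cReD). Qed.
Lemma cIm_sum (I : Type) (r : seq I) (P : pred I) (F : I -> R[i]) :
  complex.Im (\sum_(i <- r | P i) F i) = \sum_(i <- r | P i) complex.Im (F i).
Proof. by apply: (big_morph _ cImD). Qed.

Definition ccE := (cReD, cImD, cReN, cImN, cReM, cImM, cReJ, cImJ).

Lemma sqmod_ge0 z : 0 <= sqmod z.
Proof. by rewrite addr_ge0 ?sqr_ge0. Qed.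

Lemma sqmodM z w : sqmod (z * w) = sqmod z * sqmod w.
Proof. by rewrite /sqmod !ccE; ring. Qed.

Lemma sqmodJ z : sqmod (conjc z) = sqmod z.
Proof. by rewrite /sqmod !ccE; ring. Qed.

Lemma sqmodN z : sqmod (- z) = sqmod z.
Proof. by rewrite /sqmod !ccE; ring. Qed.

Lemma sqmod0 : sqmod (0 : R[i]) = 0.
Proof. by rewrite /sqmod /= expr0n addr0. Qed.

Lemma sqmod1 : sqmod (1 : R[i]) = 1.
Proof. by rewrite /sqmod /= expr0n expr1n addr0. Qed.

Lemma sqmod_eq0 z : (sqmod z == 0) = (z == 0).
Proof. by rewrite /sqmod paddr_eq0 ?sqr_ge0// !sqrf_eq0 eq_complex. Qed.

Lemma sqmod_gt0 z : (0 < sqmod z) = (z != 0).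
Proof. by rewrite lt_def sqmod_ge0 sqmod_eq0 andbT. Qed.

Lemma sqmodB_sym z w : sqmod (z - w) = sqmod (w - z).
Proof. by rewrite /sqmod !ccE; ring. Qed.

Lemma sqmodD_le z w : sqmod (z + w) <= 2 * (sqmod z + sqmod w).
Proof.
rewrite /sqmod !ccE; case: z w => a b [c d] /=.
have h1 := sqr_ge0 (a - c); have h2 := sqr_ge0 (b - d); nra.
Qed.

Lemma normRe_mulJ_le z w : `|complex.Re (z * conjc w)| <= sqmod z + sqmod w.
Proof.
rewrite !ccE /sqmod; case: z w => a b [c d] /=.
have h1 := sqr_ge0 (a - c); have h2 := sqr_ge0 (b - d).
have h3 := sqr_ge0 (a + c); have h4 := sqr_ge0 (b + d).
by rewrite ler_norml; apply/andP; split; nra.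
Qed.

Lemma normIm_mulJ_le z w : `|complex.Im (z * conjc w)| <= sqmod z + sqmod w.
Proof.
rewrite !ccE /sqmod; case: z w => a b [c d] /=.
have h1 := sqr_ge0 (a - d); have h2 := sqr_ge0 (b - c).
have h3 := sqr_ge0 (a + d); have h4 := sqr_ge0 (b + c).
by rewrite ler_norml; apply/andP; split; nra.
Qed.

Lemma mulJ_sqmod z : z * conjc z = (sqmod z)%:C.
Proof. by apply: complexE2; rewrite /sqmod !ccE /=; ring. Qed.

Lemma expi2piD s t : expi2pi (s + t) = expi2pi s * expi2pi t :> R[i].
Proof. by apply: complexE2; rewrite !ccE /= mulrDr ?cosD ?sinD; ring. Qed.

Lemma expi2pi0 : expi2pi 0 = 1 :> R[i].
Proof. by apply: complexE2; rewrite /= mulr0 ?cos0 ?sin0. Qed.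

Lemma expi2piN t : expi2pi (- t) = conjc (expi2pi t) :> R[i].
Proof. by apply: complexE2; rewrite /= mulrN ?cosN ?sinN. Qed.

Lemma sqmod_expi2pi t : sqmod (expi2pi t : R[i]) = 1.
Proof. by rewrite /sqmod /= cos2Dsin2. Qed.

Lemma expi2pi_neq0 t : expi2pi t != 0 :> R[i].
Proof. by rewrite -sqmod_eq0 sqmod_expi2pi oner_eq0. Qed.

Lemma expi2pi_nat (n : nat) : expi2pi n%:R = 1 :> R[i].
Proof.
elim: n => [|n IH]; first by rewrite expi2pi0.
rewrite -addn1 natrD expi2piD IH mul1r; apply: complexE2 => /=;
by rewrite mulr1 mulr_natl ?cos2pi ?sin2pi.
Qed.

Lemma expi2pi_int (n : int) : expi2pi n%:~R = 1 :> R[i].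
Proof.
case: n => n; first exact: expi2pi_nat.
by rewrite NegzE mulrNz expi2piN expi2pi_nat conjc1.
Qed.

Lemma expi2piDint t (n : int) : expi2pi (t + n%:~R) = expi2pi t :> R[i].
Proof. by rewrite expi2piD expi2pi_int mulr1. Qed.

Lemma expi2piX t (n : nat) : expi2pi t ^+ n = expi2pi (n%:R * t) :> R[i].
Proof.
elim: n => [|n IH]; first by rewrite mul0r expi2pi0.
by rewrite exprS IH -expi2piD -natr1 mulrDl mul1r addrC.
Qed.

(** The real part already differs from 1: cos (2 pi t) = 1 - 2 sin^2 (pi t), and sin is positive on
    ]0, pi[. *)
Lemma expi2pi_neq1 t : 0 < t < 1 -> expi2pi t != 1 :> R[i].
Proof.
move=> /andP[t0 t1]; rewrite eq_complex /= negb_and; apply/orP; left.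
have -> : 2 * pi * t = (pi * t) *+ 2 :> R by rewrite -mulrA mulr_natl.
rewrite cos_mulr2n cos2sin2.
have : 0 < sin (pi * t).
  by apply: sin_gt0_pi; rewrite mulr_gt0 ?pi_gt0//= -[ltRHS]mulr1 ltr_pM2l ?pi_gt0.
by move=> s0; apply: contraTneq s0 => h; rewrite -leNgt; nra.
Qed.

Lemma expi2pi_frac_neq1 (N k : int) : N != 0 -> ~~ (N %| k)%Z ->
  expi2pi (k%:~R / N%:~R) != 1 :> R[i].
Proof.
move=> N0 Nk.
have -> : expi2pi (k%:~R / N%:~R) =
    expi2pi ((k %% N)%Z%:~R / N%:~R) :> R[i].
  rewrite {1}(divz_eq k N) intrD intrM mulrDl mulfK ?intr_eq0//.
  by rewrite addrC expi2piDint.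
(* Passing from a negative [N] to [- N] conjugates the value. *)
wlog N0' : N N0 Nk / 0 < N => [hw|].
  have [/hw//|] := ltP 0 N; first exact.
  rewrite le_eqVlt (negbTE N0)/= => N0'.
  have := hw (- N); rewrite oppr_eq0 => /(_ N0); rewrite dvdzE abszN -dvdzE => /(_ Nk).
  rewrite oppr_gt0 => /(_ N0'); rewrite modzN mulrNz invrN mulrN expi2piN.
  by apply: contraNneq => ->; rewrite conjc1.
apply: expi2pi_neq1; apply/andP; split.
  rewrite divr_gt0 ?ltr0z// lt_def modz_ge0// andbT.
  by apply: contraNneq Nk => h; apply/dvdz_mod0P.
by rewrite ltr_pdivrMr ?ltr0z// mul1r ltr_int ltz_pmod.
Qed.

(** A geometric sum: multiplied by [z - 1], which is nonzero when [N] does not divide [k], it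
    becomes z^|N| - 1, and |N| k / N is an integer. *)
Lemma sum_expi2pi_frac (N k : int) : N != 0 ->
  \sum_(n < `|N|) expi2pi (n%:R * (k%:~R / N%:~R)) =
  (if (N %| k)%Z then `|N|%:R else 0) :> R[i].
Proof.
move=> N0; case: ifPn => [/dvdzP[q ->]|Nk].
  under eq_bigr => n _ do
    rewrite intrM mulfK ?intr_eq0// -expi2piX expi2pi_int expr1n.
  by rewrite sumr_const card_ord.
under eq_bigr => n _ do rewrite -expi2piX.
set z := expi2pi _.
have z1 : z - 1 != 0 by rewrite subr_eq0 expi2pi_frac_neq1.
apply: (mulfI z1); rewrite mulr0 -subrX1 expi2piX.
suff -> : `|N|%:R * (k%:~R / N%:~R) = (k * (sgz N))%:~R :> R.
  by rewrite expi2pi_int subrr.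
rewrite intrM mulrCA; congr (_ * _).
apply: (mulIf (_ : N%:~R != 0 :> R)); first by rewrite intr_eq0.
by rewrite mulfVK ?intr_eq0// -intrM -abszEsg pmulrn.
Qed.

End ComplexBasics.

(** * Affine changes of variable and periodic integrands *)

Section AffineChange.
Context {R : realType}.
Local Open Scope ereal_scope.
Implicit Types (f : measurableTypeR R -> \bar R).

Lemma measurable_affine (a b : R) :
  measurable_fun setT (fun x : measurableTypeR R => (a * x + b)%R : measurableTypeR R).
Proof. by apply: measurable_funD => //; exact: measurable_funM. Qed.

Lemma affine_preimage_itv (a b u v : R) (x y : bool) : a != 0%R ->
  (fun z : R => (a * z + b)%R) @^-1` [set` Interval (BSide x u) (BSide y v)] =
  (if (0 < a)%R then
     [set` Interval (BSide x ((u - b) / a)%R) (BSide y ((v - b) / a)%R)]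
   else
     [set` Interval (BSide (~~ y) ((v - b) / a)%R) (BSide (~~ x) ((u - b) / a)%R)]).
Proof.
move=> a0; have [ap|an] := ltP 0%R a.
  by apply/seteqP; split => z /=; rewrite !in_itv/= lteif_pdivrMr//
    lteif_pdivlMr// lteifBlDr lteifBrDr [(z * a)%R]mulrC.
have {}an : (a < 0)%R by rewrite lt_neqAle a0.
by apply/seteqP; split => z /=; rewrite !in_itv/= lteif_ndivrMr//
  lteif_ndivlMr// lteifBlDr lteifBrDr [(z * a)%R]mulrC andbC !negbK.
Qed.

(** Scaled by |a|, the pushforward of Lebesgue measure under x -> ax + b has the right values on
    bounded intervals, so it is Lebesgue measure by uniqueness. *)
Lemma leb_affine (a b : R) (A : set (measurableTypeR R)) : a != 0%R -> measurable A ->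
  leb ((fun z : R => (a * z + b)%R) @^-1` A) = (`|a|^-1)%:E * leb A.
Proof.
move=> a0 mA.
have na0 : `|a|%R != 0%R by rewrite normr_eq0.
have [mu muE] : exists mu : {measure set (measurableTypeR R) -> \bar R},
    forall X, mu X = `|a|%:E * leb ((fun z : R => (a * z + b)%R) @^-1` X).
  unshelve eexists; first exact: (mscale (NngNum (normr_ge0 a))
    (measure_function_pushforward__canonical__measure_function_Measure
      leb (measurable_affine a b))).
  by [].
have H : forall X, measurable X -> lebesgue_measure X = mu X.
  apply: lebesgue_measure_unique => X.
  move=> [[u v] _ <-] /=.
  rewrite muE affine_preimage_itv//.
  case: ifPn => ap; rewrite /leb/= !lebesgue_measure_itv/=.
    rewrite !lte_fin ltr_pM2r ?invr_gt0// ltrD2r; case: ifPn => _; last by rewrite mule0.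
    rewrite -!EFinD -EFinM -mulrBl opprB addrA subrK gtr0_norm//.
    by rewrite mulrC divfK.
  have an : (a < 0)%R by rewrite lt_neqAle a0 leNgt.
  rewrite !lte_fin ltr_nM2r ?invr_lt0// ltrD2r; case: ifPn => _; last by rewrite mule0.
  rewrite -!EFinD -EFinM -mulrBl opprB addrA subrK ltr0_norm//.
  by congr (_%:E); field.
rewrite [RHS](_ : _ = (`|a|^-1)%:E * mu A); last by congr (_ * _); exact: H.
by rewrite muE muleA -EFinM mulVf// mul1e.
Qed.

Lemma ge0_integral_affine (a b : R) f : a != 0%R ->
  measurable_fun setT f -> (forall x, 0 <= f x) ->
  \int[leb]_x f (a * x + b)%R = (`|a|^-1)%:E * \int[leb]_x f x.
Proof.
move=> a0 mf f0.
have na0 : (0 <= `|a|^-1)%R by rewrite invr_ge0.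
have := @ge0_integral_pushforward _ _ _ _ R _ (measurable_affine a b) leb setT f measurableT mf
  (fun x _ => f0 x).
rewrite preimage_setT => <-.
rewrite -[RHS](ge0_integral_mscale leb measurableT (NngNum na0) mf)//.
apply: eq_measure_integral => [|? A mA _]; first exact: measurable_affine.
exact: leb_affine.
Qed.

Lemma ge0_integral_affine_itv (a b u v : R) (x y : bool) f : (0 < a)%R ->
  measurable_fun setT f -> (forall x, 0 <= f x) ->
  \int[leb]_(z in [set` Interval (BSide x u) (BSide y v)]) f (a * z + b)%R =
  (a^-1)%:E * \int[leb]_(z in [set` Interval (BSide x (a * u + b)%R) (BSide y (a * v + b)%R)]) f z.
Proof.
move=> a0 mf f0; rewrite integral_mkcond [in RHS]integral_mkcond.
rewrite -{2}(gtr0_norm a0) -(@ge0_integral_affine a b); first last.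
- by move=> z; rewrite erestrict_ge0.
- by apply/(measurable_restrictT _ _).1 => //; exact: measurable_funTS.
- by rewrite gt_eqF.
apply: eq_integral => z _; rewrite /patch.
suff -> : (z \in [set` Interval (BSide x u) (BSide y v)]) =
  ((a * z + b)%R \in [set` Interval (BSide x (a * u + b)%R) (BSide y (a * v + b)%R)]) by [].
have := affine_preimage_itv b (a * u + b) (a * v + b) x y (lt0r_neq0 a0).
rewrite a0 !addrK ![(a * _)%R]mulrC !mulfK ?gt_eqF// => <-.
by apply/idP/idP; rewrite !inE /= mulrC.
Qed.

End AffineChange.

Section Periodic.
Context {R : realType}.

Lemma periodic_int (T : Type) (f : R -> T) (t : R) (n : int) :
  (forall x, f (x + 1) = f x) -> f (t + n%:~R) = f t.
Proof.
move=> fp; have fn (m : nat) x : f (x + m%:R) = f x.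
  elim: m => [|m IH]; first by rewrite addr0.
  by rewrite -natr1 addrA fp.
case: n => n; first exact: fn.
by rewrite NegzE mulrNz -[LHS](fn n.+1) -pmulrn subrK.
Qed.

Local Open Scope ereal_scope.

(** Closed, like the sides of [cube]; the proofs below pass to half-open intervals, which tile the
    line. *)
Definition uI : set (measurableTypeR R) := `[0%R, 1%R]%classic.

Lemma measurable_uI : measurable uI.
Proof. exact: measurable_itv. Qed.

Lemma integral_co_split (f : measurableTypeR R -> \bar R) :
  measurable_fun setT f -> (forall x, 0 <= f x) -> forall u v w : R, (u <= v)%R -> (v <= w)%R ->
  \int[leb]_(z in `[u, w[) f z = \int[leb]_(z in `[u, v[) f z + \int[leb]_(z in `[v, w[) f z.
Proof.
move=> mf f0 u v w uv vw.
rewrite (_ : `[u, w[%classic = `[u, v[%classic `|` `[v, w[%classic); last first.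
  by rewrite -itv_bndbnd_setU// bnd_simp.
rewrite ge0_integral_setU//; first exact: measurable_funTS.
apply/eqP/seteqP; split => // z [] /=; rewrite !in_itv/= => /andP[_ zv] /andP[vz _].
by move: (lt_le_trans zv vz); rewrite ltxx.
Qed.

Section fixedf.
Variable f : measurableTypeR R -> \bar R.
Hypotheses (mf : measurable_fun setT f) (f0 : forall x, 0 <= f x).
Hypothesis fp : forall x, f (x + 1)%R = f x.

Let shift1 (u v : R) (n : int) :
  \int[leb]_(z in `[u, v[) f z = \int[leb]_(z in `[(u + n%:~R)%R, (v + n%:~R)%R[) f z.
Proof.
have := @ge0_integral_affine_itv R 1 n%:~R u v true true f ltr01 mf f0.
rewrite invr1 mul1e !mul1r => <-.
by apply: eq_integral => z _; rewrite mul1r periodic_int.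
Qed.

(** The part of [t, t+1[ to the left of the integer [n] is moved by 1 to the right end. This gives
    [n, n+1[, which an integer translation brings to [0, 1[. *)
Lemma integral_period_co (t : R) :
  \int[leb]_(z in `[t, (t + 1)%R[) f z = \int[leb]_(z in `[0%R, 1%R[) f z.
Proof.
pose n := Num.ceil t.
have nt : (t <= n%:~R)%R by exact: ceil_ge.
have tn : (n%:~R <= t + 1)%R.
  by have := gt_pred_ceil t; rewrite rmorphB/= => /ltW; rewrite lerBlDr.
rewrite (@integral_co_split _ mf f0 t n%:~R (t + 1))//.
rewrite (@shift1 t n%:~R 1) addeC -(integral_co_split mf f0)//; last by rewrite lerD2r.
by rewrite [RHS](@shift1 0 1 n) add0r [(1 + _)%R]addrC.
Qed.

Lemma ge0_integral_period_shift (t : R) :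
  \int[leb]_(z in uI) f (z + t)%R = \int[leb]_(z in uI) f z.
Proof.
rewrite /uI -!integral_itv_bndo_bndc; last 2 first.
- exact: measurable_funTS.
- apply: measurable_funTS; apply: (measurableT_comp mf).
  exact: measurable_funD.
have := @ge0_integral_affine_itv R 1 t 0 1 true true f ltr01 mf f0.
rewrite invr1 mul1e mulr0 mulr1 add0r addrC integral_period_co => <-.
by apply: eq_integral => z _; rewrite mul1r.
Qed.

Lemma ge0_integral_period_nat (n : nat) :
  \int[leb]_(z in `[0%R, n%:R[) f z = n%:R%:E * \int[leb]_(z in `[0%R, 1%R[) f z.
Proof.
elim: n => [|n IH]; first by rewrite set_itvco0 integral_set0 mul0e.
rewrite (@integral_co_split _ mf f0 0 n%:R)//; last by rewrite ler_nat.
by rewrite -natr1 integral_period_co IH EFinD ge0_muleDl ?mul1e// lee_fin.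
Qed.

End fixedf.

Lemma ge0_integral_period_opp (f : measurableTypeR R -> \bar R) :
  measurable_fun setT f -> (forall x, 0 <= f x) -> (forall x, f (x + 1)%R = f x) ->
  \int[leb]_(z in uI) f (- z)%R = \int[leb]_(z in uI) f z.
Proof.
move=> mf f0 fp.
have mg : measurable_fun setT (fun z : measurableTypeR R => f (- z)%R).
  exact: (measurableT_comp mf).
(* A shift turns the reflection into z -> 1 - z, which preserves [uI]. *)
rewrite -(@ge0_integral_period_shift (fun z => f (- z)%R) mg _ _ (- 1)%R)//; last first.
  by move=> x; rewrite opprD -(fp (- x - 1)%R) subrK.
rewrite integral_mkcond [in RHS]integral_mkcond.
have mr : measurable_fun setT (f \_ uI).
  by apply/(measurable_restrictT _ _).1; [exact: measurable_uI|exact: measurable_funTS].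
have n0 : (-1 != 0 :> R)%R by rewrite oppr_eq0 oner_eq0.
have r0 x : 0 <= (f \_ uI) x by exact: erestrict_ge0.
have := @ge0_integral_affine R (-1)%R 1%R _ n0 mr r0.
rewrite normrN normr1 invr1 mul1e => <-.
apply: eq_integral => z _; rewrite /patch.
suff -> : (z \in uI) = ((-1 * z + 1)%R \in uI) by rewrite opprB mulN1r addrC.
by apply/idP/idP; rewrite !inE /uI/= !in_itv/=; lra.
Qed.

Lemma ge0_integral_period_scale (f : measurableTypeR R -> \bar R) (N : int) : N != 0%R ->
  measurable_fun setT f -> (forall x, 0 <= f x) -> (forall x, f (x + 1)%R = f x) ->
  \int[leb]_(z in uI) f (N%:~R * z)%R = \int[leb]_(z in uI) f z.
Proof.
move=> N0 mf f0 fp.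
wlog N_gt0 : N N0 / (0 < N)%R => [hw|].
  have [/hw|] := ltP 0%R N; first exact.
  rewrite le_eqVlt (negbTE N0)/= => N_lt0.
  rewrite -[RHS](hw (- N)%R) ?oppr_eq0 ?oppr_gt0//.
  under [RHS]eq_integral do rewrite mulrNz mulNr -mulrN.
  apply/esym; apply: (@ge0_integral_period_opp (fun z => f (N%:~R * z)%R)) => //.
  - apply: (measurableT_comp mf).
    exact: measurable_funM.
  - by move=> x; rewrite mulrDr mulr1 periodic_int.
case: N N0 N_gt0 => // n n0 n_gt0.
have n0' : (0 < n%:R :> R)%R by rewrite ltr0n.
rewrite /uI -!integral_itv_bndo_bndc; last 2 first.
- exact: measurable_funTS.
- by apply: measurable_funTS; apply: (measurableT_comp mf); exact: measurable_funM.
have := @ge0_integral_affine_itv R n%:R 0 0 1 true true f n0' mf f0.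
rewrite mulr0 mulr1 !addr0 ge0_integral_period_nat// muleA -EFinM mulVf ?gt_eqF// mul1e => <-.
by apply: eq_integral => z _; rewrite addr0.
Qed.

End Periodic.

(** * Tonelli on the square and the cube, invariance of Haar measure *)

Section ProductIntegrals.
Local Open Scope ereal_scope.

Section setX.
Context d1 d2 (T1 : measurableType d1) (T2 : measurableType d2) (R : realType).
Variables (m1 : {sigma_finite_measure set T1 -> \bar R}).
Variables (m2 : {sigma_finite_measure set T2 -> \bar R}).
Variables (A : set T1) (B : set T2) (f : T1 * T2 -> \bar R).
Hypotheses (mA : measurable A) (mB : measurable B).
Hypotheses (mf : measurable_fun setT f) (f0 : forall x, 0 <= f x).

Let mAB : measurable (A `*` B). Proof. exact: measurableX. Qed.

Let mr : measurable_fun setT (f \_ (A `*` B)).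
Proof. by apply: (measurable_restrictT _ mAB).1; exact: measurable_funTS. Qed.

Lemma ge0_integral_setX1 : \int[m1 \x m2]_(z in A `*` B) f z =
  \int[m1]_(x in A) \int[m2]_(y in B) f (x, y).
Proof.
have r0 x : 0 <= (f \_ (A `*` B)) x by exact: erestrict_ge0.
rewrite integral_mkcond (fubini_tonelli1 _ mr r0).
rewrite [RHS]integral_mkcond; apply: eq_integral => x _.
rewrite /fubini_F [in RHS]/patch; case: ifPn => xA.
  rewrite [RHS]integral_mkcond; apply: eq_integral => y _.
  by rewrite /patch in_setX xA.
under eq_integral do rewrite /patch in_setX (negbTE xA)/=.
by rewrite integral0.
Qed.

Lemma ge0_integral_setX2 : \int[m1 \x m2]_(z in A `*` B) f z =
  \int[m2]_(y in B) \int[m1]_(x in A) f (x, y).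
Proof.
have r0 x : 0 <= (f \_ (A `*` B)) x by exact: erestrict_ge0.
rewrite integral_mkcond (fubini_tonelli2 _ mr r0).
rewrite [RHS]integral_mkcond; apply: eq_integral => y _.
rewrite /fubini_G [in RHS]/patch; case: ifPn => yB.
  rewrite [RHS]integral_mkcond; apply: eq_integral => x _.
  by rewrite /patch in_setX yB andbT.
under eq_integral do rewrite /patch in_setX (negbTE yB) andbF/=.
by rewrite integral0.
Qed.

End setX.

Section torus.
Context {R : realType}.
Notation T := (measurableTypeR R).

(** Named in order to carry the sigma-finite structure declared below, with which Tonelli applies to
    [haar] as a product of [leb2] and [leb]. *)
Definition leb2 : set (T * T) -> \bar R := (@leb R \x @leb R).

HB.instance Definition _ := Measure.on leb2.

Let sigma_finite_leb2 : sigma_finite setT leb2.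
Proof.
have [F TF Foo] := sigma_finiteT (@leb R).
have /sigma_finiteP[G [TG ndG Goo]] := sigma_finiteT (@leb R).
exists (fun n => G n `*` G n).
  rewrite -setXTT TG predeqE => -[x y]; split.
    move=> [/= [n _ Gnx] [k _ Gky]]; exists (maxn n k) => //; split.
    - by move: x Gnx; exact/subsetPset/ndG/leq_maxl.
    - by move: y Gky; exact/subsetPset/ndG/leq_maxr.
  by move=> [n _ []/= ? ?]; split; exists n.
move=> k; have [? ?] := Goo k.
split; first exact: measurableX.
rewrite [X in X < _](@product_measure1E _ _ _ _ R leb leb)//.
by rewrite lte_mul_pinfty// ge0_fin_numE.
Qed.

HB.instance Definition _ := Measure_isSigmaFinite.Build _ _ _ leb2 sigma_finite_leb2.

Definition sq : set (T * T) := uI `*` uI.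

Lemma measurable_sq : measurable sq.
Proof. by apply: measurableX; exact: measurable_uI. Qed.

Lemma leb_uI : (leb : set T -> \bar R) uI = 1.
Proof. by rewrite /leb/= lebesgue_measure_itv/= lte_fin ltr01 oppr0 adde0. Qed.

Lemma leb2_sq : leb2 sq = 1.
Proof.
rewrite [LHS](@product_measure1E _ _ _ _ R leb leb uI uI measurable_uI measurable_uI).
by rewrite /= !leb_uI mule1.
Qed.

Lemma measurable_pairfun d (S : measurableType d) d1 d2 (T1 : measurableType d1)
  (T2 : measurableType d2) (f : S -> T1) (g : S -> T2) :
  measurable_fun setT f -> measurable_fun setT g -> measurable_fun setT (fun x => (f x, g x)).
Proof. by move=> mf mg; apply: (measurable_fun_pairP _).2; split; [exact: mf|exact: mg]. Qed.

Lemma measurable_sq_affine (a s b t : R) :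
  measurable_fun setT (fun z : T * T => ((a * z.1 + s)%R, (b * z.2 + t)%R) : T * T).
Proof.
apply: measurable_pairfun.
  exact: (measurableT_comp (measurable_affine a s) measurable_fst).
exact: (measurableT_comp (measurable_affine b t) measurable_snd).
Qed.

Lemma measurable_sq_shift (s t : R) :
  measurable_fun setT (fun z : T * T => ((z.1 + s)%R, (z.2 + t)%R) : T * T).
Proof.
rewrite (_ : (fun _ => _) = fun z : T * T => ((1 * z.1 + s)%R, (1 * z.2 + t)%R)).
  exact: measurable_sq_affine.
by apply/funext => z; rewrite !mul1r.
Qed.

Lemma measurable_sq_shift1 (s : R) :
  measurable_fun setT (fun z : T * T => ((z.1 + s)%R, z.2) : T * T).
Proof.
rewrite (_ : (fun _ => _) = fun z : T * T => ((z.1 + s)%R, (z.2 + 0)%R)).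
  exact: measurable_sq_shift.
by apply/funext => z; rewrite addr0.
Qed.

Lemma measurable_sq_shift2 (t : R) :
  measurable_fun setT (fun z : T * T => (z.1, (z.2 + t)%R) : T * T).
Proof.
rewrite (_ : (fun _ => _) = fun z : T * T => ((z.1 + 0)%R, (z.2 + t)%R)).
  exact: measurable_sq_shift.
by apply/funext => z; rewrite addr0.
Qed.

Lemma measurable_sq_scale1 (a : R) :
  measurable_fun setT (fun z : T * T => ((a * z.1)%R, z.2) : T * T).
Proof.
rewrite (_ : (fun _ => _) = fun z : T * T => ((a * z.1 + 0)%R, (1 * z.2 + 0)%R)).
  exact: measurable_sq_affine.
by apply/funext => z; rewrite !addr0 mul1r.
Qed.

Lemma measurable_pair1 (x : T) : measurable_fun setT (fun y : T => (x, y)).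
Proof. by apply: measurable_pairfun; [exact: measurable_cst|exact: measurable_id]. Qed.

Lemma measurable_pair2 (y : T) : measurable_fun setT (fun x : T => (x, y)).
Proof. by apply: measurable_pairfun; [exact: measurable_id|exact: measurable_cst]. Qed.

Section ge0.
Variable f : T * T -> \bar R.
Hypotheses (mf : measurable_fun setT f) (f0 : forall x, 0 <= f x).
Hypothesis fp1 : forall x y, f ((x + 1)%R, y) = f (x, y).

Let mfx y : measurable_fun setT (fun x : T => f (x, y)).
Proof. exact: (measurableT_comp mf (measurable_pair2 y)). Qed.

Let mfy x : measurable_fun setT (fun y : T => f (x, y)).
Proof. exact: (measurableT_comp mf (measurable_pair1 x)). Qed.

Lemma ge0_integral_sq_shift1 (s : R) :
  \int[leb2]_(z in sq) f ((z.1 + s)%R, z.2) = \int[leb2]_(z in sq) f z.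
Proof.
have mfs := measurableT_comp mf (measurable_sq_shift1 s).
rewrite [LHS](ge0_integral_setX2 leb leb measurable_uI measurable_uI mfs (fun z => f0 _)).
rewrite [RHS](ge0_integral_setX2 leb leb measurable_uI measurable_uI mf f0).
apply: eq_integral => y _ /=.
exact: (@ge0_integral_period_shift _ (fun x => f (x, y)) (mfx y)).
Qed.

Lemma ge0_integral_sq_scale1 (N : int) : N != 0%R ->
  \int[leb2]_(z in sq) f ((N%:~R * z.1)%R, z.2) = \int[leb2]_(z in sq) f z.
Proof.
move=> N0; have mfs := measurableT_comp mf (measurable_sq_scale1 N%:~R).
rewrite [LHS](ge0_integral_setX2 leb leb measurable_uI measurable_uI mfs (fun z => f0 _)).
rewrite [RHS](ge0_integral_setX2 leb leb measurable_uI measurable_uI mf f0).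
apply: eq_integral => y _ /=.
exact: (@ge0_integral_period_scale _ (fun x => f (x, y)) _ N0 (mfx y)).
Qed.

Hypothesis fp2 : forall x y, f (x, (y + 1)%R) = f (x, y).

Lemma ge0_integral_sq_shift2 (t : R) :
  \int[leb2]_(z in sq) f (z.1, (z.2 + t)%R) = \int[leb2]_(z in sq) f z.
Proof.
have mfs := measurableT_comp mf (measurable_sq_shift2 t).
rewrite [LHS](ge0_integral_setX1 leb leb measurable_uI measurable_uI mfs (fun z => f0 _)).
rewrite [RHS](ge0_integral_setX1 leb leb measurable_uI measurable_uI mf f0).
apply: eq_integral => x _ /=.
exact: (@ge0_integral_period_shift _ (fun y => f (x, y)) (mfy x)).
Qed.

End ge0.

Section signed.
Variable f : T * T -> \bar R.
Hypothesis mf : measurable_fun setT f.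
Hypothesis fp1 : forall x y, f ((x + 1)%R, y) = f (x, y).
Hypothesis fp2 : forall x y, f (x, (y + 1)%R) = f (x, y).

Let mfp := measurable_funepos mf.
Let mfn := measurable_funeneg mf.

Lemma integral_sq_shift (s t : R) :
  \int[leb2]_(z in sq) f ((z.1 + s)%R, (z.2 + t)%R) = \int[leb2]_(z in sq) f z.
Proof.
have H (g : T * T -> \bar R) : measurable_fun setT g -> (forall x, 0 <= g x) ->
    (forall x y, g ((x + 1)%R, y) = g (x, y)) -> (forall x y, g (x, (y + 1)%R) = g (x, y)) ->
    \int[leb2]_(z in sq) g ((z.1 + s)%R, (z.2 + t)%R) = \int[leb2]_(z in sq) g z.
  move=> mg g0 g1 g2; rewrite -[RHS](ge0_integral_sq_shift1 mg g0 g1 s).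
  rewrite -[RHS](@ge0_integral_sq_shift2 (fun z => g ((z.1 + s)%R, z.2))
    (measurableT_comp mg (measurable_sq_shift1 s)) _ _ t)//.
  by move=> x y; exact: g2.
rewrite integralE [RHS]integralE; congr (_ - _).
  have g1 x y : f^\+ ((x + 1)%R, y) = f^\+ (x, y) by rewrite !funeposE fp1.
  have g2 x y : f^\+ (x, (y + 1)%R) = f^\+ (x, y) by rewrite !funeposE fp2.
  by rewrite -(H _ mfp (fun x => funepos_ge0 f x) g1 g2); apply: eq_integral => z _; rewrite !funeposE.
have g1 x y : f^\- ((x + 1)%R, y) = f^\- (x, y) by rewrite !funenegE fp1.
have g2 x y : f^\- (x, (y + 1)%R) = f^\- (x, y) by rewrite !funenegE fp2.
by rewrite -(H _ mfn (fun x => funeneg_ge0 f x) g1 g2); apply: eq_integral => z _; rewrite !funenegE.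
Qed.

Lemma integral_sq_scale1 (N : int) : N != 0%R ->
  \int[leb2]_(z in sq) f ((N%:~R * z.1)%R, z.2) = \int[leb2]_(z in sq) f z.
Proof.
move=> N0; rewrite integralE [RHS]integralE; congr (_ - _).
  have g1 x y : f^\+ ((x + 1)%R, y) = f^\+ (x, y) by rewrite !funeposE fp1.
  by rewrite -(@ge0_integral_sq_scale1 f^\+ mfp (fun x => funepos_ge0 f x) g1 N N0); apply: eq_integral => z _; rewrite !funeposE.
have g1 x y : f^\- ((x + 1)%R, y) = f^\- (x, y) by rewrite !funenegE fp1.
by rewrite -(@ge0_integral_sq_scale1 f^\- mfn (fun x => funeneg_ge0 f x) g1 N N0); apply: eq_integral => z _; rewrite !funenegE.
Qed.

End signed.

Lemma cubeE : @cube R = sq `*` uI.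
Proof.
apply/seteqP; split => [[[a c] z]|[[a c] z]]; rewrite /sq /uI /cube /= !in_itv/=.
  by move=> [-> -> ->].
by move=> [[-> ->] ->].
Qed.

Lemma measurable_cube : measurable (cube : set (T * T * T)).
Proof. by rewrite cubeE; apply: measurableX; [exact: measurable_sq|exact: measurable_uI]. Qed.

Lemma ge0_integral_cube (f : T * T * T -> \bar R) :
  measurable_fun setT f -> (forall x, 0 <= f x) ->
  \int[haar]_(g in cube) f g = \int[leb2]_(w in sq) \int[leb]_(z in uI) f (w, z).
Proof.
move=> mf f0; rewrite cubeE.
exact: (ge0_integral_setX1 leb2 leb measurable_sq measurable_uI).
Qed.

Lemma integral_cube_fst (f : T * T -> \bar R) : measurable_fun setT f ->
  \int[haar]_(g in cube) f g.1 = \int[leb2]_(w in sq) f w.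
Proof.
have H (g : T * T -> \bar R) : measurable_fun setT g -> (forall x, 0 <= g x) ->
    \int[haar]_(x in cube) g x.1 = \int[leb2]_(w in sq) g w.
  move=> mg g0; rewrite (ge0_integral_cube (measurableT_comp mg measurable_fst) (fun x => g0 _)).
  apply: eq_integral => w _ /=; rewrite integral_cst//; last exact: measurable_uI.
  by rewrite [X in _ * X]leb_uI mule1.
move=> mf; rewrite integralE [RHS]integralE; congr (_ - _).
  by rewrite -(H f^\+ (measurable_funepos mf) (fun x => funepos_ge0 f x)); apply: eq_integral => z _; rewrite !funeposE.
by rewrite -(H f^\- (measurable_funeneg mf) (fun x => funeneg_ge0 f x)); apply: eq_integral => z _; rewrite !funenegE.
Qed.

(* Left and right translations of H(R) are all of this form. *)
Definition shear (x y w s t : R) (g : T * T * T) : T * T * T :=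
  ((g.1.1 + x)%R, (g.1.2 + y)%R, (g.2 + (w + s * g.1.1 + t * g.1.2))%R).

Lemma measurable_shear x y w s t : measurable_fun setT (shear x y w s t).
Proof.
have m1 : measurable_fun setT (fun g : T * T * T => g.1.1).
  exact: (measurableT_comp measurable_fst measurable_fst).
have m2 : measurable_fun setT (fun g : T * T * T => g.1.2).
  exact: (measurableT_comp measurable_snd measurable_fst).
apply: measurable_pairfun.
  apply: measurable_pairfun.
    exact: (measurable_funD m1 (measurable_cst x)).
  exact: (measurable_funD m2 (measurable_cst y)).
apply: (measurable_funD measurable_snd).
apply: measurable_funD; last exact: (measurable_funM (measurable_cst t) m2).
apply: (measurable_funD (measurable_cst w)).
exact: (measurable_funM (measurable_cst s) m1).
Qed.

Let ge0_integral_shift (f : T -> \bar R) (t : R) :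
  measurable_fun setT f -> (forall x, 0 <= f x) ->
  \int[leb]_x f (x + t)%R = \int[leb]_x f x.
Proof.
move=> mf f0; have := ge0_integral_affine t (oner_neq0 R) mf f0.
rewrite normr1 invr1 mul1e => <-.
by apply: eq_integral => x _; rewrite mul1r.
Qed.

(** By Tonelli: once the first two coordinates are fixed, a shear only translates the third, and
    then it translates the first two. *)
Lemma haar_shear x y w s t (A : set (T * T * T)) : measurable A ->
  haar (shear x y w s t @^-1` A) = haar A.
Proof.
move=> mA.
pose f (g : T * T * T) : \bar R := (\1_A g)%:E.
have mf : measurable_fun setT f by exact: (measurable_EFinP _ _).2 (measurable_indic mA).
have f0 g : 0 <= f g by rewrite lee_fin.
have mfs := measurableT_comp mf (measurable_shear x y w s t).
have mP : measurable (shear x y w s t @^-1` A).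
  by rewrite -[X in measurable X]setTI; exact: measurable_shear.
have E (B : set (T * T * T)) : measurable B -> haar B = \int[haar]_g (\1_B g)%:E.
  by move=> mB; rewrite (integral_indic haar measurableT mB) setIT.
rewrite (E _ mP) (E _ mA).
rewrite [LHS](@fubini_tonelli1 _ _ _ _ R leb2 leb _ mfs (fun x => f0 _)).
rewrite [RHS](@fubini_tonelli1 _ _ _ _ R leb2 leb f mf f0).
pose F (v : T * T) := \int[leb]_z f (v, z).
have mF : measurable_fun setT F by exact: measurable_fun_fubini_tonelli_F.
have F0 v : 0 <= F v by exact: integral_ge0.
transitivity (\int[leb2]_v F ((v.1 + x)%R, (v.2 + y)%R)).
  apply: eq_integral => v _; rewrite /fubini_F /=.
  have mfv := measurableT_comp mf (measurable_pairfun (measurable_cst ((v.1 + x)%R, (v.2 + y)%R)) (@measurable_id _ T setT)).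
  exact: (ge0_integral_shift (w + s * v.1 + t * v.2)%R mfv (fun x => f0 _)).
have LE := @fubini_tonelli1 _ _ _ _ R leb leb _
  (measurableT_comp mF (measurable_sq_shift x y)) (fun x => F0 _).
have RE := @fubini_tonelli1 _ _ _ _ R leb leb _ mF F0.
apply: (etrans LE); apply: (etrans _ (esym RE)).
have mG : measurable_fun setT (fubini_F leb F) by exact: measurable_fun_fubini_tonelli_F.
have G0 u : 0 <= fubini_F leb F u by exact: integral_ge0.
apply: (etrans _ (ge0_integral_shift x mG G0)).
apply: eq_integral => u _; rewrite /fubini_F /=.
exact: (ge0_integral_shift y (measurableT_comp mF (measurable_pair1 (u + x)%R)) (fun x => F0 _)).
Qed.

Lemma ae_shear x y w s t (P : T * T * T -> Prop) :
  {ae haar, forall g, P g} -> {ae haar, forall g, P (shear x y w s t g)}.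
Proof.
move=> [A [mA A0 PA]]; exists (shear x y w s t @^-1` A); split.
- by rewrite -[X in measurable X]setTI; exact: measurable_shear.
- by rewrite haar_shear.
- by move=> g /= nP; apply: PA.
Qed.

End torus.
End ProductIntegrals.

(** * Square integrable functions *)

Section ComplexMeasurable.
Context {R : realType} {d : measure_display} {T : measurableType d}.
Implicit Types f g : T -> R[i].

Definition cmeas f : Prop :=
  measurable_fun setT (fun x => complex.Re (f x)) /\
  measurable_fun setT (fun x => complex.Im (f x)).

Lemma cmeas_cst (k : R[i]) : cmeas (fun=> k).
Proof. by split; exact: measurable_cst. Qed.

Lemma cmeasD f g : cmeas f -> cmeas g -> cmeas (fun x => f x + g x).
Proof.
move=> [fr fi] [gr gi]; split.
  rewrite (_ : (fun _ => _) = (fun x => complex.Re (f x) + complex.Re (g x))).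
    exact: (measurable_funD fr gr).
  by apply/funext => x; rewrite cReD.
rewrite (_ : (fun _ => _) = (fun x => complex.Im (f x) + complex.Im (g x))).
  exact: (measurable_funD fi gi).
by apply/funext => x; rewrite cImD.
Qed.

Lemma cmeasM f g : cmeas f -> cmeas g -> cmeas (fun x => f x * g x).
Proof.
move=> [fr fi] [gr gi]; split.
  rewrite (_ : (fun _ => _) = (fun x => complex.Re (f x) * complex.Re (g x) -
      complex.Im (f x) * complex.Im (g x))).
    exact: (measurable_funB (measurable_funM fr gr) (measurable_funM fi gi)).
  by apply/funext => x; rewrite cReM.
rewrite (_ : (fun _ => _) = (fun x => complex.Re (f x) * complex.Im (g x) +
    complex.Im (f x) * complex.Re (g x))).
  exact: (measurable_funD (measurable_funM fr gi) (measurable_funM fi gr)).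
by apply/funext => x; rewrite cImM.
Qed.

Lemma cmeasZ (k : R[i]) f : cmeas f -> cmeas (fun x => k * f x).
Proof. exact: (cmeasM (cmeas_cst k)). Qed.

Lemma cmeasN f : cmeas f -> cmeas (fun x => - f x).
Proof.
move=> /(cmeasZ (-1)); rewrite (_ : (fun _ => _) = (fun x => - f x))//.
by apply/funext => x; rewrite mulN1r.
Qed.

Lemma cmeasB f g : cmeas f -> cmeas g -> cmeas (fun x => f x - g x).
Proof. by move=> mf mg; exact: (cmeasD mf (cmeasN mg)). Qed.

Lemma cmeasJ f : cmeas f -> cmeas (fun x => conjc (f x)).
Proof.
move=> [fr fi]; split.
  by rewrite (_ : (fun _ => _) = (fun x => complex.Re (f x)))//; apply/funext => x; rewrite cReJ.
rewrite (_ : (fun _ => _) = (fun x => - complex.Im (f x))).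
  exact: (measurable_funN fi).
by apply/funext => x; rewrite cImJ.
Qed.

Lemma cmeas_sum (I : Type) (r : seq I) (F : I -> T -> R[i]) :
  (forall i, cmeas (F i)) -> cmeas (fun x => \sum_(i <- r) F i x).
Proof.
move=> mF; elim: r => [|i r IH].
  rewrite (_ : (fun _ => _) = fun=> 0); first exact: cmeas_cst.
  by apply/funext => x; rewrite big_nil.
rewrite (_ : (fun _ => _) = (fun x => F i x + \sum_(j <- r) F j x)).
  exact: (cmeasD (mF i) IH).
by apply/funext => x; rewrite big_cons.
Qed.

Lemma cmeas_sqmod f : cmeas f -> measurable_fun setT (fun x => sqmod (f x)).
Proof.
move=> [fr fi].
exact: (measurable_funD (measurable_funX 2 fr) (measurable_funX 2 fi)).
Qed.

Lemma cmeas_esqmod f : cmeas f -> measurable_fun setT (fun x => (sqmod (f x))%:E).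
Proof. by move=> mf; apply: (measurable_EFinP _ _).2; exact: cmeas_sqmod. Qed.

Lemma cmeas_expi2pi (t : T -> R) : measurable_fun setT t ->
  cmeas (fun x => expi2pi (t x)).
Proof.
move=> mt.
have mpt : measurable_fun setT (fun x => 2 * pi * t x).
  exact: (measurable_funM (measurable_cst _) mt).
split => /=.
  apply: (measurableT_comp _ mpt).
  by apply: continuous_measurable_fun; exact: continuous_cos.
apply: (measurableT_comp _ mpt).
by apply: continuous_measurable_fun; exact: continuous_sin.
Qed.

End ComplexMeasurable.

Lemma cmeas_comp {R : realType} {d d' : measure_display} {T : measurableType d}
    {S : measurableType d'} (f : T -> R[i]) (h : S -> T) :
  cmeas f -> measurable_fun setT h -> cmeas (fun x => f (h x)).
Proof.
move=> [fr fi] mh; split; first exact: (measurableT_comp fr mh).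
exact: (measurableT_comp fi mh).
Qed.

Section L2.
Context {R : realType} {d : measure_display} {T : measurableType d}.
Variables (mu : {measure set T -> \bar R}) (D : set T).
Hypothesis mD : measurable D.
Implicit Types f g h : T -> R[i].
Notation sqi := (sq_integrable mu D).

(* The squared norm; [fine] makes it 0 when the integral is infinite. *)
Definition nrm2 f : R := fine (\int[mu]_(x in D) (sqmod (f x))%:E).

Lemma sqi_cmeas f : sqi f -> cmeas f.
Proof. by case. Qed.

Lemma sqiP f : sqi f <-> cmeas f /\ mu.-integrable D (fun x => (sqmod (f x))%:E).
Proof.
have E : (\int[mu]_(x in D) `|(sqmod (f x))%:E| = \int[mu]_(x in D) (sqmod (f x))%:E)%E.
  by apply: eq_integral => x _; rewrite gee0_abs ?lee_fin ?sqmod_ge0.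
split=> [[fr fi foo]|[[fr fi] /integrableP[_ foo]]]; last by split=> //; rewrite -E.
split=> //; apply/integrableP; split; last by rewrite E.
by apply: measurable_funTS; exact: cmeas_esqmod.
Qed.

Lemma nrm2E f : sqi f -> (\int[mu]_(x in D) (sqmod (f x))%:E = (nrm2 f)%:E)%E.
Proof.
move=> [_ _ foo]; rewrite /nrm2 fineK// ge0_fin_numE//.
by apply: integral_ge0 => x _; rewrite lee_fin sqmod_ge0.
Qed.

Lemma nrm2_ge0 f : 0 <= nrm2 f.
Proof. by apply: fine_ge0; apply: integral_ge0 => x _; rewrite lee_fin sqmod_ge0. Qed.

Lemma sqi_le f (g : T -> \bar R) : cmeas f -> mu.-integrable D g ->
  (forall x, D x -> ((sqmod (f x))%:E <= g x)%E) -> sqi f.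
Proof.
move=> mf ig le; apply/sqiP; split => //.
apply: (le_integrable mD _ _ ig).
  by apply: measurable_funTS; exact: cmeas_esqmod.
move=> x Dx; rewrite gee0_abs ?lee_fin ?sqmod_ge0//.
by rewrite (le_trans (le x Dx))// lee_abs.
Qed.

Lemma sqiZ (k : R[i]) f : sqi f -> sqi (fun x => k * f x).
Proof.
move=> /sqiP[mf jf].
apply: (@sqi_le _ (fun x => (sqmod k)%:E * (sqmod (f x))%:E)%E).
- exact: cmeasZ.
- exact: integrableZl.
- by move=> x _; rewrite sqmodM EFinM.
Qed.

Lemma sqiD f g : sqi f -> sqi g -> sqi (fun x => f x + g x).
Proof.
move=> /sqiP[mf jf] /sqiP[mg jg].
apply: (@sqi_le _ (fun x => 2%:E * ((sqmod (f x))%:E + (sqmod (g x))%:E))%E).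
- exact: cmeasD.
- by apply: integrableZl => //; exact: integrableD.
- by move=> x _; rewrite -EFinD -EFinM lee_fin sqmodD_le.
Qed.

Lemma sqi0 : sqi (fun=> 0).
Proof.
apply/sqiP; split; first exact: cmeas_cst.
rewrite (_ : (fun _ => _) = cst 0%E); first exact: integrable0.
by apply/funext => x; rewrite sqmod0.
Qed.

Lemma sqiN f : sqi f -> sqi (fun x => - f x).
Proof.
move=> /(sqiZ (-1)); rewrite (_ : (fun _ => _) = (fun x => - f x))//.
by apply/funext => x; rewrite mulN1r.
Qed.

Lemma sqiB f g : sqi f -> sqi g -> sqi (fun x => f x - g x).
Proof. by move=> mf mg; exact: (sqiD mf (sqiN mg)). Qed.

Lemma sqi_sum (I : Type) (r : seq I) (F : I -> T -> R[i]) :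
  (forall i, sqi (F i)) -> sqi (fun x => \sum_(i <- r) F i x).
Proof.
move=> mF; elim: r => [|i r IH].
  rewrite (_ : (fun _ => _) = fun=> 0); first exact: sqi0.
  by apply/funext => x; rewrite big_nil.
rewrite (_ : (fun _ => _) = (fun x => F i x + \sum_(j <- r) F j x)).
  exact: (sqiD (mF i) IH).
by apply/funext => x; rewrite big_cons.
Qed.

Definition cinteg f : Prop :=
  mu.-integrable D (fun x => (complex.Re (f x))%:E) /\
  mu.-integrable D (fun x => (complex.Im (f x))%:E).

Definition cint f : R[i] :=
  (\int[mu]_(x in D) complex.Re (f x)) +i* (\int[mu]_(x in D) complex.Im (f x)).

Lemma L2innerE f g : L2inner mu D f g = cint (fun x => f x * conjc (g x)).
Proof. by []. Qed.

Lemma cinteg_mulJ f g : sqi f -> sqi g -> cinteg (fun x => f x * conjc (g x)).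
Proof.
move=> /sqiP[mf jf] /sqiP[mg jg].
have [m1 m2] := cmeasM mf (cmeasJ mg).
have jfg : mu.-integrable D (fun x => (sqmod (f x))%:E + (sqmod (g x))%:E)%E.
  exact: integrableD.
split.
  apply: (le_integrable mD _ _ jfg).
    by apply/measurable_EFinP; exact: measurable_funTS m1.
  move=> x _; rewrite -EFinD !abse_EFin lee_fin [leRHS](ger0_norm (addr_ge0 (sqmod_ge0 _) (sqmod_ge0 _))).
  exact: normRe_mulJ_le.
apply: (le_integrable mD _ _ jfg).
  by apply/measurable_EFinP; exact: measurable_funTS m2.
move=> x _; rewrite -EFinD !abse_EFin lee_fin [leRHS](ger0_norm (addr_ge0 (sqmod_ge0 _) (sqmod_ge0 _))).
exact: normIm_mulJ_le.
Qed.

Lemma cintD f g : cinteg f -> cinteg g ->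
  cint (fun x => f x + g x) = cint f + cint g.
Proof.
move=> [fr fi] [gr gi]; apply: complexE2 => /=.
  rewrite -[RHS](RintegralD mD fr gr); apply: eq_Rintegral => x _.
  by rewrite cReD.
rewrite -[RHS](RintegralD mD fi gi); apply: eq_Rintegral => x _.
by rewrite cImD.
Qed.

Lemma cintegD f g : cinteg f -> cinteg g -> cinteg (fun x => f x + g x).
Proof.
move=> [fr fi] [gr gi]; split.
  rewrite (_ : (fun _ => _) = fun x => (complex.Re (f x))%:E + (complex.Re (g x))%:E)%E.
    exact: integrableD.
  by apply/funext => x; rewrite cReD.
rewrite (_ : (fun _ => _) = fun x => (complex.Im (f x))%:E + (complex.Im (g x))%:E)%E.
  exact: integrableD.
by apply/funext => x; rewrite cImD.
Qed.

Lemma cintegZ (k : R[i]) f : cinteg f -> cinteg (fun x => k * f x).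
Proof.
move=> [fr fi]; split.
  rewrite (_ : (fun _ => _) = fun x => (complex.Re k)%:E * (complex.Re (f x))%:E
      - (complex.Im k)%:E * (complex.Im (f x))%:E)%E.
    by apply: integrableB => //; exact: integrableZl.
  by apply/funext => x; rewrite cReM.
rewrite (_ : (fun _ => _) = fun x => (complex.Re k)%:E * (complex.Im (f x))%:E
    + (complex.Im k)%:E * (complex.Re (f x))%:E)%E.
  by apply: integrableD => //; exact: integrableZl.
by apply/funext => x; rewrite cImM.
Qed.

Lemma cintZ (k : R[i]) f : cinteg f -> cint (fun x => k * f x) = k * cint f.
Proof.
move=> [fr fi].
have zl (a : R) (g : T -> R) : mu.-integrable D (EFin \o g) -> mu.-integrable D (EFin \o (fun x => a * g x)).
  move=> ig; rewrite (_ : _ \o _ = fun x => (a%:E * (g x)%:E)%E); first exact: integrableZl.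
  by apply/funext.
apply: complexE2; rewrite !ccE /=.
  rewrite -(RintegralZl _ mD fr) -(RintegralZl _ mD fi) -RintegralB//; last 2 first.
    exact: zl.
    exact: zl.
  by apply: eq_Rintegral => x _; rewrite cReM.
rewrite -(RintegralZl _ mD fr) -(RintegralZl _ mD fi) -RintegralD//; last 2 first.
  exact: zl.
  exact: zl.
by apply: eq_Rintegral => x _; rewrite cImM.
Qed.

Lemma eq_cint f g : (forall x, D x -> f x = g x) -> cint f = cint g.
Proof.
move=> fg; apply: complexE2 => /=; apply: eq_Rintegral => x /set_mem Dx;
by rewrite fg.
Qed.

Lemma cinteg0 : cinteg (fun=> 0).
Proof. by split; exact: integrable0. Qed.

Lemma cint0 : cint (fun=> 0) = 0.
Proof. by apply: complexE2; rewrite /= /Rintegral integral0. Qed.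

Lemma cinteg_sum (I : Type) (r : seq I) (F : I -> T -> R[i]) :
  (forall i, cinteg (F i)) -> cinteg (fun x => \sum_(i <- r) F i x).
Proof.
move=> mF; elim: r => [|i r IH].
  rewrite (_ : (fun _ => _) = fun=> 0); first exact: cinteg0.
  by apply/funext => x; rewrite big_nil.
rewrite (_ : (fun _ => _) = (fun x => F i x + \sum_(j <- r) F j x)).
  exact: (cintegD (mF i) IH).
by apply/funext => x; rewrite big_cons.
Qed.

Lemma cint_sum (I : Type) (r : seq I) (F : I -> T -> R[i]) :
  (forall i, cinteg (F i)) ->
  cint (fun x => \sum_(i <- r) F i x) = \sum_(i <- r) cint (F i).
Proof.
move=> mF; elim: r => [|i r IH].
  rewrite big_nil -[RHS]cint0; congr cint.
  by apply/funext => x; rewrite big_nil.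
rewrite big_cons -IH -(cintD (mF i) (cinteg_sum r mF)); congr cint.
by apply/funext => x; rewrite big_cons.
Qed.

Lemma L2innerDl f g h : sqi f -> sqi g -> sqi h ->
  L2inner mu D (fun x => f x + g x) h = L2inner mu D f h + L2inner mu D g h.
Proof.
move=> jf jg jh; rewrite !L2innerE -cintD; [|exact: cinteg_mulJ..].
by congr cint; apply/funext => x; rewrite mulrDl.
Qed.

Lemma L2innerZl (k : R[i]) f h : sqi f -> sqi h ->
  L2inner mu D (fun x => k * f x) h = k * L2inner mu D f h.
Proof.
move=> jf jh; rewrite !L2innerE -cintZ; last exact: cinteg_mulJ.
by congr cint; apply/funext => x; rewrite mulrA.
Qed.

Lemma nrm2_Rint f : nrm2 f = \int[mu]_(x in D) sqmod (f x).
Proof. by []. Qed.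

Lemma L2inner_nrm2 f : L2inner mu D f f = (nrm2 f)%:C.
Proof.
apply: complexE2 => /=.
  by rewrite nrm2_Rint; apply: eq_Rintegral => x _; rewrite mulJ_sqmod.
under eq_Rintegral do rewrite mulJ_sqmod /=.
by rewrite /Rintegral integral0.
Qed.

Lemma nrm2D f g : sqi f -> sqi g ->
  nrm2 (fun x => f x + g x) = nrm2 f + nrm2 g + 2 * complex.Re (L2inner mu D f g).
Proof.
move=> jf jg; have [/sqiP[_ if_] /sqiP[_ ig]] := (jf, jg).
have [jr _] := cinteg_mulJ jf jg.
rewrite !nrm2_Rint /= -(RintegralD mD if_ ig) -(RintegralZl 2 mD jr) -RintegralD//.
- by apply: eq_Rintegral => x _; rewrite /sqmod !ccE; ring.
- rewrite (_ : _ \o _ = fun x => (sqmod (f x))%:E + (sqmod (g x))%:E)%E; last by apply/funext.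
  exact: integrableD.
- rewrite (_ : _ \o _ = fun x => 2%:E * (complex.Re (f x * conjc (g x)))%:E)%E; last by apply/funext.
  exact: integrableZl.
Qed.

Lemma nrm2Z (k : R[i]) f : sqi f -> nrm2 (fun x => k * f x) = sqmod k * nrm2 f.
Proof.
move=> /sqiP[_ jf]; rewrite !nrm2_Rint -RintegralZl//.
by apply: eq_Rintegral => x _; rewrite sqmodM.
Qed.

Lemma eq_nrm2 f g : (forall x, D x -> f x = g x) -> nrm2 f = nrm2 g.
Proof.
by move=> fg; rewrite /nrm2; congr fine; apply: eq_integral => x /set_mem Dx; rewrite fg.
Qed.

(** The substitute for the triangle inequality. Pointwise, the right side minus the left is |sqrt t
    f - g / sqrt t|^2; for small [t] the coefficient of [nrm2 f] is close to 1. *)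
Lemma nrm2_young (t : R) f g : 0 < t -> sqi f -> sqi g ->
  nrm2 (fun x => f x + g x) <= (1 + t) * nrm2 f + (1 + t^-1) * nrm2 g.
Proof.
move=> t0 jf jg; have [/sqiP[_ if_] /sqiP[_ ig]] := (jf, jg).
have /sqiP[_ ifg] := sqiD jf jg.
have zl (a : R) (h : T -> R) : mu.-integrable D (EFin \o h) -> mu.-integrable D (EFin \o (fun x => a * h x)).
  move=> ih; rewrite (_ : _ \o _ = fun x => (a%:E * (h x)%:E)%E); first exact: integrableZl.
  by apply/funext.
have i1 := zl (1 + t) _ if_; have i2 := zl (1 + t^-1) _ ig.
rewrite !nrm2_Rint -(RintegralZl _ mD if_) -(RintegralZl _ mD ig) -(RintegralD mD i1 i2).
apply: le_Rintegral => //.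
  rewrite (_ : _ \o _ = fun x => ((1 + t) * sqmod (f x))%:E + ((1 + t^-1) * sqmod (g x))%:E)%E;
    last by apply/funext.
  exact: integrableD.
move=> x _.
have sqt : t = Num.sqrt t ^+ 2 by rewrite sqr_sqrtr// ltW.
have st0 : Num.sqrt t != 0 by rewrite sqrtr_eq0 -ltNge.
have st1 : t^-1 = (Num.sqrt t)^-1 ^+ 2 by rewrite {1}sqt exprVn.
rewrite -subr_ge0.
rewrite [leRHS](_ : _ = (Num.sqrt t * complex.Re (f x) - (Num.sqrt t)^-1 * complex.Re (g x)) ^+ 2 +
  (Num.sqrt t * complex.Im (f x) - (Num.sqrt t)^-1 * complex.Im (g x)) ^+ 2).
  by rewrite addr_ge0 ?sqr_ge0.
rewrite {1}st1 {1}sqt /sqmod !ccE; field.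
exact: st0.
Qed.

Lemma nrm2_addle f g : sqi f -> sqi g ->
  nrm2 (fun x => f x + g x) <= 2 * nrm2 f + 2 * nrm2 g.
Proof.
by move=> jf jg; have := nrm2_young ltr01 jf jg; rewrite invr1.
Qed.

Lemma nrm2_tri f g h : sqi f -> sqi g -> sqi h ->
  nrm2 (fun x => f x - h x) <= 2 * nrm2 (fun x => f x - g x) + 2 * nrm2 (fun x => g x - h x).
Proof.
move=> jf jg jh; rewrite -[leLHS](@eq_nrm2 (fun x => (f x - g x) + (g x - h x))).
  by apply: nrm2_addle; exact: sqiB.
by move=> x _; rewrite addrA subrK.
Qed.

Lemma nrm2_sym f g : nrm2 (fun x => f x - g x) = nrm2 (fun x => g x - f x).
Proof. by rewrite /nrm2; congr fine; apply: eq_integral => x _; rewrite sqmodB_sym. Qed.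

Lemma L2dist2E f g : sqi f -> sqi g ->
  L2dist2 mu D f g = (nrm2 (fun x => f x - g x))%:E.
Proof. by move=> jf jg; apply: nrm2E; exact: sqiB. Qed.

Lemma L2cvgP (u : nat -> T -> R[i]) f : (forall n, sqi (u n)) -> sqi f ->
  L2cvg mu D u f <-> (fun n => nrm2 (fun x => u n x - f x)) @ \oo --> 0.
Proof.
move=> ju jf; rewrite /L2cvg.
rewrite (_ : (fun n => _) = EFin \o (fun n => nrm2 (fun x => u n x - f x))).
  split=> [/fine_cvgP[_]//|h]; apply: (fine_cvgP _ _).2; split => //.
  exact: nearW.
by apply/funext => n; rewrite L2dist2E.
Qed.

End L2.

(** * Completeness of L2 and density by orthogonal projection *)

Section Completeness.
Context {R : realType}.

Lemma half_pow_lt (K e : R) : 0 < e -> \forall n \near \oo, K * 2^-1 ^+ n < e.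
Proof.
move=> e0; have h1 : `|2^-1 : R| < 1 by rewrite ger0_norm ?invr_ge0// invf_lt1// ltr1n.
have := cvg_geometric K h1 => /cvgrPdist_lt /(_ _ e0).
apply: filterS => n; rewrite /geometric/= sub0r normrN.
by apply: le_lt_trans; exact: ler_norm.
Qed.

Lemma geometric_cauchy_cvgn (a : nat -> R) (K : R) :
  (forall n m, (a (n + m)%N - a n) ^+ 2 <= K * 2^-1 ^+ n) -> cvgn a.
Proof.
move=> aK; apply/cauchy_cvgP/cauchyP => e e0.
have [n _ nK] := half_pow_lt K (exprn_gt0 2 e0).
exists (a n); exists n => // m /= nm.
rewrite /ball/= -(ltr_pXn2r (n := 2))// ?nnegrE ?normr_ge0 ?ltW//.
rewrite real_normK ?num_real// -[_ - _]opprB sqrrN -(subnKC nm).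
exact: (le_lt_trans (aK _ _) (nK _ (leqnn n))).
Qed.

Lemma fine_limn_esup (a : nat -> R) : cvgn a ->
  fine (limn_esup (fun n => (a n)%:E)) = limn a.
Proof.
move=> ca; have h : (fun n => (a n)%:E) @ \oo --> (limn a)%:E.
  by apply: cvg_EFin => //; exact: nearW.
by rewrite is_cvg_limn_esupE ?(cvg_lim _ h)//; apply/cvg_ex; exists (limn a)%:E.
Qed.

Context {d : measure_display} {T : measurableType d}.
Variables (mu : {measure set T -> \bar R}) (D : set T).
Hypothesis mD : measurable D.

(** Riesz-Fischer for representatives. Where the weighted series [S] is finite the sequence
    converges at a geometric rate; where it is infinite the bound [c4] is void. Since [S] has
    integral at most 2, [c4] integrates to the conclusion. *)
Lemma L2_complete (u : nat -> T -> R[i]) :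
  (forall n, sq_integrable mu D (u n)) ->
  (forall n, nrm2 mu D (fun x => u n.+1 x - u n x) <= 4^-1 ^+ n) ->
  exists2 f, sq_integrable mu D f &
    forall n, nrm2 mu D (fun x => f x - u n x) <= 4 * 2^-1 ^+ n.
Proof.
move=> ju du.
pose v n x := u n.+1 x - u n x.
have jv n : sq_integrable mu D (v n) by exact: sqiB.
(* The weights 2^k absorb the factors 2 from iterating [sqmodD_le] in [c1]; as the k-th increment
   has squared norm at most 4^-k, the weighted sum still has integral at most 2. *)
pose S x : \bar R := (\sum_(0 <= k <oo) (2 ^+ k * sqmod (v k x))%:E)%E.
have t0 k x : (0 <= (2 ^+ k * sqmod (v k x))%:E)%E.
  by rewrite lee_fin mulr_ge0 ?sqmod_ge0// exprn_ge0.
have S0 x : (0 <= S x)%E by apply: nneseries_ge0 => *; exact: t0.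
have mt k : measurable_fun setT (fun x => (2 ^+ k * sqmod (v k x))%:E).
  apply: (measurable_EFinP _ _).2; apply: (measurable_funM (measurable_cst _)).
  by apply: cmeas_sqmod; exact: (sqi_cmeas (jv k)).
have mS : measurable_fun setT S.
  exact: (@ge0_emeasurable_sum _ _ _ _ (fun k x => (2 ^+ k * sqmod (v k x))%:E) xpredT
    (fun k x _ _ => t0 k x) (fun k _ => mt k)).
have intS : (\int[mu]_(x in D) S x <= 2%:E)%E.
  rewrite integral_nneseries//; last by move=> k; exact: measurable_funTS (mt k).
  apply: lime_le.
    by apply: is_cvg_nneseries => k _ _; exact: integral_ge0.
  apply: nearW => n.
  apply: (@le_trans _ _ (\sum_(0 <= k < n) (2^-1 ^+ k)%:E)%E).
    apply: lee_sum => k _.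
    have /sqiP[mv iv] := jv k.
    under eq_integral do rewrite EFinM.
    rewrite ge0_integralZl_EFin ?exprn_ge0//; last 2 first.
      by move=> x _; rewrite lee_fin sqmod_ge0.
      by apply: measurable_funTS; exact: cmeas_esqmod.
    rewrite (nrm2E (jv k)) -EFinM lee_fin.
    apply: (le_trans (ler_wpM2l (exprn_ge0 k _) (du k))) => //.
    rewrite -exprMn; apply: lerXn2r; rewrite ?nnegrE; lra.
  rewrite sumEFin lee_fin big_mkord.
  have h : forall m, \sum_(k < m) 2^-1 ^+ k = 2 - 2 * 2^-1 ^+ m :> R.
    elim=> [|m IH]; first by rewrite big_ord0 expr0; ring.
    by rewrite big_ord_recr/= IH exprS; lra.
  by rewrite h gerBl mulr_ge0// exprn_ge0// invr_ge0.
have c1 m n x : sqmod (u (n + m)%N x - u n x) <=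
    \sum_(k < m) 2 ^+ k.+1 * sqmod (v (n + k)%N x).
  elim: m n => [|m IH] n; first by rewrite addn0 subrr sqmod0 big_ord0.
  rewrite big_ord_recl/= addn0 expr1.
  have -> : u (n + m.+1)%N x - u n x = v n x + (u (n.+1 + m)%N x - u n.+1 x).
    by rewrite /v addSnnS; ring.
  apply: (le_trans (sqmodD_le _ _)); rewrite mulrDr lerD2l.
  apply: (le_trans (ler_wpM2l _ (IH _))) => //.
  rewrite mulr_sumr; apply: ler_sum => k _.
  by rewrite /bump/= add1n addSnnS mulrA -exprS.
have c2 m n x : ((sqmod (u (n + m)%N x - u n x))%:E <= (2 * 2^-1 ^+ n)%:E * S x)%E.
  apply: (@le_trans _ _ ((2 * 2^-1 ^+ n)%:E * (\sum_(0 <= k < n + m) (2 ^+ k * sqmod (v k x))%:E))%E); last first.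
    rewrite lee_wpmul2l ?lee_fin ?mulr_ge0 ?exprn_ge0 ?invr_ge0//.
    by apply: nneseries_lim_ge => *; exact: t0.
  rewrite sumEFin -EFinM lee_fin; apply: (le_trans (c1 _ _ _)).
  rewrite (big_cat_nat _ (n := n))//= ?leq_addr// mulrDr -[leLHS]add0r lerD//.
    rewrite !mulr_ge0 ?exprn_ge0 ?invr_ge0// sumr_ge0// => k _.
    by rewrite mulr_ge0 ?exprn_ge0 ?sqmod_ge0.
  rewrite -[X in \big[_/_]_(X <= _ < _) _]add0n big_addn addKn big_mkord mulr_sumr.
  apply: ler_sum => k _; rewrite [(k + n)%N]addnC exprD.
  rewrite le_eqVlt; apply/orP; left; apply/eqP.
  rewrite exprS exprVn; field; exact: expf_neq0.
(* An upper limit is measurable and always exists, and [fine] makes it real even where the sequence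
   diverges. *)
pose f x : R[i] := fine (limn_esup (fun n => (complex.Re (u n x))%:E)) +i*
  fine (limn_esup (fun n => (complex.Im (u n x))%:E)).
have mf : cmeas f.
  split => /=; apply: (measurableT_comp (fine_measurable measurableT));
    apply: measurable_fun_limn_esup => n; apply: (measurable_EFinP _ _).2.
    by have [] := sqi_cmeas (ju n).
  by have [] := sqi_cmeas (ju n).
have c4 n x : ((sqmod (f x - u n x))%:E <= (2 * 2^-1 ^+ n)%:E * S x)%E.
  case ES : (S x) (S0 x) => [s| |//] s0; last first.
    by rewrite gt0_muley ?leey// lte_fin mulr_gt0// exprn_gt0// invr_gt0.
  have c2' k m : sqmod (u (k + m)%N x - u k x) <= 2 * s * 2^-1 ^+ k.
    by have := c2 m k x; rewrite ES -EFinM lee_fin mulrAC.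
  have cr : cvgn (fun k => complex.Re (u k x)).
    apply: (@geometric_cauchy_cvgn _ (2 * s)) => k m; apply: le_trans (c2' k m).
    by rewrite /sqmod !ccE lerDl sqr_ge0.
  have ci : cvgn (fun k => complex.Im (u k x)).
    apply: (@geometric_cauchy_cvgn _ (2 * s)) => k m; apply: le_trans (c2' k m).
    by rewrite /sqmod !ccE lerDr sqr_ge0.
  have er : fine (limn_esup (fun n => (complex.Re (u n x))%:E)) = limn (fun k => complex.Re (u k x)).
    exact: fine_limn_esup.
  have ei : fine (limn_esup (fun n => (complex.Im (u n x))%:E)) = limn (fun k => complex.Im (u k x)).
    exact: fine_limn_esup.
  rewrite -EFinM lee_fin.
  pose w k := (complex.Re (u k x) - complex.Re (u n x)) ^+ 2 +
    (complex.Im (u k x) - complex.Im (u n x)) ^+ 2.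
  have wf : w @ \oo --> sqmod (f x - u n x).
    rewrite /sqmod !ccE /= er ei.
    by apply: cvgD; rewrite expr2; apply: cvgM; apply: cvgB => //; exact: cvg_cst.
  rewrite -(cvg_lim _ wf)//; apply: limr_le; first by apply/cvg_ex; exists (sqmod (f x - u n x)).
  exists n => // k /= nk.
  have := c2' n (k - n)%N; rewrite subnKC// mulrAC; apply: le_trans.
  by rewrite /w /sqmod !ccE.
have iS : mu.-integrable D S.
  apply/integrableP; split; first exact: measurable_funTS.
  under eq_integral do rewrite gee0_abs//.
  by rewrite (le_lt_trans intS)// ltry.
have jd n : sq_integrable mu D (fun x => f x - u n x).
  apply: (sqi_le mD (g := fun x => ((2 * 2^-1 ^+ n)%:E * S x)%E)).
  - by apply: cmeasB => //; exact: (sqi_cmeas (ju n)).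
  - exact: integrableZl.
  - by move=> x _; exact: c4.
exists f.
  have := sqiD mD (jd 0%N) (ju 0%N).
  by rewrite (_ : (fun _ => _) = f)//; apply/funext => x; rewrite subrK.
move=> n; rewrite -lee_fin -nrm2E//.
apply: (@le_trans _ _ (\int[mu]_(x in D) ((2 * 2^-1 ^+ n)%:E * S x)%E)%E).
  apply: ge0_le_integral => //.
  - by move=> x _; rewrite lee_fin sqmod_ge0.
  - by apply: measurable_funTS; apply: cmeas_esqmod; exact: (sqi_cmeas (jd n)).
  - by apply: measurable_funTS; apply: emeasurable_funM => //; exact: measurable_cst.
rewrite ge0_integralZl_EFin//; last exact: measurable_funTS.
have p0 : 0 <= 2 * 2^-1 ^+ n :> R by rewrite mulr_ge0// exprn_ge0// invr_ge0.
apply: (le_trans (lee_wpmul2l _ intS)); first by rewrite lee_fin.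
by rewrite -EFinM lee_fin; lra.
Qed.

End Completeness.

Section Density.
Context {R : realType} {d : measure_display} {T : measurableType d}.
Variables (mu : {measure set T -> \bar R}) (D : set T).
Hypothesis mD : measurable D.
Variables Z S : set (T -> R[i]).
Hypothesis Zsqi : forall f, Z f -> sq_integrable mu D f.
Hypothesis ZD : forall k f g, Z f -> Z g -> Z (fun x => k * f x + g x).
Hypothesis Z_complete : forall u : nat -> T -> R[i], (forall n, Z (u n)) ->
  (forall n, nrm2 mu D (fun x => u n.+1 x - u n x) <= 4^-1 ^+ n) ->
  exists2 f, Z f & forall n, nrm2 mu D (fun x => f x - u n x) <= 4 * 2^-1 ^+ n.
Hypothesis SZ : S `<=` Z.
Hypothesis S0 : S (fun=> 0).
Hypothesis SD : forall k f g, S f -> S g -> S (fun x => k * f x + g x).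
Hypothesis S_perp : forall h, Z h -> (forall s, S s -> L2inner mu D s h = 0) ->
  nrm2 mu D h = 0.

Notation N := (nrm2 mu D).

(** How limits of squared norms are taken after [nrm2_young]: [n] goes to infinity, then [t] to 0.
    If b < a, the chosen [t] makes t b < (a - b) / 2; the [b + 1] avoids a zero denominator. *)
Lemma ler_limit_young (a b c : R) :
  0 <= b ->
  (forall t : R, 0 < t -> forall n, a <= (1 + t) * (b + c * 2^-1 ^+ n) + (1 + t^-1) * (4 * 2^-1 ^+ n)) ->
  a <= b.
Proof.
move=> b0 h; rewrite leNgt; apply/negP => ab.
pose t := (a - b) / (2 * (b + 1)).
have b1 : 0 < b + 1 by rewrite ltr_wpDl.
have t0 : 0 < t by rewrite divr_gt0 ?subr_gt0// mulr_gt0.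
have tE : t * (2 * (b + 1)) = a - b by rewrite divfK// mulf_neq0// gt_eqF.
have ab2 : 0 < (a - b) / 2 by rewrite divr_gt0 ?subr_gt0.
have [n _ hn] := half_pow_lt ((1 + t) * c + (1 + t^-1) * 4) ab2.
have := hn _ (leqnn n); have := h t t0 n.
by rewrite mulrDr; lra.
Qed.

(** [S] need not be closed, so the point [sg] nearest to [th] is found in [Z], as the limit of a
    minimizing sequence from [S]. The difference [eta] is orthogonal to [S], hence of norm 0, and so
    the minimizing sequence itself approximates [th]. *)
Lemma L2_density th : Z th -> forall e : R, 0 < e -> exists2 s, S s & N (fun x => th x - s x) < e.
Proof.
move=> Zth.
pose E := [set N (fun x => th x - s x) | s in S].
have E0 : has_inf E.
  split; first by exists (N (fun x => th x - 0)); exists (fun=> 0).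
  by exists 0 => _ [s _ <-]; exact: nrm2_ge0.
pose dl := inf E.
have dl_le s : S s -> dl <= N (fun x => th x - s x).
  by move=> Ss; apply: ge_inf; [exact: E0.2|exists s].
have dl0 : 0 <= dl by apply: lb_le_inf; [exact: E0.1|move=> _ [s _ <-]; exact: nrm2_ge0].
(* If the n-th term exceeds the infimum by at most e_n, the parallelogram law bounds the n-th
   increment by 2 (e_n + e_(n+1)) <= 4 e_n; the factor 4^-1 makes this 4^-n. *)
have ep n : 0 < 4^-1 * 4^-1 ^+ n :> R by rewrite mulr_gt0 ?exprn_gt0 ?invr_gt0.
have /choice[s sP] n : exists s, S s /\ N (fun x => th x - s x) < dl + 4^-1 * 4^-1 ^+ n.
  by have [_ [s Ss <-] lt] := inf_adherent (ep n) E0; exists s.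
have jth := Zsqi Zth.
have js n : sq_integrable mu D (s n) by apply/Zsqi/SZ; have [] := sP n.
have sc n : N (fun x => s n.+1 x - s n x) <= 4^-1 ^+ n.
  pose f1 x := th x - s n x; pose f2 x := th x - s n.+1 x.
  have j1 : sq_integrable mu D f1 by exact: sqiB.
  have j2 : sq_integrable mu D f2 by exact: sqiB.
  have Sm : S (fun x => 2^-1 * s n x + (2^-1 * s n.+1 x + 0)).
    by apply: SD; [have [] := sP n|apply: SD => //; have [] := sP n.+1].
  have := dl_le _ Sm.
  have P1 := nrm2D mD j1 j2; have P2 := nrm2D mD j1 (sqiN mD j2).
  have P3 : N (fun x => f1 x + f2 x) =
      4 * N (fun x => th x - (2^-1 * s n x + (2^-1 * s n.+1 x + 0))).
    have -> : 4 = sqmod (1 + 1 : R[i]) :> R by rewrite /sqmod !ccE /=; ring.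
    rewrite -nrm2Z//; last by apply: sqiB => //; exact/Zsqi/SZ.
    by apply: eq_nrm2 => x _; rewrite /f1 /f2; field.
  have P4 : N (fun x => f1 x + (- f2 x)) = N (fun x => s n.+1 x - s n x).
    by apply: eq_nrm2 => x _; rewrite /f1 /f2; ring.
  have P5 : N (fun x => - f2 x) = N f2.
    by rewrite /nrm2; congr fine; apply: eq_integral => x _; rewrite sqmodN.
  have P6 : complex.Re (L2inner mu D f1 (fun x => - f2 x)) = - complex.Re (L2inner mu D f1 f2).
    have jr := (cinteg_mulJ mD j1 j2).1.
    rewrite /= -mulN1r -RintegralZl//; apply: eq_Rintegral => x _.
    by rewrite !ccE; ring.
  have [_ h1] := sP n; have [_ h2] := sP n.+1; rewrite -/f1 -/f2 in h1 h2.
  move: P1 P2; rewrite P3 P4 P5 P6 => P1 P2.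
  have h3 : 4^-1 * 4^-1 ^+ n.+1 <= 4^-1 * 4^-1 ^+ n :> R.
    by rewrite exprS; have := ep n; lra.
  move: P1 P2 h1 h2 h3; rewrite -/(N f1) -/(N f2); lra.
have [sg Zsg sgP] := Z_complete (fun n => SZ (sP n).1) sc.
have jsg := Zsqi Zsg.
pose eta x := th x - sg x.
have jeta : sq_integrable mu D eta by exact: sqiB.
have Zeta : Z eta.
  have := ZD (-1) Zsg Zth; rewrite (_ : (fun _ => _) = eta)//.
  by apply/funext => x; rewrite /eta; ring.
have eta_le : N eta <= dl.
  apply: (@ler_limit_young _ _ 1) => // t t0 n.
  have ti0 : 0 < t^-1 by rewrite invr_gt0.
  have jd1 : sq_integrable mu D (fun x => th x - s n x) by exact: sqiB.
  have jd2 : sq_integrable mu D (fun x => - (sg x - s n x)) by apply: sqiN => //; exact: sqiB.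
  have := nrm2_young mD t0 jd1 jd2.
  rewrite (@eq_nrm2 _ _ _ mu D _ eta); last by move=> x _; rewrite /eta; ring.
  move/le_trans; apply; apply: lerD; apply: ler_wpM2l; first lra.
  - have [_ /ltW h] := sP n; apply: (le_trans h); rewrite lerD2l mul1r.
    apply: (@le_trans _ _ (4^-1 ^+ n)).
      by rewrite ler_piMl ?exprn_ge0 ?invr_ge0// invf_le1// ler1n.
    by apply: lerXn2r; rewrite ?nnegrE; lra.
  - lra.
  - apply: le_trans (sgP n); rewrite [leLHS](_ : _ = N (fun x => sg x - s n x))//.
    by rewrite /nrm2; congr fine; apply: eq_integral => x _; rewrite sqmodN.
have eta_min r : S r -> dl <= N (fun x => eta x - r x).
  move=> Sr; apply: (@ler_limit_young _ _ 0); first exact: nrm2_ge0.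
  move=> t t0 n.
  have ti0 : 0 < t^-1 by rewrite invr_gt0.
  have jr := Zsqi (SZ Sr).
  have jd1 : sq_integrable mu D (fun x => eta x - r x) by exact: sqiB.
  have jd2 : sq_integrable mu D (fun x => sg x - s n x) by exact: sqiB.
  have Sr' := SD 1 Sr (sP n).1.
  apply: (le_trans (dl_le _ Sr')).
  rewrite (@eq_nrm2 _ _ _ mu D _ (fun x => (eta x - r x) + (sg x - s n x))); last first.
    by move=> x _; rewrite /eta; ring.
  apply: (le_trans (nrm2_young mD t0 jd1 jd2)).
  rewrite mul0r addr0 lerD2l ler_wpM2l//; lra.
have eta0 : N eta = 0.
  apply: S_perp => // r Sr; apply/eqP; rewrite -sqmod_eq0; apply/eqP.
  have jr := Zsqi (SZ Sr).
  set I := L2inner mu D r eta.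
  (* First variation: subtracting k r with k = t conj(I) from [eta] changes the squared norm by t^2
     |I|^2 N r - 2 t |I|^2, which minimality forbids to be negative. *)
  have key (t : R) : 0 < t -> 2 * t * sqmod I <= t ^+ 2 * sqmod I * N r.
    move=> t0; pose k := conjc I * t%:C.
    have Sk : S (fun x => k * r x).
      by have := SD k Sr S0; rewrite (_ : (fun _ => _) = (fun x => k * r x))//; apply/funext => x; rewrite addr0.
    have := eta_min _ Sk.
    have jk : sq_integrable mu D (fun x => - k * r x) by exact: sqiZ.
    rewrite (@eq_nrm2 _ _ _ mu D _ (fun x => - k * r x + eta x)); last first.
      by move=> x _; rewrite mulNr addrC.
    rewrite nrm2D// nrm2Z// L2innerZl// -/I.
    have -> : sqmod (- k) = t ^+ 2 * sqmod I.
      by rewrite sqmodN sqmodM sqmodJ [RHS]mulrC; congr (_ * _); rewrite /sqmod /= expr0n addr0.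
    have -> : complex.Re (- k * I) = - (t * sqmod I).
      by rewrite /k /sqmod !ccE /=; ring.
    by move=> h; have := eta_le; lra.
  have Nr0 := nrm2_ge0 mu D r.
  have I0 := sqmod_ge0 I.
  (* For this [t] the product t N r is at most 1, so the quadratic term is at most half of the
     linear one. *)
  have t0 : 0 < (1 + N r)^-1 by rewrite invr_gt0; lra.
  have := key _ t0; set t := _^-1 in t0 *.
  have tN : t * N r <= 1.
    by rewrite mulrC ler_pdivrMr; lra.
  move=> h; apply/eqP; rewrite eq_le I0 andbT.
  have h1 : t * (t * N r) * sqmod I <= t * sqmod I.
    by apply: ler_wpM2r => //; rewrite ler_piMr// ltW.
  have h2 : t * sqmod I <= 0 by rewrite expr2 in h; lra.
  by rewrite pmulr_rle0 in h2.
move=> e e0.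
have [n _ hn] := half_pow_lt 8 e0.
exists (s n); first by have [] := sP n.
have jd1 : sq_integrable mu D (fun x => sg x - s n x) by exact: sqiB.
rewrite (@eq_nrm2 _ _ _ mu D _ (fun x => eta x + (sg x - s n x))); last first.
  by move=> x _; rewrite /eta; ring.
apply: (le_lt_trans (nrm2_addle mD jeta jd1)); rewrite eta0 mulr0 add0r.
apply: le_lt_trans (hn _ (leqnn n)); have := sgP n; lra.
Qed.

End Density.

(** * Uniqueness of Fourier coefficients on the torus *)

Section PolynomialStep.
Context {R : realType}.

Lemma bernoulli_ge (x : R) (n : nat) : -1 <= x -> 1 + n%:R * x <= (1 + x) ^+ n.
Proof.
move=> x1; elim: n => [|n IH]; first by rewrite mul0r addr0 expr0.
rewrite exprS -natr1; apply: le_trans (ler_wpM2l _ IH); last lra.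
by have := mulr_ge0 (ler0n R n) (sqr_ge0 x); rewrite expr2; nra.
Qed.

(** With q = sqrt s one has s^n = q^n q^n, and Bernoulli's inequality for 1/q = 1 + u bounds n q^n
    by 1/u. *)
Lemma cvg_nat_geometric (s : R) : 0 <= s < 1 -> (fun n => n%:R * s ^+ n) @ \oo --> (0 : R).
Proof.
move=> /andP[s0 s1].
have [->|sn0] := eqVneq s 0.
  rewrite (_ : (fun n => _) = fun=> 0); first exact: cvg_cst.
  by apply/funext => -[|n]; rewrite ?mul0r// exprS mul0r mulr0.
have {sn0} s_gt0 : 0 < s by rewrite lt_def sn0.
pose q := Num.sqrt s.
have q0 : 0 < q by rewrite sqrtr_gt0.
have q1 : q < 1 by rewrite -sqrtr1 ltr_sqrt.
pose u := q^-1 - 1.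
have u0 : 0 < u by rewrite subr_gt0 invf_gt1.
have le n : n%:R * s ^+ n <= u^-1 * q ^+ n.
  have -> : s ^+ n = q ^+ n * q ^+ n by rewrite -exprMn -expr2 sqr_sqrtr ?ltW.
  rewrite mulrA; apply: ler_wpM2r; first by rewrite exprn_ge0// ltW.
  rewrite -[leRHS]mul1r ler_pdivlMr// mulrAC -ler_pdivlMr ?exprn_gt0// mul1r -exprVn.
  have -> : q^-1 = 1 + u by rewrite /u; ring.
  have u1 : -1 <= u by lra.
  have := bernoulli_ge n u1; lra.
apply: (@squeeze_cvgr _ _ _ _ (fun=> 0) (fun n => u^-1 * q ^+ n)).
- by near=> n; rewrite le mulr_ge0// exprn_ge0// ltW.
- exact: cvg_cst.
- by have := @cvg_geometric R u^-1 q; rewrite ger0_norm ?ltW// => /(_ q1).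
Unshelve. all: by end_near.
Qed.

(* By Bernoulli's inequality these polynomials tend to 1 on [0, 1/2[ and to 0 on
   [1/2, 1], which replaces the Weierstrass approximation theorem. *)
Definition step_poly (n : nat) (t : R) : R := (1 - t ^+ n) ^+ (n * 2 ^ n).

Lemma step_poly_01 n t : 0 <= t <= 1 -> 0 <= step_poly n t <= 1.
Proof.
move=> /andP[t0 t1]; have h0 := exprn_ge0 n t0; have h1 := exprn_ile1 n t0 t1.
by rewrite exprn_ge0 ?subr_ge0//= exprn_ile1//; lra.
Qed.

(** Below 1/2, Bernoulli gives the lower bound 1 - n (2t)^n. From 1/2 on, (1 - t^n)(1 + t^n) <= 1
    bounds the polynomial by the inverse of (1 + t^n)^(n 2^n), which is at least n + 1. *)
Lemma cvg_step_poly t : 0 <= t <= 1 ->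
  (fun n => step_poly n t) @ \oo --> ((t < 2^-1)%R%:R : R).
Proof.
move=> t01; have /andP[t0 t1] := t01; case: ltP => ht /=.
  have h := @cvg_nat_geometric (2 * t) _.
  have {}h : (fun n => 1 - n%:R * (2 * t) ^+ n) @ \oo --> (1 - 0 : R).
    by apply: cvgB; [exact: cvg_cst|apply: h; lra].
  rewrite subr0 in h.
  apply: (@squeeze_cvgr _ _ _ _ (fun n => 1 - n%:R * (2 * t) ^+ n) (fun=> 1)) => //; last exact: cvg_cst.
  near=> n; have /andP[_ ->] := step_poly_01 n t01; rewrite andbT /step_poly.
  have x1 : -1 <= - t ^+ n by rewrite lerN2 exprn_ile1.
  apply: le_trans (bernoulli_ge (n * 2 ^ n) x1).
  by rewrite natrM natrX exprMn mulrN mulrA.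
apply: (@squeeze_cvgr _ _ _ _ (fun=> 0) harmonic).
- near=> n; have /andP[-> _] := step_poly_01 n t01; rewrite /step_poly /harmonic/=.
  have h0 := exprn_ge0 n t0; have h1 := exprn_ile1 n t0 t1.
  have tn : 2^-1 ^+ n <= t ^+ n by rewrite lerXn2r// nnegrE// invr_ge0.
  rewrite -[leRHS]mul1r ler_pdivlMr ?ltr0n//.
  have : n.+1%:R <= (1 + t ^+ n) ^+ (n * 2 ^ n).
    have x1 : -1 <= t ^+ n by rewrite (le_trans _ h0)// lerN10.
    apply: le_trans (bernoulli_ge _ x1).
    rewrite -natr1 addrC lerD2l natrM natrX -mulrA ler_peMr//.
    rewrite -(ler_pM2l (_ : 0 < 2^-1 ^+ n)) ?exprn_gt0 ?invr_gt0//.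
    by rewrite mulr1 mulrA -exprMn mulVf// expr1n mul1r.
  move=> /(ler_wpM2l (exprn_ge0 (n * 2 ^ n) (_ : 0 <= 1 - t ^+ n))).
  rewrite subr_ge0 h1 => /(_ isT) /le_trans; apply.
  rewrite -exprMn exprn_ile1//; first by rewrite mulr_ge0; lra.
  by have := mulr_ge0 h0 h0; lra.
- exact: cvg_cst.
- exact: cvg_harmonic.
Unshelve. all: by end_near.
Qed.

End PolynomialStep.

Section RealComplex.
Context {R : realType}.

Lemma rcD (a b : R) : (a + b)%:C = a%:C + b%:C.
Proof. by apply: complexE2; rewrite !ccE //= addr0. Qed.

Lemma rcM (a b : R) : (a * b)%:C = a%:C * b%:C.
Proof. by apply: complexE2; rewrite !ccE /=; ring. Qed.

Lemma cJM (z w : R[i]) : conjc (z * w) = conjc z * conjc w.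
Proof. by apply: complexE2; rewrite !ccE; ring. Qed.

End RealComplex.

Section BoundedMultipliers.
Context {R : realType} {d : measure_display} {T : measurableType d}.
Variables (mu : {measure set T -> \bar R}) (D : set T).
Hypothesis mD : measurable D.
Implicit Types (F : T -> R[i]) (f g : T -> R).

Definition bmeas f : Prop :=
  measurable_fun setT f /\ exists M : R, forall z, `|f z| <= M.

Lemma bmeas_cst (c : R) : bmeas (fun=> c).
Proof. by split; [exact: measurable_cst|exists `|c|]. Qed.

Lemma bmeasD f g : bmeas f -> bmeas g -> bmeas (fun z => f z + g z).
Proof.
move=> [mf [M fM]] [mg [K gK]]; split; first exact: measurable_funD.
by exists (M + K) => z; rewrite (le_trans (ler_normD _ _))// lerD.
Qed.

Lemma bmeasM f g : bmeas f -> bmeas g -> bmeas (fun z => f z * g z).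
Proof.
move=> [mf [M fM]] [mg [K gK]]; split; first exact: measurable_funM.
by exists (M * K) => z; rewrite normrM ler_pM.
Qed.

Lemma cinteg_bounded F (b : T -> R[i]) (M : R) : cinteg mu D F -> cmeas b ->
  (forall z, `|complex.Re (b z)| <= M) -> (forall z, `|complex.Im (b z)| <= M) ->
  cmeas F -> cinteg mu D (fun z => b z * F z).
Proof.
move=> [fr fi] mb br bi mF; have [mr mi] := cmeasM mb mF.
have ig : mu.-integrable D (fun z => M%:E * (`|(complex.Re (F z))%:E| + `|(complex.Im (F z))%:E|))%E.
  apply: integrableZl => //; apply: integrableD => //; exact: integrable_abse.
have M0 z : 0 <= M := le_trans (normr_ge0 _) (br z).
split; apply: (le_integrable mD _ _ ig).
- by apply/measurable_EFinP; exact: measurable_funTS mr.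
- move=> z _; rewrite -EFinD -EFinM !abse_EFin lee_fin (le_trans _ (ler_norm _))//.
  rewrite cReM (le_trans (ler_normB _ _))// mulrDr !normrM.
  by rewrite lerD// ler_wpM2r.
- by apply/measurable_EFinP; exact: measurable_funTS mi.
- move=> z _; rewrite -EFinD -EFinM !abse_EFin lee_fin (le_trans _ (ler_norm _))//.
  rewrite cImM (le_trans (ler_normD _ _))// mulrDr addrC !normrM.
  by rewrite lerD// ler_wpM2r.
Qed.

Lemma cinteg_bmeas F f : cinteg mu D F -> cmeas F -> bmeas f ->
  cinteg mu D (fun z => (f z)%:C * F z).
Proof.
move=> iF mF [mf [M fM]]; apply: (@cinteg_bounded F (fun z => (f z)%:C) M) => //.
by move=> z /=; rewrite normr0 (le_trans _ (fM z)).
Qed.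

Lemma Rintegral_dominated0 (h : nat -> T -> R) (f : T -> R) (g : T -> \bar R) :
  (forall n, measurable_fun setT (h n)) -> measurable_fun setT f ->
  mu.-integrable D g ->
  (forall z, (fun n => h n z) @ \oo --> f z) ->
  (forall n z, (`|(h n z)%:E| <= g z)%E) ->
  (forall n, \int[mu]_(z in D) h n z = 0) -> \int[mu]_(z in D) f z = 0.
Proof.
move=> mh mf ig hf hg h0.
have mh' n : measurable_fun D (fun z => (h n z)%:E).
  by apply/measurable_EFinP; exact: measurable_funTS (mh n).
have mf' : measurable_fun D (fun z => (f z)%:E).
  by apply/measurable_EFinP; exact: measurable_funTS mf.
have cv : {ae mu, forall z, D z -> (fun n => (h n z)%:E) @ \oo --> (f z)%:E}.
  by apply: aeW => z _; apply: cvg_EFin; [exact: nearW|exact: hf].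
have dom : {ae mu, forall z, forall n, D z -> (`|(h n z)%:E| <= g z)%E}.
  by apply: aeW => z n _; exact: hg.
have [jf _ lim] := dominated_convergence mD mh' mf' cv ig dom.
have ih n : mu.-integrable D (fun z => (h n z)%:E).
  apply: (le_integrable mD (mh' n) _ ig) => z Dz.
  by rewrite (le_trans (hg n z))// lee_abs.
have Eh n : (\int[mu]_(z in D) (h n z)%:E = 0)%E.
  rewrite -[LHS]fineK; first by have := h0 n; rewrite /Rintegral => ->.
  exact: integrable_fin_num.
have lim0 : (fun n => \int[mu]_(z in D) (h n z)%:E)%E @ \oo --> (0 : \bar R)%E.
  by under eq_fun do rewrite Eh; exact: cvg_cst.
by rewrite /Rintegral -(cvg_lim _ lim)// (cvg_lim _ lim0).
Qed.

Lemma cint_dominated0 (h : nat -> T -> R) (f : T -> R) F (M : R) :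
  (forall n, measurable_fun setT (h n)) -> measurable_fun setT f ->
  cinteg mu D F -> cmeas F ->
  (forall z, (fun n => h n z) @ \oo --> f z) ->
  (forall n z, `|h n z| <= M) ->
  (forall n, cint mu D (fun z => (h n z)%:C * F z) = 0) ->
  cint mu D (fun z => (f z)%:C * F z) = 0.
Proof.
move=> mh mf [Fr Fi] [mr mi] hf hM h0.
apply: complexE2 => /=.
- apply: (@Rintegral_dominated0 (fun n z => complex.Re ((h n z)%:C * F z)) _
    (fun z => M%:E * `|(complex.Re (F z))%:E|)%E).
  + move=> n; rewrite (_ : (fun _ => _) = fun z => h n z * complex.Re (F z)).
      exact: (measurable_funM (mh n) mr).
    by apply/funext => z; rewrite cReM /= mul0r subr0.
  + rewrite (_ : (fun _ => _) = fun z => f z * complex.Re (F z)).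
      exact: (measurable_funM mf mr).
    by apply/funext => z; rewrite cReM /= mul0r subr0.
  + by apply: integrableZl => //; exact: integrable_abse.
  + move=> z; rewrite cReM /= mul0r subr0.
    under eq_fun do rewrite cReM /= mul0r subr0.
    by apply: cvgM; [exact: hf|exact: cvg_cst].
  + move=> n z; rewrite !abse_EFin -EFinM lee_fin cReM /= mul0r subr0 normrM.
    exact: ler_wpM2r.
  + by move=> n; have /(congr1 (@complex.Re R)) := h0 n.
- apply: (@Rintegral_dominated0 (fun n z => complex.Im ((h n z)%:C * F z)) _
    (fun z => M%:E * `|(complex.Im (F z))%:E|)%E).
  + move=> n; rewrite (_ : (fun _ => _) = fun z => h n z * complex.Im (F z)).
      exact: (measurable_funM (mh n) mi).
    by apply/funext => z; rewrite cImM /= mul0r addr0.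
  + rewrite (_ : (fun _ => _) = fun z => f z * complex.Im (F z)).
      exact: (measurable_funM mf mi).
    by apply/funext => z; rewrite cImM /= mul0r addr0.
  + by apply: integrableZl => //; exact: integrable_abse.
  + move=> z; rewrite cImM /= mul0r addr0.
    under eq_fun do rewrite cImM /= mul0r addr0.
    by apply: cvgM; [exact: hf|exact: cvg_cst].
  + move=> n z; rewrite !abse_EFin -EFinM lee_fin cImM /= mul0r addr0 normrM.
    exact: ler_wpM2r.
  + by move=> n; have /(congr1 (@complex.Im R)) := h0 n.
Qed.

End BoundedMultipliers.

Section FourierUniqueness.
Context {R : realType}.
Notation T := (measurableTypeR R).
Variable H : T * T -> R[i].
Hypotheses (mH : cmeas H) (iH : cinteg leb2 sq H).

Definition trig (k m : int) (z : T * T) : R[i] :=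
  expi2pi (k%:~R * z.1 + m%:~R * z.2).

Hypothesis H_coef0 : forall k m : int, cint leb2 sq (fun z => trig k m z * H z) = 0.

Lemma cmeas_trig k m : cmeas (trig k m).
Proof.
apply: cmeas_expi2pi; apply: measurable_funD.
  exact: (measurable_funM (measurable_cst _) measurable_fst).
exact: (measurable_funM (measurable_cst _) measurable_snd).
Qed.

Lemma cinteg_trig F k m : cinteg leb2 sq F -> cmeas F -> cinteg leb2 sq (fun z => trig k m z * F z).
Proof.
move=> iF mF; apply: (@cinteg_bounded _ _ _ leb2 sq measurable_sq F (trig k m) 1) => //.
- exact: cmeas_trig.
- by move=> z; exact: cos_max.
- by move=> z; exact: sin_max.
Qed.

(* [B]: multipliers [g] such that all Fourier coefficients of [g H] vanish.
   [A]: functions whose multiplication preserves [B].  [A] is an algebra that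
   contains the real and imaginary parts of characters and is closed under
   bounded pointwise limits, so it contains every measurable indicator. *)
Let B (g : T * T -> R) := bmeas g /\
  forall k m, cint leb2 sq (fun z => (g z)%:C * (trig k m z * H z)) = 0.

Let A (f : T * T -> R) := bmeas f /\ forall g, B g -> B (fun z => f z * g z).

Let iB g k m : bmeas g -> cinteg leb2 sq (fun z => (g z)%:C * (trig k m z * H z)).
Proof.
move=> bg; apply: (cinteg_bmeas measurable_sq) => //; first exact: cinteg_trig.
exact: (cmeasM (cmeas_trig k m) mH).
Qed.

Let BD f g : B f -> B g -> B (fun z => f z + g z).
Proof.
move=> [bf f0] [bg g0]; split; first exact: bmeasD.
move=> k m; rewrite -[RHS]addr0 -{1}(f0 k m) -(g0 k m) -(cintD measurable_sq)//; [|exact: iB..].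
by apply: eq_cint => z _; rewrite rcD mulrDl.
Qed.

Let BZ (c : R) g : B g -> B (fun z => c * g z).
Proof.
move=> [bg g0]; split; first by apply: bmeasM => //; exact: bmeas_cst.
move=> k m; rewrite -[RHS](mulr0 c%:C) -(g0 k m) -(cintZ measurable_sq)//; last exact: iB.
by apply: eq_cint => z _; rewrite rcM -mulrA.
Qed.

Let A_cst c : A (fun=> c).
Proof. by split; [exact: bmeas_cst|move=> g; exact: BZ]. Qed.

Let AD f g : A f -> A g -> A (fun z => f z + g z).
Proof.
move=> [bf fB] [bg gB]; split; first exact: bmeasD.
move=> h Bh; rewrite (_ : (fun _ => _) = fun z => f z * h z + g z * h z).
  by apply: BD; [exact: fB|exact: gB].
by apply/funext => z; rewrite mulrDl.
Qed.

Let AM f g : A f -> A g -> A (fun z => f z * g z).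
Proof.
move=> [bf fB] [bg gB]; split; first exact: bmeasM.
move=> h Bh; rewrite (_ : (fun _ => _) = fun z => f z * (g z * h z)).
  by apply: fB; exact: gB.
by apply/funext => z; rewrite mulrA.
Qed.

Let AX f n : A f -> A (fun z => f z ^+ n).
Proof.
move=> Af; elim: n => [|n IH]; first exact: A_cst.
by have := AM Af IH; under eq_fun do rewrite -exprS.
Qed.

Let AB f g : A f -> A g -> A (fun z => f z - g z).
Proof.
move=> Af Ag; have := AD Af (AM (A_cst (-1)) Ag).
by under eq_fun do rewrite mulN1r.
Qed.

Let A_lim (h : nat -> T * T -> R) f (M : R) : (forall n, A (h n)) ->
  (forall n z, `|h n z| <= M) -> (forall z, (fun n => h n z) @ \oo --> f z) -> A f.
Proof.
move=> Ah hM hf.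
have mh n : measurable_fun setT (h n) by have [[]] := Ah n.
have mf : measurable_fun setT f.
  exact: (measurable_fun_cvg mh (fun z _ => hf z)).
have fM z : `|f z| <= M.
  have cz : cvgn (fun n => h n z) by apply/cvg_ex; exists (f z); exact: hf.
  rewrite -(cvg_lim _ (hf z))// ler_norml; apply/andP; split.
    apply: limr_ge => //; apply: nearW => n.
    by have := hM n z; rewrite ler_norml => /andP[].
  apply: limr_le => //; apply: nearW => n.
  by have := hM n z; rewrite ler_norml => /andP[].
have bf : bmeas f by split=> //; exists M.
split=> // g [bg g0]; split; first exact: bmeasM.
move=> k m.
have [mg [K gK]] := bg.
apply: (@cint_dominated0 _ _ _ leb2 sq measurable_sq (fun n z => h n z * g z) _ _ (M * K)).
- by move=> n; exact: (measurable_funM (mh n) mg).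
- exact: (measurable_funM mf mg).
- exact: cinteg_trig.
- exact: (cmeasM (cmeas_trig k m) mH).
- by move=> z; apply: cvgM; [exact: hf|exact: cvg_cst].
- by move=> n z; rewrite normrM ler_pM.
- by move=> n; have [_ /(_ g)] := Ah n; case=> // _; exact.
Qed.

Let A_ae f f' : A f -> bmeas f' -> {ae leb2, forall z, sq z -> f z = f' z} -> A f'.
Proof.
move=> [bf fB] bf' ff'; split=> // g Bg; have [bg _] := Bg.
split; first exact: bmeasM.
move=> k m; have [b0 fg0] := fB _ Bg; rewrite -(fg0 k m).
have [j1r j1i] := iB k m b0.
have [j2r j2i] := iB k m (bmeasM bf' bg).
apply: complexE2; rewrite /= /Rintegral; congr fine; apply: ae_eq_integral.
- exact: measurable_sq.
- exact: (measurable_int _ j2r).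
- exact: (measurable_int _ j1r).
- by apply: filterS ff' => z fz sqz; rewrite fz.
- exact: measurable_sq.
- exact: (measurable_int _ j2i).
- exact: (measurable_int _ j1i).
- by apply: filterS ff' => z fz sqz; rewrite fz.
Qed.

(** Multiplying by a character shifts the indices of the Fourier coefficients; this is why [B] asks
    all of them to vanish and not just the integral. *)
Let A_trig (k m : int) : A (fun z => complex.Re (trig k m z)) /\ A (fun z => complex.Im (trig k m z)).
Proof.
have [mr mi] := cmeas_trig k m.
have br : bmeas (fun z => complex.Re (trig k m z)).
  by split=> //; exists 1 => z; exact: cos_max.
have bi : bmeas (fun z => complex.Im (trig k m z)).
  by split=> //; exists 1 => z; exact: sin_max.
have tD (k1 m1 k2 m2 : int) z : trig k1 m1 z * trig k2 m2 z = trig (k1 + k2) (m1 + m2) z.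
  by rewrite /trig -expi2piD; congr expi2pi; rewrite !intrD; ring.
have tN z : conjc (trig k m z) = trig (- k) (- m) z.
  by rewrite /trig -expi2piN; congr expi2pi; rewrite !mulrNz; ring.
split; split=> // g [bg g0]; split; try exact: bmeasM; move=> k' m'.
- have := cintD measurable_sq (cintegZ measurable_sq 2^-1 (iB (k + k') (m + m') bg))
    (cintegZ measurable_sq 2^-1 (iB (- k + k') (- m + m') bg)).
  rewrite !(cintZ measurable_sq) ?g0 ?mulr0 ?addr0; [|exact: iB..].
  move=> <-; apply: eq_cint => z _.
  rewrite -!tD -tN rcM.
  have -> : (complex.Re (trig k m z))%:C = 2^-1 * (trig k m z + conjc (trig k m z)).
    by rewrite ReJ_add mulrC.
  by ring.
- have := cintD measurable_sq (cintegZ measurable_sq (- 2^-1 * 'i) (iB (k + k') (m + m') bg))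
    (cintegZ measurable_sq (2^-1 * 'i) (iB (- k + k') (- m + m') bg)).
  rewrite !(cintZ measurable_sq) ?g0 ?mulr0 ?addr0; [|exact: iB..].
  move=> <-; apply: eq_cint => z _.
  rewrite -!tD -tN rcM.
  have -> : (complex.Im (trig k m z))%:C = 2^-1 * (conjc (trig k m z) - trig k m z) * 'i.
    by rewrite ImJ_sub [_ / 2]mulrC.
  by ring.
Qed.

Let A_lt f r : A f -> A (fun z => (f z < r)%R%:R).
Proof.
move=> Af; have [[mf [M fM]] _] := Af.
(* The affine function [t] of [f] takes its values in [0, 1] and sends the threshold [r] to 1/2,
   where the limit of [step_poly] jumps. *)
pose K := M + `|r| + 1.
have K0 : 0 < K.
  by rewrite ltr_wpDl// addr_ge0// (le_trans (normr_ge0 _) (fM (0, 0))).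
pose t z := 2^-1 + (f z - r) * (2 * K)^-1.
have t01 z : 0 <= t z <= 1.
  have h : `|(f z - r) * (2 * K)^-1| <= 2^-1.
    rewrite normrM [X in _ * X]gtr0_norm ?invr_gt0 ?mulr_gt0// invfM mulrCA ler_piMr ?invr_ge0//.
    rewrite ler_pdivrMr// mul1r (le_trans (ler_normB _ _))// /K.
    by have := fM z; lra.
  by move: h; rewrite ler_norml /t => /andP[]; lra.
have At : A t.
  by apply: AD => //; apply: AM => //; exact: AB.
apply: (@A_lim (fun n z => step_poly n (t z)) _ 1).
- by move=> n; apply: AX; apply: AB => //; exact: AX.
- by move=> n z; have /andP[h0 h1] := step_poly_01 n (t01 z); rewrite ger0_norm.
- move=> z; have := cvg_step_poly (t01 z).
  suff -> : (t z < 2^-1) = (f z < r) by [].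
  rewrite /t -subr_gt0 opprD addrA subrr add0r oppr_gt0 pmulr_llt0 ?invr_gt0 ?mulr_gt0//.
  by rewrite subr_lt0.
Qed.

Let M (E : set (T * T)) := measurable E /\ A (\1_E).

Let M_ltP f r E : A f -> measurable E -> (forall z, E z <-> f z < r) -> M E.
Proof.
move=> Af mE Ez; split=> //; have := A_lt r Af.
rewrite (_ : (fun _ => _) = \1_E)//; apply/funext => z; rewrite indicE.
by case: (asboolP (E z)) => h; [rewrite mem_set// ((Ez z).1 h)|rewrite memNset//;
  case: ltP => // /((Ez z).2)].
Qed.

Let bmeas_indic (E : set (T * T)) : measurable E -> bmeas (\1_E : T * T -> R).
Proof.
move=> mE; split; first exact: measurable_indic.
by exists 1 => z; rewrite indicE; case: (_ \in _); rewrite ?normr1 ?normr0.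
Qed.

Let M_ae E E' : M E -> measurable E' -> {ae leb2, forall z, sq z -> E z <-> E' z} -> M E'.
Proof.
move=> [mE AE] mE' EE'; split=> //; apply: (A_ae AE); first exact: bmeas_indic.
apply: filterS EE' => z h sqz; have [h1 h2] := h sqz; rewrite !indicE; congr (_%:R).
by congr nat_of_bool; apply/idP/idP; rewrite !inE.
Qed.

(** Finite intersections correspond to products of indicators, and a countable intersection is a
    pointwise limit of finite ones, covered by [A_lim]. *)
Let M_sigma : sigma_algebra setT M.
Proof.
have MC E : M E -> M (~` E).
  move=> [mE AE]; split; first exact: measurableC.
  have := AB (A_cst 1) AE; rewrite (_ : (fun _ => _) = \1_(~` E))//.
  by apply/funext => z; rewrite !indicE in_setC; case: (z \in E) => /=; rewrite ?subrr ?subr0.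
have MT : M setT.
  split; first exact: measurableT.
  by have := A_cst 1; rewrite (_ : (fun _ => _) = \1_setT)//; apply/funext => z; rewrite indicT.
have MI E F : M E -> M F -> M (E `&` F).
  move=> [mE AE] [mF AF]; split; first exact: measurableI.
  by have := AM AE AF; rewrite (_ : (fun _ => _) = \1_(E `&` F))// indicI.
split.
- by rewrite -setCT; exact: MC.
- by move=> E ME; rewrite setTD; exact: MC.
- move=> F MF.
  have -> : \bigcup_k F k = ~` (\bigcap_k (~` F k)) by rewrite setC_bigcap; apply: eq_bigcupr => k _; rewrite setCK.
  apply: (MC _); pose G k := ~` F k.
  have MG k : M (G k) by exact: MC.
  pose P n := \big[setI/setT]_(k < n) G k.
  have MP n : M (P n).
    by rewrite /P; elim: n => [|n IH]; [rewrite big_ord0|rewrite big_ord_recr; exact: MI].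
  split; first by apply: bigcap_measurable => // k _; have [] := MG k.
  apply: (@A_lim (fun n => \1_(P n)) _ 1).
  + by move=> n; have [] := MP n.
  + by move=> n z; rewrite indicE; case: (_ \in _); rewrite ?normr1 ?normr0.
  + move=> z; apply: cvg_near_cst.
    have PE n : P n z <-> (forall k, (k < n)%N -> G k z).
      rewrite /P; elim: n => [|n IH]; first by rewrite big_ord0.
      rewrite big_ord_recr/=; split=> [[/IH h Gn] k|h].
        by rewrite ltnS leq_eqVlt => /orP[/eqP ->//|/h].
      by split; [apply/IH => k kn; apply: h; exact: ltnW|exact: h].
    case: (asboolP ((\bigcap_k G k) z)) => h.
      apply: nearW => n; rewrite !indicE !mem_set//.
      by apply/PE => k _; exact: h.
    have [k nG] : exists k, ~ G k z by apply/existsNP => h'; apply: h => k _; exact: h'.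
    exists k.+1 => // n /= kn; rewrite !indicE !memNset//.
    by move=> /PE /(_ k kn).
Qed.

Let M_gt f r E : A f -> measurable E -> (forall z, E z <-> r < f z) -> M E.
Proof.
move=> Af mE Ez; apply: (@M_ltP (fun z => -1 * f z) (- r)) => //.
  exact: (AM (A_cst (-1)) Af).
by move=> z; rewrite mulN1r ltrN2; exact: Ez.
Qed.

Let MC E : M E -> M (~` E).
Proof. by move=> ME; have [_ MD _] := M_sigma; rewrite -setTD; exact: MD. Qed.

Let MU E F : M E -> M F -> M (E `|` F).
Proof.
move=> ME MF; have [_ _ MD] := M_sigma; rewrite -bigcup2E; apply: MD => -[|[|n]]//=.
by have [] := M_sigma.
Qed.

Let MI E F : M E -> M F -> M (E `&` F).
Proof. by move=> ME MF; rewrite -[E]setCK -[F]setCK -setCU; apply: MC; apply: MU; exact: MC. Qed.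

(* The half-planes [p < r] are cut out by the signs of [sin (2 pi p)] and of
   [cos (2 pi p) - cos (2 pi r)]. *)
Let M_coord (p : T * T -> T) r : measurable_fun setT p ->
  A (fun z => cos (2 * pi * p z)) -> A (fun z => sin (2 * pi * p z)) ->
  {ae leb2, forall z, sq z -> 0 <= p z < 1} ->
  M [set z | p z < r].
Proof.
move=> mp Ac As p01.
have mset (g : T * T -> R) s : measurable_fun setT g -> measurable [set z | g z < s].
  move=> mg; rewrite (_ : mkset _ = setT `&` g @^-1` `]-oo, s[%classic).
    by apply: mg => //; exact: measurable_itv.
  by apply/seteqP; split => z /=; rewrite in_itv/=; [move=> h; split|move=> []].
have mset2 (g : T * T -> R) s : measurable_fun setT g -> measurable [set z | s < g z].
  move=> mg; rewrite (_ : mkset _ = setT `&` g @^-1` `]s, +oo[%classic).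
    by apply: mg => //; exact: measurable_itv.
  by apply/seteqP; split => z /=; rewrite in_itv/= andbT; [move=> h; split|move=> []].
have msp := mset p r mp.
have [[mc _] _] := Ac; have [[ms _] _] := As.
have M_cos s : M [set z | cos (2 * pi * p z) < s].
  exact: (M_ltP Ac (mset _ s mc) (fun z => iff_refl _)).
have M_sin : M [set z | sin (2 * pi * p z) < 0].
  exact: (M_ltP As (mset _ 0 ms) (fun z => iff_refl _)).
have M_cos' s : M [set z | s < cos (2 * pi * p z)].
  exact: (M_gt Ac (mset2 _ s mc) (fun z => iff_refl _)).
have pi0 := pi_gt0 R.
have sinE (x : R) : 0 <= x < 1 -> (sin (2 * pi * x) < 0) = (2^-1 < x).
  move=> /andP[x0 x1]; have [h|h] := leP x 2^-1.
    apply/negbTE; rewrite -leNgt; apply: sin_ge0_pi; apply/andP; split; nra.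
  have -> : 2 * pi * x = (2 * pi * x - pi) + pi by ring.
  by rewrite sinDpi oppr_lt0; apply: sin_gt0_pi; apply/andP; split; nra.
have cosE1 (x : R) : 0 <= x <= 2^-1 -> 0 <= r <= 2^-1 -> (cos (2 * pi * r) < cos (2 * pi * x)) = (x < r).
  move=> /andP[x0 x1] /andP[r0 r1].
  rewrite ltr_cos ?in_itv/=; first by rewrite ltr_pM2l// mulr_gt0.
    by apply/andP; split; nra.
  by apply/andP; split; nra.
have cosE2 (x : R) : 2^-1 < x < 1 -> 2^-1 < r <= 1 -> (cos (2 * pi * x) < cos (2 * pi * r)) = (x < r).
  move=> /andP[x0 x1] /andP[r0 r1].
  have -> : 2 * pi * x = (2 * pi * x - pi) + pi by ring.
  have -> : 2 * pi * r = (2 * pi * r - pi) + pi by ring.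
  rewrite !cosDpi ltrN2 ltr_cos ?in_itv/=; first by rewrite ltrD2r ltr_pM2l// mulr_gt0.
    by apply/andP; split; nra.
  by apply/andP; split; nra.
have [r0|r0] := ltP r 0.
  apply: (@M_ae set0) => //; first by have [] := M_sigma.
  by apply: filterS p01 => z h /h /andP[p0 _]; split=> //= /(le_lt_trans p0); lra.
have [r1|r1] := ltP 1 r.
  apply: (@M_ae setT) => //; first by rewrite -setC0; apply: MC; have [] := M_sigma.
  by apply: filterS p01 => z h /h /andP[_ p1]; split=> //= _; exact: lt_trans r1.
have [r2|r2] := leP r 2^-1.
  apply: (@M_ae ([set z | cos (2 * pi * r) < cos (2 * pi * p z)] `&` ~` [set z | sin (2 * pi * p z) < 0])) => //.
    by apply: MI => //; exact: MC.
  apply: filterS p01 => z h /h pz; have /andP[p0 p1] := pz; rewrite /= sinE//; split.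
    by move=> [] /[swap] /negP; rewrite -leNgt => h1; rewrite cosE1 ?p0 ?r0.
  move=> pr; have h1 : p z <= 2^-1 by lra.
  by rewrite cosE1 ?p0 ?r0//; split => //; apply/negP; rewrite -leNgt.
apply: (@M_ae (~` [set z | sin (2 * pi * p z) < 0] `|` [set z | cos (2 * pi * p z) < cos (2 * pi * r)])) => //.
  by apply: MU => //; exact: MC.
apply: filterS p01 => z h /h pz; have /andP[p0 p1] := pz; rewrite /= sinE//.
have [h1|h1] := leP (p z) 2^-1.
  by split=> [_|_]; [exact: le_lt_trans r2|left].
by split=> [[//|]|pr]; [|right]; rewrite cosE2 ?h1 ?r2.
Qed.

Let M_fst (B0 : set T) (p : T * T -> T) :
  (forall r, M [set z | p z < r]) -> measurable B0 -> M (p @^-1` B0).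
Proof.
move=> Mp mB.
suff h : (RGenInftyO.G (R:=R)).-sigma.-measurable `<=` [set E : set T | M (p @^-1` E)].
  by apply: (h B0); rewrite -RGenInftyO.measurableE; exact: mB.
apply: smallest_sub.
  have [M0 MD MB] := M_sigma; split => /=.
  - by rewrite preimage_set0.
  - by move=> E ME; rewrite setTD preimage_setC -setTD; exact: MD.
  - by move=> E ME; rewrite preimage_bigcup; exact: MB.
move=> _ [r ->] /=; have := Mp r.
by rewrite (_ : mkset _ = p @^-1` `]-oo, r[%classic).
Qed.

(** Characters take the same values at 0 and at 1, so they can separate points of the closed square
    only after the edges z.1 = 1 and z.2 = 1 are discarded. *)
Lemma ae_sq_lt1 : {ae leb2, forall z : T * T, sq z -> 0 <= z.1 < 1 /\ 0 <= z.2 < 1}.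
Proof.
have n1 : leb2.-negligible ([set 1] `*` setT : set (T * T)).
  apply/negligibleP; first exact: measurableX.
  rewrite [LHS](@product_measure1E _ _ _ _ R leb leb)//.
  by rewrite [X in (X * _)%E]lebesgue_measure_set1 mul0e.
have n2 : leb2.-negligible (setT `*` [set 1] : set (T * T)).
  apply/negligibleP; first exact: measurableX.
  rewrite [LHS](@product_measure1E _ _ _ _ R leb leb)//.
  by rewrite [X in (_ * X)%E]lebesgue_measure_set1 mule0.
apply: negligibleS (negligibleU n1 n2) => -[x y] /= /not_implyP[].
rewrite /sq /uI /= !in_itv/= => -[/andP[x0 x1] /andP[y0 y1]] h.
have [->|xn] := eqVneq x 1; first by left.
have [->|yn] := eqVneq y 1; first by right.
by exfalso; apply: h; rewrite !lt_neqAle x0 y0 x1 y1 xn yn.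
Qed.

Let M_all (E : set (T * T)) : measurable E -> M E.
Proof.
have M1 r : M [set z | z.1 < r].
  apply: M_coord; first exact: measurable_fst.
  - have [h _] := A_trig 1 0; move: h; rewrite /trig /=.
    by under eq_fun do rewrite mul1r mul0r addr0.
  - have [_ h] := A_trig 1 0; move: h; rewrite /trig /=.
    by under eq_fun do rewrite mul1r mul0r addr0.
  - by apply: filterS ae_sq_lt1 => z h /h [].
have M2 r : M [set z | z.2 < r].
  apply: M_coord; first exact: measurable_snd.
  - have [h _] := A_trig 0 1; move: h; rewrite /trig /=.
    by under eq_fun do rewrite mul1r mul0r add0r.
  - have [_ h] := A_trig 0 1; move: h; rewrite /trig /=.
    by under eq_fun do rewrite mul1r mul0r add0r.
  - by apply: filterS ae_sq_lt1 => z h /h [].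
suff h : g_sigma_preimageU (@fst T T) (@snd T T) `<=` M by exact: h.
apply: smallest_sub; first exact: M_sigma.
move=> _ [[B0 mB <-]|[B0 mB <-]]; rewrite setTI; exact: M_fst.
Qed.

Let int_indic (h : T * T -> R) (E : set (T * T)) :
  leb2.-integrable sq (fun z => (h z)%:E) -> measurable E ->
  \int[leb2]_(z in sq) (\1_E z * h z) = 0 -> (forall z, 0 <= \1_E z * h z) ->
  measurable_fun setT h ->
  {ae leb2, forall z, sq z -> \1_E z * h z = 0}.
Proof.
move=> ih mE h0 p mh.
have mf : measurable_fun sq (fun z => (\1_E z * h z)%:E).
  apply/measurable_EFinP; apply: (@measurable_funTS).
  by apply: (measurable_funM _ mh); exact: measurable_indic.
have jf : leb2.-integrable sq (fun z => (\1_E z * h z)%:E).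
  apply: (le_integrable measurable_sq mf _ ih) => z _.
  rewrite !abse_EFin lee_fin normrM ler_piMl//.
  by rewrite indicE; case: (_ \in _); rewrite ?normr1 ?normr0.
have /(ae_eq_integral_abs leb2 measurable_sq mf) : (\int[leb2]_(z in sq) `|(\1_E z * h z)%:E| = 0)%E.
  under eq_integral do rewrite gee0_abs ?lee_fin//.
  by rewrite -[LHS]fineK; [have := h0; rewrite /Rintegral => ->|exact: integrable_fin_num measurable_sq _ jf].
by apply: filterS => z h1 /h1 [].
Qed.

(** The hypothesis is tested on the sets where [h] is positive and where it is negative. *)
Let real_part0 (h : T * T -> R) :
  leb2.-integrable sq (fun z => (h z)%:E) -> measurable_fun setT h ->
  (forall E, measurable E -> \int[leb2]_(z in sq) (\1_E z * h z) = 0) ->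
  {ae leb2, forall z, sq z -> h z = 0}.
Proof.
move=> ih mh h0.
have mp : measurable [set z | 0 < h z].
  rewrite (_ : mkset _ = setT `&` h @^-1` `]0, +oo[%classic).
    by apply: mh => //; exact: measurable_itv.
  by apply/seteqP; split => z /=; rewrite in_itv/= andbT; [move=> ?; split|move=> []].
have mn : measurable [set z | h z < 0].
  rewrite (_ : mkset _ = setT `&` h @^-1` `]-oo, 0[%classic).
    by apply: mh => //; exact: measurable_itv.
  by apply/seteqP; split => z /=; rewrite in_itv/=; [move=> ?; split|move=> []].
have ap : {ae leb2, forall z, sq z -> \1_[set z | 0 < h z] z * h z = 0}.
  apply: int_indic => //; first exact: h0.
  move=> z; rewrite indicE; case: (boolP (z \in _)); last by rewrite mul0r.
  by rewrite inE/= mul1r => /ltW.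
have an : {ae leb2, forall z, sq z -> \1_[set z | h z < 0] z * - h z = 0}.
  apply: int_indic => //.
  - rewrite (_ : (fun _ => _) = (\- (fun z => (h z)%:E))%E); first exact: integrableN.
    by apply/funext.
  - have jn : leb2.-integrable sq (EFin \o (fun z => \1_[set z | h z < 0] z * h z)).
      apply: (le_integrable measurable_sq _ _ ih).
        apply/measurable_EFinP; apply: (@measurable_funTS).
        by apply: (measurable_funM _ mh); exact: measurable_indic.
      move=> z _; rewrite !abse_EFin lee_fin normrM ler_piMl//.
      by rewrite indicE; case: (_ \in _); rewrite ?normr1 ?normr0.
    have := RintegralZl (-1) measurable_sq jn; rewrite (h0 _ mn) mulr0 => e0.
    apply: (etrans _ e0).
    by apply: eq_Rintegral => z _; rewrite mulN1r mulrN.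
  - move=> z; rewrite indicE; case: (boolP (z \in _)); last by rewrite mul0r.
    by rewrite inE/= mul1r oppr_ge0 => /ltW.
  - exact: measurable_funN.
apply: filterS2 ap an => z ap an sqz; move: (ap sqz) (an sqz); rewrite !indicE.
case: (ltgtP (h z) 0) => // hz.
  by rewrite (mem_set (hz : [set z | h z < 0] z)) mul1r => _ /eqP; rewrite oppr_eq0 => /eqP.
by rewrite (mem_set (hz : [set z | 0 < h z] z)) mul1r.
Qed.

(** The constant 1 lies in [B] by hypothesis and every measurable indicator lies in [A], so [H] has
    integral 0 over each measurable part of the square. *)
Theorem fourier_unique : {ae leb2, forall z, sq z -> H z = 0}.
Proof.
have B1 : B (fun=> 1).
  split; first exact: bmeas_cst.
  by move=> k m; rewrite -[RHS](H_coef0 k m); apply: eq_cint => z _; rewrite mul1r.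
have key E : measurable E -> cint leb2 sq (fun z => (\1_E z)%:C * H z) = 0.
  move=> /M_all [_ [_ /(_ _ B1)[_ /(_ 0 0) h]]]; rewrite -[RHS]h; apply: eq_cint => z _.
  by rewrite /trig !mul0r addr0 expi2pi0 mul1r mulr1.
have [[Hr Hi] [mr mi]] := (iH, mH).
have re : {ae leb2, forall z, sq z -> complex.Re (H z) = 0}.
  apply: real_part0 => // E mE; have /(congr1 (@complex.Re R)) /= := key E mE.
  move=> h; rewrite -[RHS]h; apply: eq_Rintegral => z _.
  by rewrite cReM /= mul0r subr0.
have im : {ae leb2, forall z, sq z -> complex.Im (H z) = 0}.
  apply: real_part0 => // E mE; have /(congr1 (@complex.Im R)) /= := key E mE.
  move=> h; rewrite -[RHS]h; apply: eq_Rintegral => z _.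
  by rewrite cImM /= mul0r addr0.
by apply: filterS2 re im => z h1 h2 sqz; apply: complexE2; [exact: h1|exact: h2].
Qed.

End FourierUniqueness.

(** * The Zak space and its irreducibility *)

Section QuasiPeriodic.
Context {R : realType}.
Notation T := (measurableTypeR R).
Notation sqi := (sq_integrable leb2 sq).
Notation nrm := (nrm2 leb2 sq).
Implicit Types (th eta : T * T -> R[i]) (N : int).

Lemma cint_sq_shift (F : T * T -> R[i]) (s t : R) : cmeas F ->
  (forall x y, F (x + 1, y) = F (x, y)) -> (forall x y, F (x, y + 1) = F (x, y)) ->
  cint leb2 sq (fun z => F (z.1 + s, z.2 + t)) = cint leb2 sq F.
Proof.
move=> [mr mi] F1 F2; apply: complexE2; rewrite /= /Rintegral; congr fine.
  apply: (@integral_sq_shift R (fun z => (complex.Re (F z))%:E)).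
  - exact: (measurable_EFinP _ _).2 mr.
  - by move=> x y; rewrite F1.
  - by move=> x y; rewrite F2.
apply: (@integral_sq_shift R (fun z => (complex.Im (F z))%:E)).
- exact: (measurable_EFinP _ _).2 mi.
- by move=> x y; rewrite F1.
- by move=> x y; rewrite F2.
Qed.

Lemma cint_sq_scale1 (F : T * T -> R[i]) N : N != 0 -> cmeas F ->
  (forall x y, F (x + 1, y) = F (x, y)) -> 
  cint leb2 sq (fun z => F (N%:~R * z.1, z.2)) = cint leb2 sq F.
Proof.
move=> N0 [mr mi] F1; apply: complexE2; rewrite /= /Rintegral; congr fine.
  apply: (@integral_sq_scale1 R (fun z => (complex.Re (F z))%:E)) => //.
  - exact: (measurable_EFinP _ _).2 mr.
  - by move=> x y; rewrite F1.
apply: (@integral_sq_scale1 R (fun z => (complex.Im (F z))%:E)) => //.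
- exact: (measurable_EFinP _ _).2 mi.
- by move=> x y; rewrite F1.
Qed.

Lemma sqi_shift th (s t : R) : sqi th ->
  (forall x y, sqmod (th (x + 1, y)) = sqmod (th (x, y))) ->
  (forall x y, sqmod (th (x, y + 1)) = sqmod (th (x, y))) ->
  sqi (fun z => th (z.1 + s, z.2 + t)).
Proof.
move=> jth th1 th2; have mth := sqi_cmeas jth; have [_ _ foo] := jth.
have [m1 m2] := cmeas_comp mth (measurable_sq_shift s t); split => //.
rewrite (@integral_sq_shift R (fun z => (sqmod (th z))%:E))//.
- exact: cmeas_esqmod.
- by move=> x y; rewrite th1.
- by move=> x y; rewrite th2.
Qed.

(* The symmetry of z |-> F(a, c, 0) for F in H_N; the Zak space is [Qs 1]. *)
Definition qper N th : Prop :=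
  (forall b c, th (b + 1, c) = th (b, c)) /\
  (forall b c, th (b, c + 1) = expi2pi (- (N%:~R * b)) * th (b, c)).

Definition Qs N : set (T * T -> R[i]) := [set th | sqi th /\ qper N th].

Lemma qper_sqmod2 N th : qper N th -> forall x y, sqmod (th (x, y + 1)) = sqmod (th (x, y)).
Proof. by move=> [_ h] x y; rewrite h sqmodM sqmod_expi2pi mul1r. Qed.

Lemma qper_sqmod1 N th : qper N th -> forall x y, sqmod (th (x + 1, y)) = sqmod (th (x, y)).
Proof. by move=> [h _] x y; rewrite h. Qed.

Lemma qper_mulJ N th eta : qper N th -> qper N eta ->
  (forall x y, th (x + 1, y) * conjc (eta (x + 1, y)) = th (x, y) * conjc (eta (x, y))) /\
  (forall x y, th (x, y + 1) * conjc (eta (x, y + 1)) = th (x, y) * conjc (eta (x, y))).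
Proof.
move=> [t1 t2] [e1 e2]; split=> x y; first by rewrite t1 e1.
rewrite t2 e2 rmorphM/= mulrACA mulJ_sqmod sqmod_expi2pi.
by rewrite (_ : 1%:C = 1) ?mul1r.
Qed.

Lemma qper_int1 N th b c (n : int) : qper N th -> th (b + n%:~R, c) = th (b, c).
Proof. by move=> [h _]; apply: (@periodic_int _ _ (fun b => th (b, c))). Qed.

Lemma qper_int2 N th b c (n : int) : qper N th ->
  th (b, c + n%:~R) = expi2pi (- (n%:~R * (N%:~R * b))) * th (b, c).
Proof.
move=> [_ h].
(* For fixed [b], multiplication by e(c N b) makes the function periodic in [c]. *)
have := @periodic_int _ _ (fun c => expi2pi (c * (N%:~R * b)) * th (b, c)) c n _.
move=> per; have {}per : expi2pi ((c + n%:~R) * (N%:~R * b)) * th (b, c + n%:~R) =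
    expi2pi (c * (N%:~R * b)) * th (b, c).
  apply: per => x; rewrite h mulrA -expi2piD; congr (expi2pi _ * _); ring.
apply: (mulfI (expi2pi_neq0 ((c + n%:~R) * (N%:~R * b)))).
rewrite per [RHS]mulrA -expi2piD; congr (expi2pi _ * _); ring.
Qed.

Lemma Qs_lin N (k : R[i]) th eta : Qs N th -> Qs N eta -> Qs N (fun z => k * th z + eta z).
Proof.
move=> [j1 [p1 q1]] [j2 [p2 q2]]; split.
  by apply: (sqiD measurable_sq) => //; exact: (sqiZ measurable_sq).
by split=> b c; rewrite ?p1 ?p2 ?q1 ?q2//; ring.
Qed.

Lemma Qs0 N : Qs N (fun=> 0).
Proof. by split; [exact: (sqi0 _ _)|split=> b c; rewrite ?mulr0]. Qed.

Lemma Qs_sum N (I : Type) (r : seq I) (F : I -> T * T -> R[i]) (k : I -> R[i]) :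
  (forall i, Qs N (F i)) -> Qs N (fun z => \sum_(i <- r) k i * F i z).
Proof.
move=> QF; elim: r => [|i r IH].
  by under eq_fun do rewrite big_nil; exact: Qs0.
by under eq_fun do rewrite big_cons; exact: Qs_lin.
Qed.

Definition frac (x : R) : R := x - (Num.floor x)%:~R.

Lemma frac_ge0 x : 0 <= frac x.
Proof. by rewrite subr_ge0 floor_le. Qed.

Lemma frac_lt1 x : frac x < 1.
Proof. by have /andP[_] := floor_itv x; rewrite intrD ltrBlDl. Qed.

Lemma floorD1 (x : R) : Num.floor (x + 1) = Num.floor x + 1.
Proof. by rewrite floorDrz ?floor1. Qed.

Lemma fracD1 x : frac (x + 1) = frac x.
Proof. by rewrite /frac floorD1 intrD; ring. Qed.

Lemma floor_id (x : R) : 0 <= x < 1 -> Num.floor x = 0.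
Proof. by move=> h; apply: floor_def; rewrite add0r. Qed.

Lemma measurable_floorR : measurable_fun (setT : set T) (fun x : T => (Num.floor x)%:~R : R).
Proof.
apply: nondecreasing_measurable => // x y xy.
by rewrite ler_int; exact: le_floor.
Qed.

(* The quasi-periodic function that agrees with [th] on [0, 1[ x [0, 1[. *)
Definition quasi N th (z : T * T) : R[i] :=
  expi2pi (- (N%:~R * (Num.floor z.2)%:~R * z.1)) * th (frac z.1, frac z.2).

Lemma qper_quasi N th : qper N (quasi N th).
Proof.
split=> b c; rewrite /quasi /= fracD1//.
  have -> : - (N%:~R * (Num.floor c)%:~R * (b + 1)) =
      - (N%:~R * (Num.floor c)%:~R * b) + (- (N * Num.floor c))%:~R :> R.
    by rewrite mulrNz intrM; ring.
  by rewrite expi2piDint.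
rewrite mulrA -expi2piD floorD1; congr (expi2pi _ * _).
by rewrite intrD; ring.
Qed.

Lemma frac_id (x : R) : 0 <= x < 1 -> frac x = x.
Proof. by move=> h; rewrite /frac (floor_id h) -[0%:~R]/(0 : R) subr0. Qed.

Lemma quasi_id N th b c : 0 <= b < 1 -> 0 <= c < 1 -> quasi N th (b, c) = th (b, c).
Proof.
move=> b1 c1; rewrite /quasi /= (frac_id b1) (frac_id c1) (floor_id c1).
by rewrite -[0%:~R]/(0 : R) mulr0 mul0r oppr0 expi2pi0 mul1r.
Qed.

Lemma cmeas_quasi N th : cmeas th -> cmeas (quasi N th).
Proof.
move=> mth.
have mfl := measurable_floorR.
have mfr : measurable_fun setT (fun x : T => frac x : T).
  by apply: measurable_funB; [exact: measurable_id|exact: mfl].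
apply: cmeasM.
  apply: cmeas_expi2pi; apply: measurable_funN.
  apply: (measurable_funM _ measurable_fst).
  exact: (measurable_funM (measurable_cst _) (measurableT_comp mfl measurable_snd)).
apply: (cmeas_comp mth); apply: measurable_pairfun.
  exact: (measurableT_comp mfr measurable_fst).
exact: (measurableT_comp mfr measurable_snd).
Qed.

Lemma ae_quasi_id N th : {ae leb2, forall z, sq z -> quasi N th z = th z}.
Proof.
by apply: filterS (@ae_sq_lt1 R) => -[b c] h /h /= [h1 h2]; exact: quasi_id.
Qed.

Lemma ae_integral_sqmod d (S : measurableType d) (mu : {measure set S -> \bar R}) (D : set S)
    (f g : S -> R[i]) : measurable D -> cmeas f -> cmeas g ->
  {ae mu, forall z, D z -> f z = g z} ->
  (\int[mu]_(x in D) (sqmod (f x))%:E = \int[mu]_(x in D) (sqmod (g x))%:E)%E.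
Proof.
move=> mD mf mg fg; apply: ae_eq_integral => //.
- by apply: measurable_funTS; exact: cmeas_esqmod.
- by apply: measurable_funTS; exact: cmeas_esqmod.
- by apply: filterS fg => x h /h ->.
Qed.

Lemma Qs_quasi N th : sqi th -> Qs N (quasi N th).
Proof.
move=> jth; have mth := sqi_cmeas jth; have [_ _ foo] := jth.
split; last exact: qper_quasi.
have mq := cmeas_quasi N mth; have [m1 m2] := mq; split => //.
by rewrite (ae_integral_sqmod measurable_sq mq mth (ae_quasi_id N th)).
Qed.

(** The limit provided by [L2_complete] is controlled only almost everywhere on the square; [quasi]
    replaces it by an exactly quasi-periodic function. *)
Lemma Qs_complete N (u : nat -> T * T -> R[i]) : (forall n, Qs N (u n)) ->
  (forall n, nrm (fun x => u n.+1 x - u n x) <= 4^-1 ^+ n) ->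
  exists2 f, Qs N f & forall n, nrm (fun x => f x - u n x) <= 4 * 2^-1 ^+ n.
Proof.
move=> Qu du.
have [f jf fP] := L2_complete measurable_sq (fun n => (Qu n).1) du.
exists (quasi N f); first exact: Qs_quasi.
have mf := sqi_cmeas jf; have mq := cmeas_quasi N mf.
move=> n; apply: le_trans (fP n); rewrite /nrm2.
have mu := sqi_cmeas (Qu n).1.
rewrite (ae_integral_sqmod measurable_sq (cmeasB mq mu) (cmeasB mf mu))//.
by apply: filterS (ae_quasi_id N f) => z h /h ->.
Qed.

Definition hact (al ga be : R) th : T * T -> R[i] :=
  fun z => expi2pi (be + z.2 * al) * th (z.1 + al, z.2 + ga).

Lemma cmeas_phase (be al : R) : cmeas (fun z : T * T => expi2pi (be + z.2 * al)).
Proof.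
apply: cmeas_expi2pi; apply: (measurable_funD (measurable_cst _)).
exact: (measurable_funM measurable_snd (measurable_cst _)).
Qed.

Lemma cmeas_hact al ga be th : cmeas th -> cmeas (hact al ga be th).
Proof.
move=> mth; apply: (cmeasM (cmeas_phase be al)).
exact: (cmeas_comp mth (measurable_sq_shift al ga)).
Qed.

Lemma Qs_hact al ga be th : Qs 1 th -> Qs 1 (hact al ga be th).
Proof.
move=> [jth qth]; have mth := sqi_cmeas jth.
have js := sqi_shift al ga jth (qper_sqmod1 qth) (qper_sqmod2 qth).
split.
  have [m1 m2] := cmeas_hact al ga be mth; split => //.
  have [_ _] := js; rewrite (_ : (\int[leb2]_(x in sq) _ = \int[leb2]_(x in sq)
    (sqmod (hact al ga be th x))%:E)%E)//.
  by apply: eq_integral => z _; rewrite sqmodM sqmod_expi2pi mul1r.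
have [q1 q2] := qth; split=> b c; rewrite /hact /=.
  by congr (_ * _); rewrite addrAC q1.
rewrite [c + 1 + ga]addrAC q2 !mulrA -!expi2piD; congr (expi2pi _ * _); ring.
Qed.

Lemma hactM al ga be al' ga' be' th :
  hact al ga be (hact al' ga' be' th) = hact (al + al') (ga + ga') (be + be' + ga * al') th.
Proof.
apply/funext => z; rewrite /hact /= mulrA -expi2piD -!addrA; congr (expi2pi _ * _); ring.
Qed.

Lemma L2inner_hact al ga be th eta : Qs 1 th -> Qs 1 eta ->
  L2inner leb2 sq (hact al ga be th) (hact al ga be eta) = L2inner leb2 sq th eta.
Proof.
move=> [jth qth] [jeta qeta].
have [p1 p2] := qper_mulJ qth qeta.
have mth := sqi_cmeas jth; have meta := sqi_cmeas jeta.
rewrite !L2innerE -[RHS](cint_sq_shift al ga (cmeasM mth (cmeasJ meta)) p1 p2).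
apply: eq_cint => z _; rewrite /hact rmorphM/= mulrACA mulJ_sqmod sqmod_expi2pi.
by rewrite (_ : 1%:C = 1) ?mul1r.
Qed.

Lemma nrm_hact al ga be th : Qs 1 th -> nrm (hact al ga be th) = nrm th.
Proof.
move=> Qth; have := L2inner_hact al ga be Qth Qth.
by rewrite !L2inner_nrm2 => /(congr1 (@complex.Re R)).
Qed.

Lemma measurable_add2 : measurable_fun setT (fun p : (T * T) * (T * T) =>
  (p.2.1 + p.1.1, p.2.2 + p.1.2) : T * T).
Proof.
apply: measurable_pairfun.
  exact: (measurable_funD (measurableT_comp measurable_fst measurable_snd)
    (measurableT_comp measurable_fst measurable_fst)).
exact: (measurable_funD (measurableT_comp measurable_snd measurable_snd)
  (measurableT_comp measurable_snd measurable_fst)).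
Qed.

(* The translates of [th] by integer parameters only change the integrand by a
   character of the torus, so all Fourier coefficients of
   [th (. + (al, ga)) * conj eta] vanish. *)
Lemma orthogonal_orbit th eta : Qs 1 th -> Qs 1 eta ->
  (forall al ga, L2inner leb2 sq (hact al ga 0 th) eta = 0) -> nrm th = 0 \/ nrm eta = 0.
Proof.
move=> Qth Qeta inner0; have [[jth qth] [jeta qeta]] := (Qth, Qeta).
have mth := sqi_cmeas jth; have meta := sqi_cmeas jeta.
have pt al ga : {ae leb2, forall z, sq z -> sqmod (th (z.1 + al, z.2 + ga)) * sqmod (eta z) = 0}.
  pose H z := hact al ga 0 th z * conjc (eta z).
  have jh := (Qs_hact al ga 0 Qth).1.
  have iH : cinteg leb2 sq H by exact: (cinteg_mulJ measurable_sq).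
  have mH : cmeas H by exact: (cmeasM (sqi_cmeas jh) (cmeasJ meta)).
  have H0 k m : cint leb2 sq (fun z => trig k m z * H z) = 0.
    have jkm := (Qs_hact (al + m%:~R) (ga + (- k)%:~R) 0 Qth).1.
    have h := inner0 (al + m%:~R) (ga + (- k)%:~R).
    (* Shifting the parameters by (m, -k) multiplies [H] by the character [trig k m] and the scalar
       e(k al). *)
    rewrite -[RHS](mulr0 (expi2pi (- (k%:~R * al)))) -h.
    rewrite L2innerE -(cintZ measurable_sq); last exact: (cinteg_mulJ measurable_sq).
    apply: eq_cint => z _; rewrite /H /hact /trig !mulrA.
    congr (_ * _); rewrite !addrA (qper_int1 _ _ _ qth) (qper_int2 _ _ _ qth) !mulrA.
    rewrite -!expi2piD; congr (expi2pi _ * _).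
    by rewrite mulrNz -[1%:~R]/(1 : R); ring.
  apply: filterS (fourier_unique mH iH H0) => z h /h /(congr1 sqmod).
  by rewrite /H /hact !sqmodM sqmod_expi2pi mul1r sqmodJ sqmod0.
(* [p.1] is the translation parameter and [p.2] the point. Integrating over [p.2] first gives 0,
   over [p.1] first the product of the two squared norms. *)
pose f (p : (T * T) * (T * T)) : \bar R :=
  (sqmod (th (p.2.1 + p.1.1, p.2.2 + p.1.2)) * sqmod (eta p.2))%:E.
have mf : measurable_fun setT f.
  apply: (measurable_EFinP _ _).2; apply: measurable_funM.
    exact: (cmeas_sqmod (cmeas_comp mth measurable_add2)).
  exact: (cmeas_sqmod (cmeas_comp meta measurable_snd)).
have f0 p : (0 <= f p)%E by rewrite lee_fin mulr_ge0 ?sqmod_ge0.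
have E1 := ge0_integral_setX1 leb2 leb2 measurable_sq measurable_sq mf f0.
have E2 := ge0_integral_setX2 leb2 leb2 measurable_sq measurable_sq mf f0.
have Z1 : (\int[leb2]_(x in sq) \int[leb2]_(y in sq) f (x, y) = 0)%E.
  apply: integral0_eq => w _.
  transitivity (\int[leb2]_(y in sq) (fun=> 0%E) y : \bar R)%E; last by rewrite integral0.
  apply: ae_eq_integral; [exact: measurable_sq| |exact: measurable_cst|].
    apply: measurable_funTS; apply: (measurableT_comp mf).
    by apply: measurable_pairfun; [exact: measurable_cst|exact: measurable_id].
  by apply: filterS (pt w.1 w.2) => z h /h /= hz; rewrite /f /= hz.
have Z2 : (\int[leb2]_(y in sq) \int[leb2]_(x in sq) f (x, y) = (nrm th * nrm eta)%:E)%E.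
  transitivity (\int[leb2]_(y in sq) ((nrm th)%:E * (sqmod (eta y))%:E))%E; last first.
    rewrite ge0_integralZl_EFin; first by rewrite (nrm2E jeta).
    - exact: measurable_sq.
    - by move=> z _; rewrite lee_fin sqmod_ge0.
    - by apply: measurable_funTS; exact: cmeas_esqmod.
    - exact: nrm2_ge0.
  apply: eq_integral => y _; rewrite /f /=.
  under eq_integral do rewrite mulrC EFinM.
  rewrite ge0_integralZl_EFin; last 4 first.
  - exact: measurable_sq.
  - by move=> z _; rewrite lee_fin sqmod_ge0.
  - apply: measurable_funTS; apply: (cmeas_esqmod (cmeas_comp mth _)).
    apply: (measurableT_comp measurable_add2 (g := fun x => (x, y))).
    by apply: measurable_pairfun; [exact: measurable_id|exact: measurable_cst].
  - exact: sqmod_ge0.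
  rewrite muleC; congr (_ * _)%E; rewrite -(nrm2E jth).
  under eq_integral do rewrite [y.1 + _]addrC [y.2 + _]addrC.
  apply: (@integral_sq_shift R (fun z => (sqmod (th z))%:E)).
  - exact: cmeas_esqmod.
  - by move=> b c; rewrite (qper_sqmod1 qth).
  - by move=> b c; rewrite (qper_sqmod2 qth).
have : nrm th * nrm eta = 0.
  by apply: EFin_inj; rewrite -Z2 -E2 E1.
by move/eqP; rewrite mulf_eq0 => /orP[] /eqP ->; [left|right].
Qed.

End QuasiPeriodic.

(** * Dense invariant subspaces and continuity of the action *)

Section ZakSpace.
Context {R : realType}.
Notation T := (measurableTypeR R).
Notation nrm := (nrm2 leb2 sq).
Notation Zak := (Qs (R:=R) 1).

(** By [orthogonal_orbit] only vectors of norm 0 are orthogonal to an invariant subspace containing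
    [s0]. Invariance is asked for be = 0, since [be] contributes just a scalar. *)
Lemma Zak_density (S : set (T * T -> R[i])) (s0 : T * T -> R[i]) :
  S `<=` Zak -> S s0 -> nrm s0 != 0 ->
  (forall k f g, S f -> S g -> S (fun z => k * f z + g z)) ->
  (forall al ga s, S s -> S (hact al ga 0 s)) ->
  forall th, Zak th -> forall e : R, 0 < e -> exists2 s, S s & nrm (fun z => th z - s z) < e.
Proof.
move=> SZ Ss0 s0n SD Sh; have Ss : S (fun=> 0).
  have := SD (-1) s0 s0 Ss0 Ss0.
  by rewrite (_ : (fun _ => _) = fun=> 0)//; apply/funext => z; ring.
apply: (L2_density measurable_sq (fun f (Zf : Zak f) => Zf.1) _ _ SZ Ss SD).
- by move=> k f g; exact: Qs_lin.
- by move=> u Zu du; exact: Qs_complete.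
- move=> h Zh hS.
  have [s00|//] := orthogonal_orbit (SZ _ Ss0) Zh (fun al ga => hS _ (Sh al ga _ Ss0)).
  by rewrite s00 eqxx in s0n.
Qed.

(** Sequential, because dominated convergence is about sequences; [VX_strongly_continuous] returns
    to neighbourhoods. *)
Definition hact_cont (th : T * T -> R[i]) : Prop :=
  forall (al ga be : nat -> R) (a g b : R),
    al @ \oo --> a -> ga @ \oo --> g -> be @ \oo --> b ->
    (fun n => nrm (fun z => hact (al n) (ga n) (be n) th z - hact a g b th z)) @ \oo --> 0.

(** The excluded points are those where the floor in the translate of [zak0] by [g] jumps. *)
Lemma ae_not_int (g : R) : {ae leb2, forall z : T * T, ~ (exists n : int, z.2 + g = n%:~R)}.
Proof.
pose A := range (fun n : int => n%:~R - g : T).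
have cA : countable A.
  exact: (card_le_trans (card_image_le (fun n : int => n%:~R - g : T) setT) (countableP _)).
have mA : measurable A.
  rewrite (_ : A = \bigcup_(n : int) [set n%:~R - g]).
    apply: countable_bigcupT_measurable => [|n]; first exact: countableP.
    exact: measurable_set1.
  by apply/seteqP; split=> [_ [n _ <-]|_ [n _ ->]]; exists n.
have : leb2.-negligible (setT `*` A : set (T * T)).
  apply/negligibleP; first exact: (measurableX measurableT mA).
  rewrite [LHS](@product_measure1E _ _ _ _ R leb leb _ _ measurableT mA).
  by rewrite [X in (_ * X)%E](countable_lebesgue_measure0 cA) mule0.
apply: negligibleS => -[x y] /= /contrapT [n yn]; split => //; exists n => //.
by rewrite -yn addrK.
Qed.

(** Explicitly e(- floor(c) b). Its modulus is 1 everywhere, so that it has norm 1 and its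
    translates are uniformly bounded; it shows that the Zak space is not 0. *)
Definition zak0 : T * T -> R[i] := quasi 1 (fun=> 1).

Lemma sq_integrable1 : sq_integrable leb2 sq (fun=> 1 : R[i]).
Proof.
have [m1 m2] := @cmeas_cst R _ (T * T)%type 1; split => //.
rewrite sqmod1 integral_cst; last exact: measurable_sq.
by rewrite [X in (_ * X)%E]leb2_sq mule1 ltry.
Qed.

Lemma Zak_zak0 : Zak zak0.
Proof. exact: (Qs_quasi 1 sq_integrable1). Qed.

Lemma nrm_zak0 : nrm zak0 = 1.
Proof.
rewrite /nrm2; have -> : (\int[leb2]_(x in sq) (sqmod (zak0 x))%:E = \int[leb2]_(x in sq) 1%:E)%E.
  by apply: eq_integral => z _; rewrite /zak0 /quasi sqmodM sqmod_expi2pi mul1r sqmod1.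
rewrite integral_cst; last exact: measurable_sq.
by rewrite [X in (_ * X)%E]leb2_sq mule1.
Qed.

Lemma hact_cont_zak0 : hact_cont zak0.
Proof.
move=> al ga be a g b cal cga cbe.
pose P (x y t : R) (z : T * T) : R := t + z.2 * x - (Num.floor (z.2 + y))%:~R * (z.1 + x).
have hE x y t z : hact x y t zak0 z = expi2pi (P x y t z).
  rewrite /hact /zak0 /quasi /= mulr1 -expi2piD; congr expi2pi.
  by rewrite /P -[1%:~R]/(1 : R); ring.
pose F n z := sqmod (hact (al n) (ga n) (be n) zak0 z - hact a g b zak0 z).
have jZ x y t := (Qs_hact x y t Zak_zak0).1.
have jd n : sq_integrable leb2 sq (fun z => hact (al n) (ga n) (be n) zak0 z - hact a g b zak0 z).
  by apply: (sqiB measurable_sq); exact: jZ.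
have mF n : measurable_fun sq (fun z => (F n z)%:E).
  by apply: measurable_funTS; apply: cmeas_esqmod; exact: (sqi_cmeas (jd n)).
have cF : {ae leb2, forall z, sq z -> (fun n => (F n z)%:E) @ \oo --> (0 : \bar R)%E}.
  apply: filterS (ae_not_int g) => z nz _.
  apply: cvg_EFin; first exact: nearW.
  pose x := z.2 + g; pose m := Num.floor x.
  have /andP[mx xm] := floor_itv x; rewrite -/m in mx xm.
  have {}mx : m%:~R < x.
    by rewrite lt_neqAle mx andbT; apply/eqP => h; apply: nz; exists m; exact: esym h.
  have cx : (fun n => z.2 + ga n) @ \oo --> x by apply: cvgD; [exact: cvg_cst|].
  (* Away from the integers the floor is locally constant, so the phases [P] converge. *)
  have cfl : \forall n \near \oo, Num.floor (z.2 + ga n) = m.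
    near=> n; apply: floor_def; apply/andP; split.
      by apply/ltW; near: n; exact: (cvgr_gt x).
    by near: n; exact: (cvgr_lt x).
  have cP : (fun n => P (al n) (ga n) (be n) z) @ \oo --> P a g b z.
    apply: cvgB.
      by apply: cvgD => //; apply: cvgM => //; exact: cvg_cst.
    apply: cvgM; last by apply: cvgD => //; exact: cvg_cst.
    apply: cvg_near_cst.
    by apply: filterS cfl => n ->.
  have c2P : (fun n => 2 * pi * P (al n) (ga n) (be n) z) @ \oo --> 2 * pi * P a g b z.
    by apply: cvgM => //; exact: cvg_cst.
  have cc := cvg_comp _ _ c2P (@continuous_cos R _).
  have cs := cvg_comp _ _ c2P (@continuous_sin R _).
  rewrite (_ : fine \o _ = fun n =>
    (cos (2 * pi * P (al n) (ga n) (be n) z) - cos (2 * pi * P a g b z)) ^+ 2 +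
    (sin (2 * pi * P (al n) (ga n) (be n) z) - sin (2 * pi * P a g b z)) ^+ 2); last first.
    by apply/funext => n /=; rewrite /F !hE /sqmod !ccE.
  have -> : 0 = (cos (2 * pi * P a g b z) - cos (2 * pi * P a g b z)) ^+ 2 +
    (sin (2 * pi * P a g b z) - sin (2 * pi * P a g b z)) ^+ 2 :> R by ring.
  by apply: cvgD; apply: cvgM; apply: cvgB => //; exact: cvg_cst.
have dF : {ae leb2, forall z, forall n, sq z -> (`|(F n z)%:E| <= 4%:E)%E}.
  apply: aeW => z n _; rewrite gee0_abs ?lee_fin ?sqmod_ge0//.
  apply: (le_trans (sqmodD_le _ _)); rewrite sqmodN !hE !sqmod_expi2pi; lra.
have i4 : leb2.-integrable sq (fun=> 4%:E : \bar R)%E.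
  apply/integrableP; split; first exact: measurable_cst.
  rewrite integral_cst; last exact: measurable_sq.
  by rewrite [X in (_ * X)%E]leb2_sq mule1 ltry.
have [_ _] := dominated_convergence measurable_sq mF (measurable_cst _) cF i4 dF.
rewrite integral0 => /fine_cvgP[_]; apply: cvg_trans; apply: near_eq_cvg.
by apply: nearW => n.
Unshelve. all: by end_near.
Qed.

(** Vectors with continuous orbit form an invariant subspace containing [zak0], hence a dense one;
    the action is isometric, so continuity passes to limits. *)
Lemma hact_cont_all th : Zak th -> hact_cont th.
Proof.
pose S := [set th | Zak th /\ hact_cont th].
have SD k f h : S f -> S h -> S (fun z => k * f z + h z).
  move=> [Zf cf] [Zh ch]; split; first exact: Qs_lin.
  move=> al ga be a g b cal cga cbe.
  have hf := cf _ _ _ _ _ _ cal cga cbe; have hh := ch _ _ _ _ _ _ cal cga cbe.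
  pose U n := 2 * (sqmod k * nrm (fun z => hact (al n) (ga n) (be n) f z - hact a g b f z)) +
      2 * nrm (fun z => hact (al n) (ga n) (be n) h z - hact a g b h z).
  apply: (@squeeze_cvgr _ _ _ _ (fun=> 0) U); [|exact: cvg_cst|]; last first.
    rewrite [X in _ --> X](_ : 0 = 2 * (sqmod k * 0) + 2 * 0); last by ring.
    by apply: cvgD; apply: cvgM => //; [exact: cvg_cst|apply: cvgM => //; exact: cvg_cst|exact: cvg_cst].
  rewrite /U {U}.
  apply: nearW => n; rewrite nrm2_ge0/=.
  have j1 : sq_integrable leb2 sq (fun z => hact (al n) (ga n) (be n) f z - hact a g b f z).
    by apply: (sqiB measurable_sq); exact: (Qs_hact _ _ _ Zf).1.
  have j2 : sq_integrable leb2 sq (fun z => hact (al n) (ga n) (be n) h z - hact a g b h z).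
    by apply: (sqiB measurable_sq); exact: (Qs_hact _ _ _ Zh).1.
  rewrite -(nrm2Z measurable_sq k j1); apply: le_trans (nrm2_addle measurable_sq (sqiZ measurable_sq k j1) j2).
  rewrite le_eqVlt; apply/orP; left; apply/eqP; apply: eq_nrm2 => z _.
  by rewrite /hact; ring.
have Sh al0 ga0 s : S s -> S (hact al0 ga0 0 s).
  move=> [Zs cs]; split; first exact: Qs_hact.
  move=> al ga be a g b cal cga cbe.
  under eq_fun do rewrite !hactM.
  apply: cs; first by apply: cvgD => //; exact: cvg_cst.
    by apply: cvgD => //; exact: cvg_cst.
  apply: cvgD; first by apply: cvgD => //; exact: cvg_cst.
  by apply: cvgM => //; exact: cvg_cst.
move=> Zth al ga be a g b cal cga cbe.
have S0 : S zak0 by split; [exact: Zak_zak0|exact: hact_cont_zak0].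
have n0 : nrm zak0 != 0 by rewrite nrm_zak0 oner_eq0.
apply/cvgrPdist_lt => e e0.
(* Two uses of [nrm2_tri] produce the coefficients 2, 4 and 4, of sum 10 < 12. *)
have e4 : 0 < e / 12 by rewrite divr_gt0.
have [s [Zs cs] sth] := Zak_density (fun s (Ss : S s) => Ss.1) S0 n0 SD Sh Zth e4.
have /cvgrPdist_lt /(_ _ e4) := cs _ _ _ _ _ _ cal cga cbe.
apply: filterS => n; rewrite sub0r normrN ger0_norm ?nrm2_ge0// => cn.
rewrite sub0r normrN ger0_norm ?nrm2_ge0//.
have j1 x y t := (Qs_hact x y t Zth).1; have j2 x y t := (Qs_hact x y t Zs).1.
have Zd : Zak (fun z => th z - s z).
  have := Qs_lin (-1) Zs Zth; rewrite (_ : (fun _ => _) = fun z => th z - s z)//.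
  by apply/funext => z; ring.
have d1 x y t : nrm (fun z => hact x y t th z - hact x y t s z) < e / 12.
  apply: le_lt_trans sth; rewrite -(nrm_hact x y t Zd).
  by rewrite le_eqVlt; apply/orP; left; apply/eqP; apply: eq_nrm2 => z _; rewrite /hact; ring.
apply: (le_lt_trans (nrm2_tri measurable_sq (j1 _ _ _) (j2 (al n) (ga n) (be n)) (j1 _ _ _))).
have := nrm2_tri measurable_sq (j2 (al n) (ga n) (be n)) (j2 a g b) (j1 a g b).
have := d1 (al n) (ga n) (be n); have := d1 a g b; rewrite (nrm2_sym _ _ (hact a g b th)).
move: cn; lra.
Qed.

End ZakSpace.

(** * Representations of the Heisenberg group *)

Section AlmostEverywhere.
Context {R : realType} {d : measure_display} {S : measurableType d}.
Variable mu : {measure set S -> \bar R}.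
Implicit Types P : S -> Prop.

Lemma aeS P P' : {ae mu, forall x, P x} -> (forall x, P x -> P' x) -> {ae mu, forall x, P' x}.
Proof. by move=> h1 h; apply: filterS h1. Qed.

Lemma aeS2 P1 P2 P' : {ae mu, forall x, P1 x} -> {ae mu, forall x, P2 x} ->
  (forall x, P1 x -> P2 x -> P' x) -> {ae mu, forall x, P' x}.
Proof. by move=> h1 h2 h; apply: filterS2 h1 h2. Qed.

Lemma aeS3 P1 P2 P3 P' : {ae mu, forall x, P1 x} -> {ae mu, forall x, P2 x} ->
  {ae mu, forall x, P3 x} ->
  (forall x, P1 x -> P2 x -> P3 x -> P' x) -> {ae mu, forall x, P' x}.
Proof. by move=> h1 h2 h3 h; apply: filterS3 h1 h2 h3. Qed.

End AlmostEverywhere.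

Section HeisenbergAE.
Context {R : realType}.
Notation T := (measurableTypeR R).
Notation H3 := (T * T * T)%type.
Implicit Types (F G K : H3 -> R[i]) (h g : H3).

Lemma heq_refl F : heq F F.
Proof. exact: aeW. Qed.

Lemma heq_sym F G : heq F G -> heq G F.
Proof. by move=> h; apply: (aeS h) => g ->. Qed.

Lemma heq_trans F G K : heq F G -> heq G K -> heq F K.
Proof. by move=> h1 h2; apply: (aeS2 h1 h2) => g -> ->. Qed.

Lemma hmul_shear h g : hmul h g = shear h.1.1 h.1.2 h.2 h.1.2 0 g.
Proof.
case: h g => [[a c] z] [[a' c'] z']; rewrite /shear /hmul /=.
by congr (_, _, _); ring.
Qed.

Lemma hmulr_shear h g : hmul g h = shear h.1.1 h.1.2 h.2 0 h.1.1 g.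
Proof.
case: h g => [[a c] z] [[a' c'] z']; rewrite /shear /hmul /=.
by congr (_, _, _); ring.
Qed.

Lemma measurable_hmulr h : measurable_fun setT (fun g : H3 => hmul g h : H3).
Proof.
rewrite (_ : (fun _ => _) = shear h.1.1 h.1.2 h.2 0 h.1.1); first exact: measurable_shear.
by apply/funext => g; rewrite hmulr_shear.
Qed.

Lemma ae_hmull h (P : H3 -> Prop) :
  {ae haar, forall g, P g} -> {ae haar, forall g, P (hmul h g)}.
Proof.
by move=> /(ae_shear h.1.1 h.1.2 h.2 h.1.2 0) aP; apply: (aeS aP) => g; rewrite hmul_shear.
Qed.

Lemma ae_hmulr h (P : H3 -> Prop) :
  {ae haar, forall g, P g} -> {ae haar, forall g, P (hmul g h)}.
Proof.
by move=> /(ae_shear h.1.1 h.1.2 h.2 0 h.1.1) aP; apply: (aeS aP) => g; rewrite hmulr_shear.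
Qed.

Lemma heq_rho h F G : heq F G -> heq (rho h F) (rho h G).
Proof. exact: (ae_hmulr h (P := fun g => F g = G g)). Qed.

Lemma hmulA (g h k : H3) : hmul (hmul g h) k = hmul g (hmul h k).
Proof.
case: g h k => [[a c] z] [[a' c'] z'] [[a'' c''] z'']; rewrite /hmul /=.
by congr (_, _, _); ring.
Qed.

Lemma rho1 F : rho hone F = F.
Proof.
apply/funext => -[[a c] z]; rewrite /rho /hmul /hone /=.
by congr (F (_, _, _)); ring.
Qed.

Lemma rhoM h h' F : rho (hmul h h') F = rho h (rho h' F).
Proof. by apply/funext => g; rewrite /rho hmulA. Qed.

Lemma cmeas_rho h F : cmeas F -> cmeas (rho h F).
Proof. by move=> mF; exact: (cmeas_comp mF (measurable_hmulr h)). Qed.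

Lemma L2H_cmeas F : L2H F -> cmeas F.
Proof. by move=> [[]]. Qed.

Lemma L2H_heq F G : cmeas F -> heq F G -> L2H G -> L2H F.
Proof.
move=> mF FG LG; have [[_ _ goo] inv] := LG; have mG := L2H_cmeas LG.
split.
  have [m1 m2] := mF; split => //.
  rewrite (ae_integral_sqmod measurable_cube mF mG)//.
  by apply: (aeS FG) => g -> _.
move=> a c z; apply: (heq_trans (ae_hmull (a%:~R, c%:~R, z%:~R) FG)).
by apply: heq_trans (inv a c z) _; exact: heq_sym.
Qed.

Lemma heq_L2inner F F' G G' : cmeas F -> cmeas F' -> cmeas G -> cmeas G' ->
  heq F F' -> heq G G' -> L2inner haar cube F G = L2inner haar cube F' G'.
Proof.
move=> mF mF' mG mG' FF' GG'.
have [m1 m2] := cmeasM mF (cmeasJ mG); have [m3 m4] := cmeasM mF' (cmeasJ mG').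
apply: complexE2; rewrite /= /Rintegral; congr fine; apply: ae_eq_integral.
- exact: measurable_cube.
- by apply: measurable_funTS; exact: (measurable_EFinP _ _).2.
- by apply: measurable_funTS; exact: (measurable_EFinP _ _).2.
- by apply: (aeS2 FF' GG') => g -> ->.
- exact: measurable_cube.
- by apply: measurable_funTS; exact: (measurable_EFinP _ _).2.
- by apply: measurable_funTS; exact: (measurable_EFinP _ _).2.
- by apply: (aeS2 FF' GG') => g -> ->.
Qed.

Lemma heq_L2dist2 F F' G G' : cmeas F -> cmeas F' -> cmeas G -> cmeas G' ->
  heq F F' -> heq G G' -> L2dist2 haar cube F G = L2dist2 haar cube F' G'.
Proof.
move=> mF mF' mG mG' FF' GG'.
apply: (ae_integral_sqmod measurable_cube (cmeasB mF mG) (cmeasB mF' mG')).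
by apply: (aeS2 FF' GG') => g -> -> _.
Qed.

Lemma nrm2_eq0_ae d (S : measurableType d) (mu : {measure set S -> \bar R}) (D : set S)
    (f : S -> R[i]) : measurable D -> sq_integrable mu D f -> nrm2 mu D f = 0 ->
  {ae mu, forall x, D x -> f x = 0}.
Proof.
move=> mD jf f0.
have mf : measurable_fun D (fun x => (sqmod (f x))%:E).
  by apply: measurable_funTS; exact: (cmeas_esqmod (sqi_cmeas jf)).
have /(ae_eq_integral_abs mu mD mf) : (\int[mu]_(x in D) `|(sqmod (f x))%:E| = 0)%E.
  under eq_integral do rewrite gee0_abs ?lee_fin ?sqmod_ge0//.
  by rewrite (nrm2E jf) f0.
by move=> ae0; apply: (aeS ae0) => x h /h [] /eqP; rewrite sqmod_eq0 => /eqP.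
Qed.

(** Each element of H(Z) comes with its own null set, off which invariance holds. H(Z) being
    countable, one null set serves all elements, and every point has a translate in the cube. *)
Lemma L2H_cube_heq F G : L2H F -> L2H G ->
  {ae haar, forall g, cube g -> F g = G g} -> heq F G.
Proof.
move=> [jF iF] [jG iG] FG.
(* An enumeration of H(Z); numbers that encode no triple give the identity. *)
pose gam k : H3 := let: (a, c, z) := odflt (0, 0, 0) (unpickle k : option (int * int * int)) in
  (a%:~R, c%:~R, z%:~R).
have h1 : {ae haar, forall g, forall k, cube (hmul (gam k) g) -> F (hmul (gam k) g) = G (hmul (gam k) g)}.
  by apply: ae_foralln => k; exact: (ae_hmull (gam k) FG).
have h2 : {ae haar, forall g, forall k, F (hmul (gam k) g) = F g}.
  by apply: ae_foralln => k; rewrite /gam; case: (odflt _ _) => [[a c] z]; exact: iF.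
have h3 : {ae haar, forall g, forall k, G (hmul (gam k) g) = G g}.
  by apply: ae_foralln => k; rewrite /gam; case: (odflt _ _) => [[a c] z]; exact: iG.
apply: (aeS3 h1 h2 h3) => -[[a c] z] {}h1 {}h2 {}h3.
pose m := - Num.floor a; pose n := - Num.floor c.
(* The group law adds n a to the last coordinate, so the floor is taken after this addition. *)
pose k0 := - Num.floor (z + n%:~R * a).
pose k := pickle (m, n, k0).
rewrite -(h2 k) -(h3 k); apply: h1.
rewrite /gam /k pickleK /= /hmul /cube /=.
have e1 : m%:~R + a = frac a by rewrite /m /frac mulrNz addrC.
have e2 : n%:~R + c = frac c by rewrite /n /frac mulrNz addrC.
have e3 : k0%:~R + z + n%:~R * a = frac (z + n%:~R * a) by rewrite /k0 /frac mulrNz; ring.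
by rewrite e1 e2 e3 !frac_ge0 !ltW ?frac_lt1.
Qed.

End HeisenbergAE.

(** * The maps J_X *)

Section WeilBrezinModel.
Context {R : realType}.
Notation T := (measurableTypeR R).
Notation H3 := (T * T * T)%type.
Notation nrm := (nrm2 leb2 sq).
Notation Zak := (Qs (R:=R) 1).
Variable N : int.
Hypothesis N0 : N != 0.
Implicit Types (th eta phi : T * T -> R[i]) (X Y : int -> R[i]) (F G : H3 -> R[i]).

Let NR0 : N%:~R != 0 :> R. Proof. by rewrite intr_eq0. Qed.

Definition zterm (n : int) th (w : T * T) : R[i] :=
  expi2pi (n%:~R * w.1) * th (N%:~R * w.1, w.2 + n%:~R / N%:~R).

Lemma cmeas_zterm n th : cmeas th -> cmeas (zterm n th).
Proof.
move=> mth; apply: cmeasM.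
  by apply: cmeas_expi2pi; exact: (measurable_funM (measurable_cst _) measurable_fst).
apply: (cmeas_comp mth); apply: measurable_pairfun.
  exact: (measurable_funM (measurable_cst _) measurable_fst).
exact: (measurable_funD measurable_snd (measurable_cst _)).
Qed.

Lemma qper_zterm n th : qper 1 th -> qper N (zterm n th).
Proof.
move=> qth; split=> b c; rewrite /zterm /=.
  rewrite !mulrDr !mulr1 expi2piDint; congr (_ * _).
  exact: (qper_int1 _ _ _ qth).
rewrite addrAC qth.2 mulrCA -[1%:~R]/(1 : R) mul1r; congr (_ * _).
Qed.

Lemma cint_zterm th eta n : Zak th -> Zak eta ->
  cint leb2 sq (fun w => zterm n th w * conjc (zterm n eta w)) =
  cint leb2 sq (fun w => th w * conjc (eta w)).
Proof.
move=> [jth qth] [jeta qeta].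
have mth := sqi_cmeas jth; have meta := sqi_cmeas jeta.
have [p1 p2] := qper_mulJ qth qeta.
pose K w := th w * conjc (eta w).
have mK : cmeas K by exact: (cmeasM mth (cmeasJ meta)).
rewrite -[RHS](cint_sq_shift 0 (n%:~R / N%:~R) mK p1 p2).
rewrite -[RHS](@cint_sq_scale1 _ _ N N0).
- apply: eq_cint => w _; rewrite /zterm /K rmorphM/= mulrACA mulJ_sqmod sqmod_expi2pi.
  by rewrite (_ : 1%:C = 1) ?mul1r ?addr0.
- exact: (cmeas_comp mK (measurable_sq_shift 0 (n%:~R / N%:~R))).
- by move=> x y /=; rewrite !addr0 /K p1.
Qed.

(** Stated for the integral in the extended reals, without assuming it finite: [Zak_zcomp] derives
    square integrability from it. *)
Lemma integral_sqmod_zterm n th : cmeas th -> qper 1 th ->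
  (\int[leb2]_(w in sq) (sqmod (zterm n th w))%:E = \int[leb2]_(w in sq) (sqmod (th w))%:E)%E.
Proof.
move=> mth qth.
pose K (t : R) (w : T * T) : \bar R := (sqmod (th (w.1, w.2 + t)))%:E.
have mK t : measurable_fun setT (K t).
  exact: (cmeas_esqmod (cmeas_comp mth (measurable_sq_shift2 t))).
have K1 t x y : K t (x + 1, y) = K t (x, y) by rewrite /K /= (qper_sqmod1 qth).
have K2 t x y : K t (x, y + 1) = K t (x, y) by rewrite /K /= addrAC (qper_sqmod2 qth).
have <- : (\int[leb2]_(x in sq) K (n%:~R / N%:~R)%R (N%:~R * x.1, x.2)%R =
    \int[leb2]_(x in sq) (sqmod (zterm n th x))%:E)%E.
  by apply: eq_integral => w _; rewrite /K /zterm sqmodM sqmod_expi2pi mul1r.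
rewrite (integral_sq_scale1 (mK _) (K1 _) N0).
have <- : (\int[leb2]_(x in sq) K 0%R (x.1 + 0, x.2 + n%:~R / N%:~R)%R =
    \int[leb2]_(x in sq) K (n%:~R / N%:~R)%R x)%E.
  by apply: eq_integral => w _; rewrite /K /= !addr0.
rewrite (integral_sq_shift (mK 0) (K1 0) (K2 0)).
by apply: eq_integral => w _; rewrite /K addr0 -surjective_pairing.
Qed.

Lemma Qs_zterm n th : Zak th -> Qs N (zterm n th).
Proof.
move=> [jth qth]; have mth := sqi_cmeas jth; split; last exact: qper_zterm.
have [m1 m2] := cmeas_zterm n mth; split=> //.
by rewrite integral_sqmod_zterm//; case: jth.
Qed.

(** The shift b -> b + 1/N preserves the integral and multiplies the integrand by e((n - m)/N),
    which is not 1. *)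
Lemma cint_zterm0 th eta (n m : int) : Zak th -> Zak eta -> ~~ (N %| n - m)%Z ->
  cint leb2 sq (fun w => zterm n th w * conjc (zterm m eta w)) = 0.
Proof.
move=> Zth Zeta nm.
have [jn qn] := Qs_zterm n Zth; have [jm qm] := Qs_zterm m Zeta.
have [p1 p2] := qper_mulJ qn qm.
pose K w := zterm n th w * conjc (zterm m eta w).
have mK : cmeas K by exact: (cmeasM (sqi_cmeas jn) (cmeasJ (sqi_cmeas jm))).
have iK : cinteg leb2 sq K by exact: (cinteg_mulJ measurable_sq jn jm).
have e1 := expi2pi_frac_neq1 (R := R) N0 nm.
have := cint_sq_shift (N%:~R)^-1 0 mK p1 p2.
have [_ qth] := Zth; have [_ qeta] := Zeta.
have sh (p : int) f w : qper 1 f -> zterm p f (w.1 + (N%:~R)^-1, w.2 + 0) =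
    expi2pi (p%:~R / N%:~R) * zterm p f w.
  move=> [f1 _]; rewrite /zterm /= addr0 !mulrDr mulfV// f1 expi2piD; ring.
have -> : cint leb2 sq (fun z => K (z.1 + (N%:~R)^-1, z.2 + 0)) =
    expi2pi ((n - m)%:~R / N%:~R) * cint leb2 sq K.
  rewrite -(cintZ measurable_sq _ iK); apply: eq_cint => w _.
  rewrite /K !sh// cJM -expi2piN mulrACA -expi2piD; congr (expi2pi _ * _).
  by rewrite rmorphB /=; ring.
move/eqP; rewrite -subr_eq0 -{2}[cint _ _ _]mul1r -mulrBl mulf_eq0 subr_eq0.
by rewrite (negbTE e1) => /eqP.
Qed.

Definition ztheta X th (w : T * T) : R[i] :=
  \sum_(n < `|N|) X n%:Z * zterm n%:Z th w.

Definition zdot X Y : R[i] := \sum_(n < `|N|) X n%:Z * conjc (Y n%:Z).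

Lemma Qs_ztheta X th : Zak th -> Qs N (ztheta X th).
Proof. by move=> Zth; apply: Qs_sum => n; exact: Qs_zterm. Qed.

Lemma ord_dvd_eq (n m : 'I_`|N|) : (N %| n%:Z - m%:Z)%Z = (n == m).
Proof.
apply/idP/eqP => [|->]; last by rewrite subrr dvdz0.
rewrite dvdzE => /dvdnP [k]; move: (ltn_ord n) (ltn_ord m) => hn hm hk.
apply/val_inj => /=; case: k hk => [|k] hk; last by lia.
by lia.
Qed.

Lemma L2inner_ztheta X Y th eta : Zak th -> Zak eta ->
  L2inner leb2 sq (ztheta X th) (ztheta Y eta) = zdot X Y * L2inner leb2 sq th eta.
Proof.
move=> Zth Zeta; rewrite !L2innerE.
have ip (n m : int) : cinteg leb2 sq (fun w => zterm n th w * conjc (zterm m eta w)).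
  exact: (cinteg_mulJ measurable_sq (Qs_zterm n Zth).1 (Qs_zterm m Zeta).1).
transitivity (cint leb2 sq (fun w => \sum_(n < `|N|) \sum_(m < `|N|)
    (X n%:Z * conjc (Y m%:Z)) * (zterm n%:Z th w * conjc (zterm m%:Z eta w)))).
  apply: eq_cint => w _; rewrite /ztheta rmorph_sum mulr_suml/=; apply: eq_bigr => n _.
  rewrite mulr_sumr; apply: eq_bigr => m _.
  by rewrite rmorphM/= mulrACA.
rewrite (cint_sum measurable_sq); last first.
  by move=> n; apply: (cinteg_sum measurable_sq) => m; exact: (cintegZ measurable_sq).
rewrite /zdot mulr_suml; apply: eq_bigr => n _.
rewrite (cint_sum measurable_sq); last by move=> m; exact: (cintegZ measurable_sq).
rewrite (bigD1 n)//= big1 ?addr0 => [|m mn]; rewrite (cintZ measurable_sq)//.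
  by rewrite cint_zterm.
by rewrite cint_zterm0 ?mulr0// ord_dvd_eq eq_sym.
Qed.

Definition lift phi (g : H3) : R[i] := expi2pi (N%:~R * g.2) * phi g.1.

Lemma cmeas_lift phi : cmeas phi -> cmeas (lift phi).
Proof.
move=> mphi; apply: cmeasM.
  by apply: cmeas_expi2pi; exact: (measurable_funM (measurable_cst _) measurable_snd).
exact: (cmeas_comp mphi measurable_fst).
Qed.

Lemma L2inner_lift phi psi : cmeas phi -> cmeas psi ->
  L2inner haar cube (lift phi) (lift psi) = L2inner leb2 sq phi psi.
Proof.
move=> m1 m2; rewrite !L2innerE.
have [mr mi] := cmeasM m1 (cmeasJ m2).
transitivity (cint haar cube (fun g : H3 => phi g.1 * conjc (psi g.1))).
  apply: eq_cint => g _; rewrite /lift rmorphM/= mulrACA mulJ_sqmod sqmod_expi2pi.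
  by rewrite (_ : 1%:C = 1) ?mul1r.
apply: complexE2; rewrite /= /Rintegral; congr fine.
  exact: (integral_cube_fst (f := fun w => (complex.Re (phi w * conjc (psi w)))%:E)
    ((measurable_EFinP _ _).2 mr)).
exact: (integral_cube_fst (f := fun w => (complex.Im (phi w * conjc (psi w)))%:E)
  ((measurable_EFinP _ _).2 mi)).
Qed.

Lemma integral_sqmod_lift phi : cmeas phi ->
  (\int[haar]_(g in cube) (sqmod (lift phi g))%:E = \int[leb2]_(w in sq) (sqmod (phi w))%:E)%E.
Proof.
move=> mphi; rewrite -(integral_cube_fst (cmeas_esqmod mphi)).
by apply: eq_integral => g _; rewrite /lift sqmodM sqmod_expi2pi mul1r.
Qed.

(** The twist in [qper N] compensates the term c a' of the group law. *)
Lemma lift_invariant phi (a c z : int) g : qper N phi ->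
  lift phi (hmul (a%:~R, c%:~R, z%:~R) g) = lift phi g.
Proof.
move=> qphi; case: g => [[x y] t]; rewrite /lift /hmul /=.
rewrite [a%:~R + x]addrC [c%:~R + y]addrC (qper_int1 _ _ _ qphi) (qper_int2 _ _ _ qphi).
rewrite mulrA -expi2piD; congr (_ * _).
have -> : N%:~R * (z%:~R + t + c%:~R * x) - c%:~R * (N%:~R * x) =
  N%:~R * t + (N * z)%:~R by rewrite intrM; ring.
by rewrite expi2piDint.
Qed.

Lemma L2H_lift phi : Qs N phi -> L2H (lift phi).
Proof.
move=> [jphi qphi]; have mphi := sqi_cmeas jphi; split.
  have [m1 m2] := cmeas_lift mphi; split => //.
  by rewrite integral_sqmod_lift//; have [] := jphi.
by move=> a c z; apply: aeW => g; exact: lift_invariant.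
Qed.

Definition JX X th : H3 -> R[i] := lift (ztheta X th).

(** The map (a, c, z) -> (Na, c, Nz) is an automorphism of H(R). Composed with it, the action on the
    Zak space becomes right translation, for every [X] alike. *)
Lemma rho_JX X th (h : H3) : qper 1 th ->
  rho h (JX X th) = JX X (hact (N%:~R * h.1.1) h.1.2 (N%:~R * h.2) th).
Proof.
move=> qth; apply/funext => -[[a c] z]; case: h => [[a' c'] z'].
rewrite /rho /JX /lift /hmul /ztheta /= !mulr_sumr; apply: eq_bigr => n _.
rewrite mulrCA [RHS]mulrCA; congr (_ * _).
rewrite /zterm /hact /= !mulrA -!expi2piD; congr (expi2pi _ * th (_, _)); last by ring.
  by rewrite !mulrDr; field.
by ring.
Qed.

(** All measurable representatives are included, as in [HNd], where membership is defined by L2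
    limits. Measurability is required separately, since [heq] does not transfer it. *)
Definition VX X : set (H3 -> R[i]) :=
  [set F | cmeas F /\ exists2 th, Zak th & heq F (JX X th)].

Lemma L2H_JX X th : Zak th -> L2H (JX X th).
Proof. by move=> Zth; apply: L2H_lift; exact: Qs_ztheta. Qed.

Lemma cmeas_JX X th : Zak th -> cmeas (JX X th).
Proof. by move=> /(L2H_JX X) /L2H_cmeas. Qed.

Lemma VX_L2H X : VX X `<=` L2H.
Proof. by move=> F [mF [th Zth FJ]]; apply: L2H_heq FJ _ => //; exact: L2H_JX. Qed.

Lemma VX_JX X th : Zak th -> VX X (JX X th).
Proof. by move=> Zth; split; [exact: cmeas_JX|exists th => //; exact: heq_refl]. Qed.

Lemma JX_lin X (k : R[i]) th eta :
  (fun g => k * JX X th g + JX X eta g) = JX X (fun z => k * th z + eta z).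
Proof.
apply/funext => g; rewrite /JX /lift /ztheta mulrCA -mulrDr mulr_sumr -big_split/=.
by congr (_ * _); apply: eq_bigr => n _; rewrite /zterm; ring.
Qed.

Lemma VX_lin X (k : R[i]) F G : VX X F -> VX X G -> VX X (fun g => k * F g + G g).
Proof.
move=> [mF [th Zth FJ]] [mG [eta Zeta GJ]]; split.
  by apply: cmeasD => //; exact: cmeasZ.
exists (fun z => k * th z + eta z); first exact: Qs_lin.
by rewrite -JX_lin; apply: (aeS2 FJ GJ) => g -> ->.
Qed.

Lemma VX0 X : VX X (fun=> 0).
Proof.
split; first exact: cmeas_cst.
exists (fun=> 0); first exact: Qs0.
apply: aeW => g; rewrite /JX /lift /ztheta big1 ?mulr0// => n _.
by rewrite /zterm !mulr0.
Qed.

Lemma VX_inner X Y F G th eta : Zak th -> Zak eta -> cmeas F -> cmeas G ->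
  heq F (JX X th) -> heq G (JX Y eta) ->
  L2inner haar cube F G = zdot X Y * L2inner leb2 sq th eta.
Proof.
move=> Zth Zeta mF mG FJ GJ.
rewrite (heq_L2inner mF (cmeas_JX X Zth) mG (cmeas_JX Y Zeta) FJ GJ).
rewrite L2inner_lift ?L2inner_ztheta//; apply: sqi_cmeas; exact: (Qs_ztheta _ _).1.
Qed.

Lemma zdot_rc X : zdot X X = (\sum_(n < `|N|) sqmod (X n%:Z))%:C.
Proof.
rewrite /zdot; apply: complexE2; rewrite ?cRe_sum ?cIm_sum /=.
  by apply: eq_bigr => n _; rewrite mulJ_sqmod.
by apply: big1 => n _; rewrite mulJ_sqmod.
Qed.

Definition znorm X : R := \sum_(n < `|N|) sqmod (X n%:Z).

Lemma nrm2_JX X th : Zak th -> nrm2 haar cube (JX X th) = znorm X * nrm th.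
Proof.
move=> Zth; have h := VX_inner Zth Zth (cmeas_JX X Zth) (cmeas_JX X Zth) (heq_refl _) (heq_refl _).
move: h; rewrite !L2inner_nrm2 zdot_rc -rcM => /(congr1 (@complex.Re R)) /=.
by [].
Qed.

Lemma JX_sub X th eta : (fun g => JX X th g - JX X eta g) = JX X (fun z => th z - eta z).
Proof.
have := JX_lin X (-1) eta th.
have -> : (fun g => -1 * JX X eta g + JX X th g) = (fun g => JX X th g - JX X eta g).
  by apply/funext => g; ring.
by move=> ->; congr JX; apply/funext => z; ring.
Qed.

Lemma Zak_sub th eta : Zak th -> Zak eta -> Zak (fun z => th z - eta z).
Proof.
move=> Zth Zeta; have := Qs_lin (-1) Zeta Zth.
by rewrite (_ : (fun _ => _) = fun z => th z - eta z)//; apply/funext => z; ring.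
Qed.

Lemma L2dist2_JX X th eta : Zak th -> Zak eta ->
  L2dist2 haar cube (JX X th) (JX X eta) = (znorm X * nrm (fun z => th z - eta z))%:E.
Proof.
move=> Zth Zeta; rewrite (L2dist2E measurable_cube); [|exact: (L2H_JX _ _).1..].
by rewrite JX_sub nrm2_JX//; exact: Zak_sub.
Qed.

End WeilBrezinModel.

(** * The representation on the image of J_X *)

Section ModelRepresentation.
Context {R : realType}.
Notation T := (measurableTypeR R).
Notation H3 := (T * T * T)%type.
Notation nrm := (nrm2 leb2 sq).
Notation nrmc := (nrm2 haar cube).
Notation Zak := (Qs (R:=R) 1).
Variable N : int.
Hypothesis N0 : N != 0.
Implicit Types (th eta phi : T * T -> R[i]) (X Y : int -> R[i]) (F G : H3 -> R[i]).
Notation JX := (JX N).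
Notation VX := (VX N).

Let NR0 : N%:~R != 0 :> R. Proof. by rewrite intr_eq0. Qed.

Lemma nrmc_heq F F' : cmeas F -> cmeas F' -> heq F F' -> nrmc F = nrmc F'.
Proof.
move=> mF mF' FF'; rewrite /nrm2 (ae_integral_sqmod measurable_cube mF mF')//.
by apply: (aeS FF') => g -> _.
Qed.

Lemma nrmc_eq0_heq F G : L2H F -> L2H G -> nrmc (fun g => F g - G g) = 0 -> heq F G.
Proof.
move=> LF LG h; apply: L2H_cube_heq => //.
have jd := sqiB measurable_cube LF.1 LG.1.
by apply: (aeS (nrm2_eq0_ae measurable_cube jd h)) => g hg /hg /eqP; rewrite subr_eq0 => /eqP.
Qed.

(** The choice [p] may fail to be increasing; the applications use the bounds alone. *)
Lemma fast_subsequence (a : nat -> R) (e : nat -> R) : a @ \oo --> 0 -> (forall n, 0 < e n) ->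
  exists p : nat -> nat, forall n, a (p n) < e n.
Proof.
move=> a0 e0.
have /choice[p pP] n : exists k, a k < e n.
  have /cvgrPdist_lt /(_ _ (e0 n)) [k _ hk] := a0.
  exists k; have := hk k (leqnn k); rewrite /= sub0r normrN.
  by apply: le_lt_trans; exact: ler_norm.
by exists p.
Qed.

Lemma nrmc_limit_eq0 (a : R) (b c : nat -> R) : 0 <= a -> (forall n, a <= 2 * b n + 2 * c n) ->
  (forall n, b n <= 2^-1 ^+ n) -> (exists K, forall n, c n <= K * 2^-1 ^+ n) -> a = 0.
Proof.
move=> a0 abc hb [K hc]; apply/eqP; rewrite eq_le a0 andbT leNgt; apply/negP => agt.
have [n _ hn] := half_pow_lt (2 + 2 * K) agt.
have := hn n (leqnn n); have := abc n; have := hb n; have := hc n; lra.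
Qed.

Section fixedX.
Variable X : int -> R[i].
Hypothesis X0 : 0 < znorm N X.

(** J_X multiplies squared norms by the positive number [znorm N X], so a sequence that converges in
    the image comes from a Cauchy sequence in the Zak space, which is complete. *)
Lemma VX_closed : closed_subspace (VX X).
Proof.
split; [exact: VX_L2H|exact: VX0|by move=> k F G; exact: VX_lin|].
move=> u F Vu LF cv.
have mF := L2H_cmeas LF.
have /choice[th thP] n : exists th, Zak th /\ heq (u n) (JX X th).
  by have [_ [th Zth h]] := Vu n; exists th.
have ju n : L2H (u n) := VX_L2H N0 (Vu n).
have cv' := (L2cvgP measurable_cube (fun n => (ju n).1) LF.1).1 cv.
(* The bound by [znorm N X] makes the preimages [t] a fast Cauchy sequence, and the bound by 1 makes
   their images converge fast to [F]. The 8 leaves room for the factors of [nrm2_tri]. *)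
pose e n := 4^-1 ^+ n * (Num.min 1 (znorm N X) / 8).
have m0 : 0 < Num.min 1 (znorm N X) by rewrite lt_min ltr01.
have m1 : Num.min 1 (znorm N X) <= 1 by rewrite ge_min lexx.
have m2 : Num.min 1 (znorm N X) <= znorm N X by rewrite ge_min lexx orbT.
have e0 n : 0 < e n by rewrite mulr_gt0 ?exprn_gt0 ?invr_gt0// divr_gt0.
have [p pP] := fast_subsequence cv' e0.
pose t n := th (p n).
have Zt n : Zak (t n) := (thP (p n)).1.
have LJ n : L2H (JX X (t n)) := L2H_JX N0 X (Zt n).
have dJF n : nrmc (fun g => JX X (t n) g - F g) < e n.
  apply: le_lt_trans (pP n); rewrite le_eqVlt; apply/orP; left; apply/eqP.
  apply: nrmc_heq; [exact: (cmeasB (L2H_cmeas (LJ n)) mF)|exact: (cmeasB (L2H_cmeas (ju _)) mF)|].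
  by apply: (aeS (thP (p n)).2) => g ->.
have dt n : nrm (fun z => t n.+1 z - t n z) <= 4^-1 ^+ n.
  have := nrm2_tri measurable_cube (LJ n.+1).1 LF.1 (LJ n).1.
  rewrite (nrm2_sym haar cube F (JX X (t n))) JX_sub (nrm2_JX N0 X (Zak_sub (Zt n.+1) (Zt n))) => tri.
  have h1 := dJF n; have h2 := dJF n.+1.
  have e1 : e n.+1 <= e n.
    rewrite /e exprS -mulrA ler_piMl ?ltW//; first exact: e0.
    lra.
  rewrite -(ler_pM2l X0); apply: (le_trans tri).
  have : e n * 8 <= znorm N X * 4^-1 ^+ n.
    rewrite /e -mulrA divfK// mulrC ler_wpM2r// exprn_ge0// invr_ge0//.
  have := nrm2_ge0 haar cube (fun g => JX X (t n) g - F g).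
  by move: h1 h2 e1; rewrite -/(e n); lra.
have [lim Zlim limP] := Qs_complete Zt dt.
split=> //; exists lim => //.
apply: (nrmc_eq0_heq LF (L2H_JX N0 X Zlim)).
apply: (@nrmc_limit_eq0 _ (fun n => nrmc (fun g => F g - JX X (t n) g))
  (fun n => nrmc (fun g => JX X (t n) g - JX X lim g))).
- exact: nrm2_ge0.
- by move=> n; apply: (nrm2_tri measurable_cube LF.1 (LJ n).1); exact: (L2H_JX N0 X Zlim).1.
- move=> n; rewrite nrm2_sym; apply: (le_trans (ltW (dJF n))).
  apply: (@le_trans _ _ (4^-1 ^+ n)).
    rewrite /e ler_piMr ?exprn_ge0 ?invr_ge0//; lra.
  by apply: lerXn2r; rewrite ?nnegrE; lra.
- exists (znorm N X * 4) => n; rewrite JX_sub nrm2_JX//; last exact: Zak_sub.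
  rewrite nrm2_sym -mulrA; apply: ler_wpM2l; [exact: ltW|exact: limP].
Qed.

Lemma VX_rho : rho_invariant (VX X).
Proof.
move=> h F [mF [th Zth FJ]]; split; first exact: cmeas_rho.
exists (hact (N%:~R * h.1.1) h.1.2 (N%:~R * h.2) th); first exact: Qs_hact.
by rewrite -rho_JX; [exact: heq_rho|exact: N0|exact: Zth.2].
Qed.

Lemma VX_strongly_continuous F : VX X F -> forall h0 : R * R * R,
  L2dist2 haar cube (rho h F) (rho h0 F) @[h --> h0] --> 0%E.
Proof.
move=> [mF [th Zth FJ]] h0.
pose ac (h : H3) := hact (N%:~R * h.1.1) h.1.2 (N%:~R * h.2) th.
have Zac h : Zak (ac h) by exact: Qs_hact.
have dE h : L2dist2 haar cube (rho h F) (rho h0 F) =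
    (znorm N X * nrm (fun z => ac h z - ac h0 z))%:E.
  rewrite -L2dist2_JX//.
  apply: heq_L2dist2; try exact: cmeas_rho; try exact: cmeas_JX.
    by rewrite -rho_JX; [exact: heq_rho|exact: N0|exact: Zth.2].
  by rewrite -rho_JX; [exact: heq_rho|exact: N0|exact: Zth.2].
rewrite (_ : (fun h => _) = fun h => (znorm N X * nrm (fun z => ac h z - ac h0 z))%:E); last exact/funext.
apply: cvg_EFin; first exact: nearW.
change ((fun h : R * R * R => znorm N X * nrm (fun z => ac h z - ac h0 z)) @ h0 --> (0 : R)).
apply/cvgrPdist_lt => e e0.
(* If the limit fails, there are points within 1/(n+1) of [h0] at which the distance stays above
   [e]; along this sequence [hact_cont_all] is contradicted. *)
apply: contrapT => nn.
have /choice[hs hsP] n : exists h : R * R * R, ball h0 (n.+1%:R^-1 : R) h /\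
    e <= znorm N X * nrm (fun z => ac h z - ac h0 z).
  apply: contrapT => nex; apply: nn; apply: (nbhs_ballP h0 _).2; exists (n.+1%:R^-1); first by rewrite /= invr_gt0.
  move=> h bh /=; rewrite sub0r normrN ger0_norm; last first.
    by rewrite mulr_ge0 ?nrm2_ge0// ltW.
  by rewrite ltNge; apply/negP => le; apply: nex; exists h.
have cmp (p : R * R * R -> R) : (forall n, `|p h0 - p (hs n)| < n.+1%:R^-1) ->
    (fun n => p (hs n)) @ \oo --> p h0.
  move=> hp; apply/cvgrPdist_lt => d d0.
  have /cvgrPdist_lt /(_ _ d0) := @cvg_harmonic R.
  apply: filterS => n; rewrite sub0r normrN /harmonic /= => hn.
  by apply: (lt_trans (hp n)); apply: le_lt_trans hn; exact: ler_norm.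
have c1 : (fun n => (hs n).1.1) @ \oo --> h0.1.1.
  by apply: (cmp (fun h => h.1.1)) => n; have [[[]]] := hsP n.
have c2 : (fun n => (hs n).1.2) @ \oo --> h0.1.2.
  by apply: (cmp (fun h => h.1.2)) => n; have [[[]]] := hsP n.
have c3 : (fun n => (hs n).2) @ \oo --> h0.2.
  by apply: (cmp (fun h => h.2)) => n; have [[[]]] := hsP n.
have cM (u : nat -> R) (l : R) : u @ \oo --> l -> (fun n => N%:~R * u n) @ \oo --> N%:~R * l.
  by move=> ul; exact: (cvgM (cvg_cst _) ul).
have sc := hact_cont_all Zth (cM _ _ c1) c2 (cM _ _ c3).
have eX : 0 < e / znorm N X by rewrite divr_gt0.
have /cvgrPdist_lt /(_ _ eX) [n _ hn] := sc.
have := hn n (leqnn n); rewrite /= sub0r normrN ger0_norm ?nrm2_ge0//.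
have [_ le] := hsP n.
by rewrite ltr_pdivlMr// mulrC ltNge le.
Qed.

Lemma VX_unitary : unitary_rep (VX X).
Proof.
split.
- by split; [exact: VX_closed|exact: VX_rho].
- by move=> F _; rewrite rho1; exact: heq_refl.
- by move=> h h' F _; rewrite rhoM; exact: heq_refl.
- move=> h F G [mF [th Zth FJ]] [mG [eta Zeta GJ]].
  rewrite (VX_inner N0 Zth Zeta mF mG FJ GJ).
  have FJ' := heq_rho h FJ; have GJ' := heq_rho h GJ.
  rewrite rho_JX in FJ'; [|exact: N0|exact: Zth.2].
  rewrite rho_JX in GJ'; [|exact: N0|exact: Zeta.2].
  rewrite (VX_inner N0 (Qs_hact _ _ _ Zth) (Qs_hact _ _ _ Zeta) (cmeas_rho h mF) (cmeas_rho h mG) FJ' GJ').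
  by rewrite L2inner_hact.
- by move=> F VF h0; exact: VX_strongly_continuous.
Qed.

(** The constant sequence [F] converges in L2 to every representative of its class. *)
Lemma closed_heq (W : set (H3 -> R[i])) F G : closed_subspace W -> W F -> cmeas G ->
  heq G F -> W G.
Proof.
move=> [WL _ _ Wc] WF mG GF.
have LF := WL _ WF; have LG := L2H_heq mG GF LF.
apply: (Wc (fun=> F)) => //.
apply: ((L2cvgP measurable_cube (fun=> LF.1) LG.1).2).
rewrite (_ : (fun n => _) = fun=> 0); first exact: cvg_cst.
apply/funext => n; rewrite -[RHS](_ : nrmc (fun=> 0) = 0).
  apply: nrmc_heq; [exact: (cmeasB (L2H_cmeas LF) mG)|exact: cmeas_cst|].
  by apply: (aeS GF) => g ->; rewrite subrr.
by rewrite /nrm2; under eq_integral do rewrite sqmod0; rewrite integral0.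
Qed.

Lemma nrm_JX_neq0 F th : Zak th -> cmeas F -> heq F (JX X th) -> ~ heq F (fun=> 0) -> nrm th != 0.
Proof.
move=> Zth mF FJ nF; apply/eqP => th0; apply: nF; apply: (heq_trans FJ).
have L0 := VX_L2H N0 (VX0 N X).
apply: (nrmc_eq0_heq (L2H_JX N0 X Zth) L0).
rewrite -[RHS](mulr0 (znorm N X)) -th0 -(nrm2_JX N0 X Zth).
by apply: eq_nrm2 => g _; rewrite subr0.
Qed.

(** The preimage of [W] under J_X is an invariant subspace of the Zak space. If it contains a vector
    of nonzero norm it is dense, and [W], being closed, is everything. *)
Lemma VX_irreducible : irreducible_rep (VX X).
Proof.
split; first exact: VX_unitary.
  exists (JX X zak0); split; first by apply: VX_JX => //; exact: Zak_zak0.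
  move=> J0; have Zz := @Zak_zak0 R.
  have := nrm2_JX N0 X Zz; rewrite nrm_zak0 mulr1 => h.
  have m0 : @cmeas R _ H3 (fun=> 0) by exact: cmeas_cst.
  move: X0; rewrite -h (nrmc_heq (cmeas_JX N0 X Zz) m0 J0).
  by rewrite /nrm2; under eq_integral do rewrite sqmod0; rewrite integral0 ltxx.
move=> W cW iW WV.
have [allW|/existsNP[F /not_implyP[WF nF]]] := pselect (forall F, W F -> heq F (fun=> 0)).
  by left.
right; apply/seteqP; split=> // G [mG [eta Zeta GJ]].
have [mF [th Zth FJ]] := WV _ WF.
pose S := [set s | Zak s /\ W (JX X s)].
have SF : S th.
  by split=> //; apply: (closed_heq cW WF); [exact: cmeas_JX|exact: heq_sym].
have SD k f g : S f -> S g -> S (fun z => k * f z + g z).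
  move=> [Zf Wf] [Zg Wg]; split; first exact: Qs_lin.
  by rewrite -JX_lin; have [_ _ WD _] := cW; exact: WD.
have Sh al ga s : S s -> S (hact al ga 0 s).
  move=> [Zs Ws]; split; first exact: Qs_hact.
  (* Division by [N] undoes the scaling in [rho_JX]. *)
  have := iW (al / N%:~R, ga, 0) _ Ws; rewrite rho_JX//=; last exact: Zs.2.
  by rewrite mulr0 mulrCA divff ?mulr1.
have th0 := nrm_JX_neq0 Zth mF FJ nF.
have dens := Zak_density (fun s (Ss : S s) => Ss.1) SF th0 SD Sh Zeta.
have e0 n : 0 < n.+1%:R^-1 :> R by rewrite invr_gt0.
have /choice[s sP] n : exists s, S s /\ nrm (fun z => eta z - s z) < n.+1%:R^-1.
  by have [s Ss le] := dens _ (e0 n); exists s.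
have LG : L2H G by apply: L2H_heq GJ _ => //; exact: L2H_JX.
have Ls n : L2H (JX X (s n)) by apply: L2H_JX => //; exact: (sP n).1.1.
have [_ _ _ Wc] := cW.
apply: (Wc (fun n => JX X (s n))) => //; first by move=> n; exact: (sP n).1.2.
apply: ((L2cvgP measurable_cube (fun n => (Ls n).1) LG.1).2).
apply/cvgrPdist_lt => e e_gt0.
have eX : 0 < e / znorm N X by rewrite divr_gt0.
have /cvgrPdist_lt /(_ _ eX) := @cvg_harmonic R.
apply: filterS => n; rewrite sub0r normrN /harmonic /= => hn.
rewrite sub0r normrN ger0_norm ?nrm2_ge0//.
have -> : nrmc (fun g => JX X (s n) g - G g) = znorm N X * nrm (fun z => s n z - eta z).
  rewrite -(nrm2_JX N0)//; last by apply: Zak_sub => //; exact: (sP n).1.1.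
  rewrite -JX_sub; apply: nrmc_heq.
  - exact: (cmeasB (L2H_cmeas (Ls n)) mG).
  - exact: (cmeasB (L2H_cmeas (Ls n)) (cmeas_JX N0 X Zeta)).
  - by apply: (aeS GJ) => g ->.
rewrite mulrC -ltr_pdivlMr// nrm2_sym; apply: (lt_trans (sP n).2).
by apply: le_lt_trans hn; exact: ler_norm.
Qed.

Lemma VX_central : has_central_character (VX X) (fun z => expi2pi (N%:~R * z)).
Proof.
move=> t F [mF [th Zth FJ]].
apply: (heq_trans (heq_rho (0, 0, t) FJ)).
apply: (aeS FJ) => -[[a c] z] ->.
rewrite /rho /JX /lift /= !addr0 mulr0 addr0 mulrDr expi2piD.
by rewrite mulrA [expi2pi (N%:~R * t) * _]mulrC.
Qed.

End fixedX.

Lemma VX_orthogonal X Y : zdot N X Y = 0 ->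
  forall F G, VX X F -> VX Y G -> L2inner haar cube F G = 0.
Proof.
move=> XY F G [mF [th Zth FJ]] [mG [eta Zeta GJ]].
by rewrite (VX_inner N0 Zth Zeta mF mG FJ GJ) XY mul0r.
Qed.

End ModelRepresentation.

(** * Splitting H_N by finite Fourier analysis *)

Section SpaceHN.
Context {R : realType}.
Notation T := (measurableTypeR R).
Notation H3 := (T * T * T)%type.
Notation Zak := (Qs (R:=R) 1).
Variable N : int.
Hypothesis N0 : N != 0.
Implicit Types (th phi : T * T -> R[i]) (X : int -> R[i]) (F G : H3 -> R[i]).
Notation JX := (JX N).
Notation lift := (lift N).
Notation zterm := (zterm N).

Let NR0 : N%:~R != 0 :> R. Proof. by rewrite intr_eq0. Qed.

Lemma ae_fst (P : T * T -> Prop) :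
  {ae leb2, forall w, P w} -> {ae (haar : set H3 -> \bar R), forall g, P g.1}.
Proof.
move=> [A [mA A0 PA]]; exists (A `*` setT); split.
- exact: measurableX.
- apply: (etrans (product_measure1E leb2 (@leb R) mA measurableT)).
  exact: (etrans (congr1 (fun x => (x * _)%E) A0) (mul0e _)).
- by move=> g nP; split; [exact: PA|].
Qed.

Lemma lift0 phi w : lift phi (w, 0) = phi w.
Proof. by rewrite /lift /= mulr0 expi2pi0 mul1r. Qed.

(** The restriction [phi] of [G] to z = 0 is measurable and square integrable, but perhaps not
    quasi-periodic everywhere. Its repaired version has the same lift almost everywhere on the cube,
    and [L2H_cube_heq] spreads the agreement over the group. *)
Lemma HNP F : HN N F <-> cmeas F /\ exists2 phi, Qs N phi & heq F (lift phi).
Proof.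
split=> [[LF [G [LG FG GE]]]|[mF [phi Qphi Fphi]]]; last first.
  have Ll := L2H_lift Qphi; split; first exact: (L2H_heq mF Fphi Ll).
  exists (lift phi); split=> //.
  by apply: aeW => g; rewrite lift0.
split; first exact: L2H_cmeas LF.
pose phi w := G (w, 0).
have mG := L2H_cmeas LG.
have mphi : cmeas phi.
  exact: (cmeas_comp mG (measurable_pairfun (@measurable_id _ _ _) (measurable_cst (0 : T)))).
have jphi : sq_integrable leb2 sq phi.
  have [m1 m2] := mphi; split => //.
  rewrite -(integral_sqmod_lift N mphi).
  rewrite -(ae_integral_sqmod measurable_cube mG (cmeas_lift N mphi)); first by have [[]] := LG.
  by apply: (aeS GE) => g ->.
exists (quasi N phi); first exact: Qs_quasi.
apply: (heq_trans FG); apply: (L2H_cube_heq LG (L2H_lift (Qs_quasi N jphi))).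
apply: (aeS2 GE (ae_fst (ae_quasi_id N phi))) => g -> h gc; rewrite /lift h//.
by move: gc; rewrite cubeE => -[].
Qed.

(* [zcomp phi n] is the [th] with [zterm n th] equal to the part of [phi] of weight
   e(nk/N) under b |-> b + k/N. *)
Definition zcomp phi (n : int) (w : T * T) : R[i] :=
  (`|N|%:R)^-1 * \sum_(k < `|N|) expi2pi (- (n%:~R * ((w.1 + k%:R) / N%:~R))) *
    phi ((w.1 + k%:R) / N%:~R, w.2 - n%:~R / N%:~R).

Lemma cmeas_zcomp phi n : cmeas phi -> cmeas (zcomp phi n).
Proof.
move=> mphi; apply: cmeasZ; apply: cmeas_sum => k.
have mk : measurable_fun setT (fun w : T * T => (w.1 + k%:R) / N%:~R : T).
  exact: (measurable_funM (measurable_funD measurable_fst (measurable_cst _)) (measurable_cst _)).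
apply: cmeasM.
  apply: cmeas_expi2pi; apply: measurable_funN.
  exact: (measurable_funM (measurable_cst _) mk).
apply: (cmeas_comp mphi); apply: (measurable_pairfun mk).
exact: (measurable_funD measurable_snd (measurable_cst _)).
Qed.

Let sum_shift (V : nmodType) (f : int -> V) : (forall k, f (k + N) = f k) ->
  \sum_(k < `|N|) f (k%:Z + 1) = \sum_(k < `|N|) f k%:Z.
Proof.
move=> fN; have f0 : f `|N|%N%:Z = f 0.
  have [hN|hN] := leP 0 N; first by rewrite gez0_abs// -[in LHS](add0r N) fN.
  by rewrite ltz0_abs// -[LHS]fN addNr.
have : (0 < `|N|)%N by rewrite absz_gt0.
case: `|N|%N f0 => // m f0 _; rewrite big_ord_recr big_ord_recl /= addrC; congr (_ + _).
  by rewrite -f0; congr f; lia.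
by apply: eq_bigr => i _; congr f; rewrite /bump/=; lia.
Qed.

Lemma qper_zcomp phi n : qper N phi -> qper 1 (zcomp phi n).
Proof.
move=> qphi; split=> b c; rewrite /zcomp /=; last first.
  rewrite [RHS]mulrCA; congr (_ * _); rewrite mulr_sumr; apply: eq_bigr => k _.
  rewrite addrAC qphi.2 mulrCA; congr (_ * _).
  rewrite mulrCA divff// mulr1 opprD -[1%:~R]/(1 : R) mul1r.
  rewrite -[k%:R]/(k%:Z%:~R) -intrN.
  by rewrite expi2piDint.
congr (_ * _).
(* Moving [b] by 1 moves the index [k] by 1; the sum is unchanged because its terms have period [N]
   in [k]. *)
pose f (k : int) := expi2pi (- (n%:~R * ((b + k%:~R) / N%:~R))) *
    phi ((b + k%:~R) / N%:~R, c - n%:~R / N%:~R).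
rewrite -[RHS](_ : \sum_(k < `|N|) f (k%:Z + 1) = _).
  apply: eq_bigr => k _; rewrite /f; congr (expi2pi (- (_ * (_ / _))) * phi (_ / _, _));
  by rewrite intrD -[1%:~R]/(1 : R) -pmulrn; ring.
rewrite sum_shift// => k; rewrite /f.
have -> : (b + (k + N)%:~R) / N%:~R = (b + k%:~R) / N%:~R + 1 :> R by rewrite intrD; field.
rewrite qphi.1; congr (_ * _).
by rewrite mulrDr mulr1 opprD -intrN expi2piDint.
Qed.

Lemma zterm_zcomp phi n w : zterm n (zcomp phi n) w =
  (`|N|%:R)^-1 * \sum_(k < `|N|) expi2pi (- (n%:~R * (k%:R / N%:~R))) *
     phi (w.1 + k%:R / N%:~R, w.2 + 0).
Proof.
rewrite /zterm /zcomp /= mulrCA mulr_sumr; congr (_ * _); apply: eq_bigr => k _.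
have -> : (N%:~R * w.1 + k%:R) / N%:~R = w.1 + k%:R / N%:~R :> R by field.
rewrite mulrA -expi2piD addrK addr0; congr (expi2pi _ * phi _); ring.
Qed.

(** Square integrability is read off from [zterm n (zcomp phi n)], a weighted average of translates
    of [phi]. *)
Lemma Zak_zcomp phi n : Qs N phi -> Zak (zcomp phi n).
Proof.
move=> [jphi qphi]; have mphi := sqi_cmeas jphi.
have mz := cmeas_zcomp n mphi; have qz := qper_zcomp n qphi.
split=> //; have [m1 m2] := mz; split=> //.
rewrite -(integral_sqmod_zterm N0 n mz qz).
suff [_ _] : sq_integrable leb2 sq (zterm n (zcomp phi n)) by [].
rewrite (funext (zterm_zcomp phi n)).
apply: (sqiZ measurable_sq); apply: (sqi_sum measurable_sq) => k.
apply: (sqiZ measurable_sq); apply: sqi_shift => //.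
  exact: qper_sqmod1 qphi.
exact: qper_sqmod2 qphi.
Qed.

(** Exchanging the sums leaves a sum of roots of unity, which vanishes except at k = 0. *)
Lemma sum_zcomp phi w : \sum_(n < `|N|) zterm n%:Z (zcomp phi n%:Z) w = phi w.
Proof.
under eq_bigr do rewrite zterm_zcomp.
rewrite -mulr_sumr exchange_big/=.
have N1 : (0 < `|N|)%N by rewrite absz_gt0.
rewrite (bigD1 (Ordinal N1))//= [X in _ + X]big1 => [|k kN].
  rewrite addr0 mul0r !addr0 -mulr_suml mulrA.
  rewrite (eq_bigr (fun=> 1)); last by move=> i _; rewrite mulr0 oppr0 expi2pi0.
  by rewrite sumr_const card_ord -surjective_pairing mulVf ?mul1r// pnatr_eq0 -lt0n.
rewrite -mulr_suml.
rewrite (eq_bigr (fun i : 'I_`|N| => expi2pi (i%:R * ((- k%:Z)%:~R / N%:~R)))); last first.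
  by move=> i _; congr expi2pi; rewrite rmorphN/= mulNr mulrN.
rewrite sum_expi2pi_frac; last exact: N0.
rewrite dvdzE abszN ifF ?mul0r//.
by apply/negP => /dvdnP [q hq]; move: kN (ltn_ord k); rewrite -val_eqE /=; case: q hq => [|q] /=; lia.
Qed.

Variables (I : eqType) (s : seq I) (X : I -> int -> R[i]) (C : nat -> I -> R[i]).
Hypothesis deltaE : forall n m : 'I_`|N|, \sum_(p <- s) C n p * X p m%:Z = (m == n)%:R.

(** [sum_zcomp] writes [phi] with point masses in place of the [X p]. By [deltaE] each point mass is
    a combination of the [X p], and the terms are regrouped by [p]. *)
Lemma lift_decomposition phi : Qs N phi ->
  exists eta : I -> T * T -> R[i], (forall p, Zak (eta p)) /\
    lift phi = fun g => \sum_(p <- s) JX (X p) (eta p) g.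
Proof.
move=> Qphi.
exists (fun p z => \sum_(n < `|N|) C n p * zcomp phi n%:Z z); split.
  by move=> p; apply: Qs_sum => n; exact: Zak_zcomp.
apply/funext => g; rewrite /JX /lift -mulr_sumr -[in LHS]sum_zcomp; congr (_ * _).
transitivity (\sum_(p <- s) \sum_(m < `|N|) \sum_(n < `|N|)
    (C n p * X p m%:Z) * zterm m%:Z (zcomp phi n%:Z) g.1); last first.
  apply: eq_bigr => p _; apply: eq_bigr => m _; rewrite /zterm !mulr_sumr.
  by apply: eq_bigr => n _; ring.
rewrite exchange_big/=; apply: eq_bigr => m _.
rewrite exchange_big/= (bigD1 m)//= -mulr_suml deltaE eqxx mul1r big1 ?addr0// => n nm.
by rewrite -mulr_suml deltaE eq_sym (negbTE nm) mul0r.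
Qed.

Lemma HN_sum F : cmeas F -> 
  (HN N F <-> exists f : I -> H3 -> R[i], (forall p, p \in s -> VX N (X p) (f p)) /\
    heq F (fun g => \sum_(p <- s) f p g)).
Proof.
move=> mF; split=> [/HNP[_ [phi /lift_decomposition [eta [Zeta ->]] h]]|[f [fV Ff]]].
  by exists (fun p => JX (X p) (eta p)); split=> // p _; exact: VX_JX.
have /choice[eta etaP] p : exists eta, p \in s -> Zak eta /\ heq (f p) (JX (X p) eta).
  have [ps|_] := boolP (p \in s); last by exists (fun=> 0).
  by have [_ [eta Zeta h]] := fV _ ps; exists eta.
(* [eta p] is specified only for [p] in [s]; the guards make every summand quasi-periodic, as
   [Qs_sum] asks. *)
pose phi := fun w => \sum_(p <- s) (if p \in s then 1 else 0) * ztheta N (X p) (if p \in s then eta p else fun=> 0) w.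
apply/HNP; split=> //; exists phi.
  apply: Qs_sum => p; case: ifP => ps; first by apply: Qs_ztheta => //; exact: (etaP _ ps).1.
  by apply: Qs_ztheta => //; exact: Qs0.
apply: (heq_trans Ff).
have aes (r : seq I) : {subset r <= s} ->
    heq (fun g => \sum_(p <- r) f p g) (fun g => \sum_(p <- r) JX (X p) (eta p) g).
  elim: r => [_|p r IH rs]; first by apply: aeW => g; rewrite !big_nil.
  apply: (aeS2 (etaP p (rs _ (mem_head _ _))).2 (IH (fun q qr => rs _ (mem_behead (s := p :: r) qr)))).
  by move=> g h1 h2; rewrite !big_cons h1 h2.
apply: (aeS (aes s (fun _ => id))) => g ->.
rewrite /phi /JX /lift -mulr_sumr; congr (_ * _).
by apply: eq_big_seq => p ->; rewrite mul1r.
Qed.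

End SpaceHN.

(** * Dirichlet characters *)

Section CharacterExistence.
Context {R : realType}.
Variable d' : nat.
Notation d := d'.+1.
Implicit Types u v k : nat.

(* Right multiplication by [dilmx u] is f |-> f(u .) on functions on Z/d.  These
   commuting matrices of finite order are codiagonalizable for u coprime to d, and
   their eigenvalues, as functions of u, are the characters modulo d. *)
Definition dilmx u : 'M[R[i]]_d := \matrix_(i, j) (val i == u * val j %% d)%N%:R.

Let ordm u : 'I_d := Ordinal (ltn_pmod u (ltn0Sn d')).

Lemma mul_dilmx m (P : 'M[R[i]]_(m, d)) u r l : (P *m dilmx u) r l = P r (ordm (u * l)%N).
Proof.
rewrite !mxE (bigD1 (ordm (u * l)%N))//= !mxE eqxx mulr1 big1 ?addr0// => i ni.
by rewrite !mxE (_ : (_ == _) = false) ?mulr0//; apply: contraNF ni => /eqP h; apply/eqP/val_inj.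
Qed.

Lemma dilmxM u v : dilmx u *m dilmx v = dilmx (u * v)%N.
Proof.
apply/matrixP => i l; rewrite mul_dilmx !mxE /=.
by rewrite modnMmr mulnA.
Qed.

Lemma dilmx1 : dilmx 1%N = 1%:M.
Proof. by apply/matrixP => i j; rewrite !mxE mul1n modn_small ?ltn_ord// val_eqE. Qed.

Lemma dilmx_mod u v : u = v %[mod d] -> dilmx u = dilmx v.
Proof. by move=> uv; apply/matrixP => i j; rewrite !mxE -modnMml uv modnMml. Qed.

Lemma dilmxX u k : dilmx u ^+ k = dilmx (u ^ k)%N.
Proof. by elim: k => [|k IH]; rewrite ?dilmx1// exprS IH -[_ * _]/(_ *m _) dilmxM expnS. Qed.

Lemma dilmx_totient u : coprime u d -> dilmx u ^+ totient d = 1.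
Proof. by move=> ud; rewrite dilmxX (dilmx_mod (Euler_exp_totient ud)) dilmx1. Qed.

Lemma uniq_unity_roots k : (0 < k)%N ->
  uniq [seq expi2pi (i%:R / k%:R) : R[i] | i <- iota 0 k].
Proof.
move=> k0; rewrite map_inj_in_uniq ?iota_uniq// => i j; rewrite !mem_iota /= !add0n => ik jk h.
apply/eqP; apply: contraT => ij.
have kz : k%:Z != 0 by rewrite -lt0n in k0 *; lia.
have nd : ~~ (k%:Z %| i%:Z - j%:Z)%Z.
  rewrite dvdzE /=; apply/negP => /dvdnP [q hq]; case: q hq => [|q]; rewrite ?mulSn; lia.
have /negP[] := expi2pi_frac_neq1 (R := R) kz nd; apply/eqP.
rewrite intrB -!pmulrn mulrBl expi2piD h -expi2piD addrN; exact: expi2pi0.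
Qed.

(** The minimal polynomial of [A] divides X^k - 1, which splits with simple roots, the k-th roots of
    unity. *)
Lemma diagonalizable_unipotent (A : 'M[R[i]]_d) k : (0 < k)%N -> A ^+ k = 1 ->
  exists2 P, P \in unitmx & is_diag_mx (conjmx P A).
Proof.
move=> k0 Ak; suff [P Pu PA] : diagonalizable_in unitmx A by exists P.
apply/diagonalizableP; exists [seq expi2pi (i%:R / k%:R) | i <- iota 0 k].
  exact: uniq_unity_roots.
have -> : \prod_(x <- [seq expi2pi (i%:R / k%:R) | i <- iota 0 k]) ('X - x%:P) = 'X^k - 1 :> {poly R[i]}.
  rewrite (@all_roots_prod_XsubC _ ('X^k - 1) [seq expi2pi (i%:R / k%:R) | i <- iota 0 k]).
  - by rewrite lead_coefXnsubC// scale1r.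
  - by rewrite size_XnsubC// size_map size_iota.
  - apply/allP => _ /mapP[i _ ->]; rewrite rootE !hornerE; apply/eqP.
    by rewrite expi2piX mulrCA divff ?mulr1 ?expi2pi_nat ?subrr// pnatr_eq0 -lt0n.
  - by rewrite uniq_rootsE uniq_unity_roots.
by apply: mxminpoly_min; rewrite rmorphB rmorphXn/= horner_mx_X rmorph1 Ak subrr.
Qed.

Lemma codiagonal_dilmx : exists2 P : 'M[R[i]]_d, P \in unitmx &
  forall u, coprime u d -> is_diag_mx (P *m dilmx u *m invmx P).
Proof.
have [] := (codiagonalizableP [seq dilmx u | u <- iota 0 d & coprime u d]).1.
  split=> [A B /mapP[u _ ->] /mapP[v _ ->]|A /mapP[u]].
    by rewrite /comm_mx !dilmxM mulnC.
  rewrite mem_filter => /andP[ud _] ->.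
  by apply: (diagonalizable_unipotent _ (dilmx_totient ud)); rewrite totient_gt0.
move=> P Pu /allP PA; exists P => // u ud.
have um : u %% d = u %[mod d] by rewrite modn_mod.
rewrite -(dilmx_mod um) -conjumx//; apply: PA; apply: map_f.
by rewrite mem_filter coprime_modl ud mem_iota ltn_pmod.
Qed.

(** Row [r] of [P] is a common eigenfunction f on Z/d, with f(u) = c(u, r) f(1) at units u.
    Inverting [P] then expresses the point mass at [j] on the units by the eigenvalues. Different
    [r] may give the same character. *)
Lemma dilmx_eigenvalues : exists c : nat -> 'I_d -> R[i],
  [/\ forall u v r, coprime u d -> c (u * v)%N r = c u r * c v r,
      forall r, c 1%N r = 1,
      forall u v r, u = v %[mod d] -> c u r = c v r &
      forall j, (j < d)%N -> exists k : 'I_d -> R[i],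
        forall u, coprime u d -> \sum_r k r * c u r = (u %% d == j)%N%:R].
Proof.
have [P Pu Pd] := codiagonal_dilmx.
pose E u := P *m dilmx u *m invmx P.
have EM u v : E u *m E v = E (u * v)%N.
  by rewrite /E !mulmxA mulmxKV// -dilmxM !mulmxA.
have Ed u r l : coprime u d -> r != l -> E u r l = 0.
  by move=> ud rl; have /is_diag_mxP := Pd _ ud; apply.
exists (fun u r => E u r r); split.
- move=> u v r ud; rewrite -EM mxE (bigD1 r)//= big1 ?addr0// => i ir.
  by rewrite (Ed u)// 1?eq_sym// mul0r.
- by move=> r; rewrite /E dilmx1 mulmx1 mulmxV// mxE eqxx.
- by move=> u v r uv; rewrite /E (dilmx_mod uv).
move=> j jd; exists (fun r => invmx P (Ordinal jd) r * P r (ordm 1%N)) => u ud.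
have PE r : P r (ordm u) = E u r r * P r (ordm 1%N).
  have -> : ordm u = ordm (u * ordm 1%N)%N by apply/val_inj; rewrite /= modnMmr muln1.
  rewrite -mul_dilmx -[P *m _](mulmxKV Pu) -/(E u) mxE (bigD1 r)//= big1 ?addr0// => i ir.
  by rewrite Ed ?mul0r// eq_sym.
transitivity ((invmx P *m P) (Ordinal jd) (ordm u)).
  by rewrite mxE; apply: eq_bigr => r _; rewrite PE; ring.
by rewrite mulVmx// mxE -val_eqE/= eq_sym.
Qed.

Lemma characters_exist : exists chr : 'I_d -> int -> R[i],
  (forall r, dirichlet_character d (chr r)) /\
  forall j, (j < d)%N -> coprime j d -> exists k : 'I_d -> R[i],
    forall n : int, \sum_r k r * chr r n = (n == j%:Z %[mod d%:Z])%Z%:R.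
Proof.
have [c [cM c1 cm cD]] := dilmx_eigenvalues; set D := d in c cM c1 cm cD *.
have Dp : (0 < D)%N by [].
have D0 : D%:Z != 0 by [].
pose nm (n : int) : nat := `|(n %% D)%Z|%N.
have nmE (n : int) : (nm n)%:Z = (n %% D)%Z by rewrite /nm gez0_abs// modz_ge0.
have nmc (n : int) : coprime (nm n) D = coprimez n D.
  by rewrite -[LHS]/(coprimez (nm n) D) nmE /coprimez gcdz_modl.
clearbody D.
exists (fun r n => if coprimez n D then c (nm n) r else 0); split.
  move=> r; split.
  - move=> n; have -> : nm (n + D) = nm n by rewrite /nm modzDr.
    by rewrite -nmc (_ : nm (n + D) = nm n) ?nmc// /nm modzDr.
  - move=> m n; rewrite coprimezMl.
    have [hm|hm] /= := boolP (coprimez m D); last by rewrite mul0r.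
    have [hn|hn] := boolP (coprimez n D); last by rewrite mulr0.
    rewrite -cM ?nmc//; apply: cm; apply/eqP.
    by rewrite -eqz_nat -!modz_nat PoszM !nmE modz_mod modzMml modzMmr.
  - move=> n; have [hn|hn] := boolP (coprimez n D); last by rewrite eqxx.
    have hn' : coprime (nm n) D by rewrite nmc.
    (* By Euler's theorem the values at units are roots of unity, hence nonzero. *)
    have cX k : c (nm n ^ k)%N r = c (nm n) r ^+ k.
      by elim: k => [|k IH]; rewrite ?c1// expnS cM// IH exprS.
    have := cX (totient D); rewrite (cm _ _ _ (Euler_exp_totient hn')) c1 => h.
    apply/eqP => h0; move: h; rewrite h0 expr0n.
    by rewrite eqn0Ngt totient_gt0 Dp /= => /eqP; rewrite oner_eq0.
move=> j jd cj; have [k kE] := cD j jd; exists k => n.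
have [hn|hn] := boolP (coprimez n D).
  rewrite kE ?nmc//; congr (_%:R).
  rewrite -[(n == _ %[mod _])%Z]/((n %% D)%Z == (j %% D)%Z) -nmE modz_nat eqz_nat.
  by rewrite (modn_small jd) modn_small// -ltz_nat nmE ltz_pmod.
rewrite big1 => [|r _]; last by rewrite mulr0.
case: eqP => // h; move: hn; rewrite /coprimez -gcdz_modl h gcdz_modl.
by rewrite -/(coprimez _ _) -[coprimez _ _]/(coprime j D) cj.
Qed.

End CharacterExistence.

Section DirichletCharacters.
Context {R : realType}.
Implicit Types (d : nat) (chi psi : int -> R[i]).

Lemma dirichlet_modz d chi (n : int) : dirichlet_character d chi -> chi (n %% d)%Z = chi n.
Proof.
move=> [per _ _]; have perk (k : nat) m : chi (m + (k * d)%N%:Z) = chi m.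
  by elim: k => [|k IH]; rewrite ?mul0n ?addr0// mulSnr PoszD addrA per IH.
transitivity (chi ((n %% d)%Z + (n %/ d)%Z * d)); last by rewrite addrC -divz_eq.
case: (_ %/ _)%Z => k; first by rewrite -PoszM perk.
by rewrite NegzE mulNr -PoszM -[in RHS](perk k.+1) subrK.
Qed.

Lemma dirichlet1 d chi : dirichlet_character d chi -> chi 1 = 1.
Proof.
move=> [_ mul nz]; have := nz 1; rewrite /coprimez gcd1z => n1.
by apply: (mulfI n1); rewrite -mul !mulr1.
Qed.

Lemma dirichlet_sqmod d chi (n : int) : (0 < d)%N -> dirichlet_character d chi -> coprimez n d ->
  sqmod (chi n) = 1.
Proof.
move=> d0 D cn; have [_ mul nz] := D; rewrite -(dirichlet_modz n D).
have [k kE] : exists k : nat, (n %% d)%Z = k.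
  by exists `|(n %% d)%Z|%N; rewrite gez0_abs// modz_ge0// -lt0n.
have ck : coprime k d by rewrite -[coprime k d]/(coprimez k d) -kE /coprimez gcdz_modl.
rewrite kE; have cX (t : nat) : chi (k ^ t)%N = chi k ^+ t.
  by elim: t => [|t IH]; rewrite ?(dirichlet1 D)// expnS PoszM mul IH exprS.
have : chi k ^+ totient d = 1.
  rewrite -cX -(dirichlet_modz _ D) modz_nat (Euler_exp_totient ck) -modz_nat.
  by rewrite (dirichlet_modz _ D) (dirichlet1 D).
have sX (z : R[i]) (t : nat) : sqmod (z ^+ t) = sqmod z ^+ t.
  by elim: t => [|t IH]; rewrite ?sqmod1// !exprS sqmodM IH.
move/(congr1 sqmod); rewrite sX sqmod1 => /eqP.
by rewrite pexpr_eq1 ?sqmod_ge0 ?totient_gt0// => /eqP.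
Qed.

(** At some unit n the two characters differ, so h(n) = chi(n) conj(psi(n)) is not 1; substituting
    nk for k multiplies the sum by h(n). *)
Lemma dirichlet_orthogonal d chi psi : (0 < d)%N ->
  dirichlet_character d chi -> dirichlet_character d psi -> chi != psi ->
  \sum_(k < d) chi k%:Z * conjc (psi k%:Z) = 0.
Proof.
case: d => // d' _; set d := d'.+1 => Dc Dp cp.
have [[_ cM cnz] [_ pM pnz]] := (Dc, Dp).
have [n cpn] : exists n, chi n != psi n.
  apply: contrapT => nex; move/eqP: cp; apply; apply/funext => n.
  by apply/eqP; apply: contrapT => h; apply: nex; exists n; apply/negP.
have cn : coprimez n d.
  apply: contraT => nc; move: cpn.
  move: (cnz n) (pnz n); rewrite (negbTE nc) => /negbFE/eqP -> /negbFE/eqP ->.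
  by rewrite eqxx.
pose h m := chi m * conjc (psi m).
have hM m k : h (m * k) = h m * h k by rewrite /h cM pM rmorphM/= mulrACA.
have hmod m : h (m %% d)%Z = h m by rewrite /h (dirichlet_modz _ Dc) (dirichlet_modz _ Dp).
have hn1 : h n != 1.
  apply: contra cpn => /eqP h1; apply/eqP.
  rewrite -[LHS]mulr1 -(_ : (1 : R)%:C = 1)// -(dirichlet_sqmod (ltn0Sn d') Dp cn).
  by rewrite -mulJ_sqmod [psi n * _]mulrC mulrA -/(h n) h1 mul1r.
have [u uE] : exists u : nat, (n %% d)%Z = u.
  by exists `|(n %% d)%Z|%N; rewrite gez0_abs// modz_ge0.
have cu : coprime u d by rewrite -[coprime u d]/(coprimez u d) -uE /coprimez gcdz_modl.
pose f (k : 'I_d) : 'I_d := Ordinal (ltn_pmod (u * k) (ltn0Sn d')).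
have finj : injective f.
  move=> i j /(congr1 val) /= /eqP.
  rewrite -eqz_nat -!modz_nat eqz_mod_dvd !PoszM -mulrBr Gauss_dvdzr; last first.
    by rewrite -[coprimez _ _]/(coprime d u) coprime_sym.
  by rewrite (@ord_dvd_eq R d%:Z isT) => /eqP.
have e : \sum_(k < d) h k%:Z = h n * \sum_(k < d) h k%:Z.
  rewrite [LHS](reindex_inj finj) mulr_sumr; apply: eq_bigr => k _.
  by rewrite /f /= -modz_nat hmod PoszM hM -uE hmod.
apply/eqP; move/eqP: e; rewrite -subr_eq0 -{1}[\sum_(k < d) _]mul1r -mulrBl mulf_eq0 subr_eq0.
by rewrite eq_sym (negbTE hn1).
Qed.

End DirichletCharacters.

(** * The functions chi(nd/N) on Z/N *)

Section ChiRatio.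
Context {R : realType}.
Variable N : int.
Hypothesis N0 : N != 0.
Implicit Types (d g : nat) (chi psi : int -> R[i]).

(** The sign of [N]: if |N| = gd, then nd/N at n = gk equals [ep * k]. *)
Let ep : int := (-1) ^+ (N < 0)%R.
Let ep2 : ep * ep = 1. Proof. by rewrite -expr2 sqrr_sign. Qed.
Let NE g d : `|N|%N = (g * d)%N -> N = ep * (g%:Z * d%:Z).
Proof. by move=> h; rewrite [LHS]intEsign h PoszM. Qed.

Lemma chi_ratio_mul g d chi (k : int) : `|N|%N = (g * d)%N ->
  chi_ratio N d chi (g%:Z * k) = chi (ep * k).
Proof.
move=> h; rewrite /chi_ratio; have -> : g%:Z * k * d%:Z = (ep * k) * N.
  by rewrite (NE h) mulrACA ep2 mul1r; ring.
by rewrite dvdz_mull// mulzK.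
Qed.

Lemma chi_ratio_eq0 g d chi (n : int) : `|N|%N = (g * d)%N -> ~~ (g%:Z %| n)%Z ->
  chi_ratio N d chi n = 0.
Proof.
move=> h gn; rewrite /chi_ratio ifN//; apply: contra gn => /dvdzP [q qE].
have d0 : d%:Z != 0 by apply: contraNneq N0 => d0; rewrite (NE h) d0 !mulr0.
have : n * d%:Z = (q * ep * g%:Z) * d%:Z by rewrite qE (NE h) !mulrA.
by move/(mulIf d0) ->; rewrite dvdz_mull.
Qed.

(** The support of chi(nd/N) determines g, hence d; for different moduli the supports are disjoint,
    and orthogonality holds term by term. *)
Lemma chi_ratio_neq0 g d chi (n : int) : `|N|%N = (g * d)%N -> dirichlet_character d chi ->
  chi_ratio N d chi n != 0 -> gcdn `|n| `|N| = g.
Proof.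
move=> h [_ _ nz] Xn.
have /dvdzP [k kE] : (g%:Z %| n)%Z by apply: contraNT Xn => /(chi_ratio_eq0 chi h) ->.
move: Xn; rewrite kE mulrC (chi_ratio_mul _ _ h) nz coprimezMl => /andP[_ ck].
rewrite abszM h -muln_gcdr /= (_ : gcdn `|k| d = 1%N) ?muln1//.
by apply/eqP; move: ck; rewrite /coprimez /gcdz eqz_nat.
Qed.

Lemma sum_multiples g d (f : nat -> R[i]) : (0 < g)%N ->
  (forall n, ~~ (g %| n)%N -> f n = 0) -> \sum_(n < g * d) f n = \sum_(k < d) f (g * k)%N.
Proof.
move=> g0 f0; elim: d => [|d IH]; first by rewrite muln0 !big_ord0.
rewrite big_ord_recr/= -IH mulnSr big_split_ord/=; congr (_ + _).
case: g g0 f0 {IH} => // g _ f0; rewrite big_ord_recl/= addn0 big1 ?addr0// => i _.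
apply: f0; rewrite dvdn_addr ?dvdn_mulr//; apply/negP => /dvdn_leq.
by rewrite /bump/= => /(_ isT); have := ltn_ord i; lia.
Qed.

Lemma zdot_chi_ratio g d chi psi : `|N|%N = (g * d)%N ->
  dirichlet_character d chi -> dirichlet_character d psi ->
  zdot N (chi_ratio N d chi) (chi_ratio N d psi) =
  chi ep * conjc (psi ep) * \sum_(k < d) chi k%:Z * conjc (psi k%:Z).
Proof.
move=> h [_ cM _] [_ pM _].
have g0 : (0 < g)%N by move: N0; rewrite -absz_gt0 h muln_gt0 => /andP[].
rewrite /zdot h.
rewrite (@sum_multiples g d (fun n => chi_ratio N d chi n%:Z * conjc (chi_ratio N d psi n%:Z)) g0).
  rewrite mulr_sumr; apply: eq_bigr => k _.
  by rewrite PoszM !(chi_ratio_mul _ _ h) cM pM rmorphM/= mulrACA.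
by move=> n gn; rewrite (chi_ratio_eq0 chi h) ?mul0r.
Qed.

Lemma zdot_chi_ratio_eq0 (p q : nat * (int -> R[i])) :
  (p.1 %| `|N|)%N -> dirichlet_character p.1 p.2 ->
  (q.1 %| `|N|)%N -> dirichlet_character q.1 q.2 -> p != q ->
  zdot N (chi_ratio N p.1 p.2) (chi_ratio N q.1 q.2) = 0.
Proof.
case: p q => [d chi] [e psi] /= /dvdnP [g hg] Dc /dvdnP [g' hg'] Dp pq.
have d0 : (0 < d)%N by move: N0; rewrite -absz_gt0 hg muln_gt0 => /andP[].
have g0 : (0 < g)%N by move: N0; rewrite -absz_gt0 hg muln_gt0 => /andP[].
have [de|de] := eqVneq d e.
  subst e; have cp : chi != psi by apply: contraNneq pq => ->.
  by rewrite (zdot_chi_ratio hg Dc Dp) (dirichlet_orthogonal d0 Dc Dp cp) mulr0.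
rewrite /zdot big1// => n _; apply/eqP; apply: contraNT de.
rewrite mulf_eq0 negb_or conjc_eq0 => /andP[cn pn].
have := chi_ratio_neq0 hg Dc cn; rewrite (chi_ratio_neq0 hg' Dp pn) => gg.
by apply/eqP; move: hg'; rewrite hg gg => /eqP; rewrite eqn_pmul2l// => /eqP.
Qed.

Lemma znorm_chi_ratio_gt0 d chi : (d %| `|N|)%N -> dirichlet_character d chi ->
  0 < znorm N (chi_ratio N d chi).
Proof.
move=> /dvdnP [g hg] Dc.
have d0 : (0 < d)%N by move: N0; rewrite -absz_gt0 hg muln_gt0 => /andP[].
have nn : 0 <= znorm N (chi_ratio N d chi) by apply: sumr_ge0 => n _; exact: sqmod_ge0.
rewrite lt_neqAle nn andbT eq_sym; apply/eqP => /(congr1 (fun x : R => x%:C)).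
rewrite -zdot_rc (zdot_chi_ratio hg Dc Dc) => /eqP.
have cep : coprimez ep d by rewrite /ep /coprimez /gcdz absz_sign gcd1n.
rewrite mulJ_sqmod (dirichlet_sqmod d0 Dc cep) mul1r.
under eq_bigr do rewrite mulJ_sqmod.
move=> /eqP /(congr1 (@complex.Re R)); rewrite cRe_sum /= => /eqP.
rewrite psumr_eq0; last by move=> k _; exact: sqmod_ge0.
(* The residue of 1 modulo [d], which is 0 when d = 1. *)
move=> /allP /(_ (Ordinal (ltn_pmod 1 d0)) (mem_index_enum _)) /=.
rewrite sqmod_eq0 -modz_nat (dirichlet_modz _ Dc) (dirichlet1 Dc).
by rewrite oner_eq0.
Qed.

Definition chi_index : set (nat * (int -> R[i])) :=
  [set p | (p.1 %| `|N|)%N /\ dirichlet_character p.1 p.2].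

Let d_gt0 d : (d %| `|N|)%N -> (0 < d)%N.
Proof. by apply: dvdn_gt0; rewrite absz_gt0. Qed.

Let chars : exists chr : forall d, 'I_d -> int -> R[i], forall d, (0 < d)%N ->
  (forall r, dirichlet_character d (chr d r)) /\
  forall j, (j < d)%N -> coprime j d -> exists k : 'I_d -> R[i],
    forall n : int, \sum_r k r * chr d r n = (n == j%:Z %[mod d%:Z])%Z%:R.
Proof.
have h d : exists chr : 'I_d -> int -> R[i], (0 < d)%N ->
  (forall r, dirichlet_character d (chr r)) /\
  forall j, (j < d)%N -> coprime j d -> exists k : 'I_d -> R[i],
    forall n : int, \sum_r k r * chr r n = (n == j%:Z %[mod d%:Z])%Z%:R.
  case: d => [|d']; first by exists (fun _ _ => 0).
  by have [chr h] := @characters_exist R d'; exists chr.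
exists (fun d => sval (cid (h d))) => d; exact: (svalP (cid (h d))).
Qed.

(** Every character modulo d is some [chr d r]: otherwise it is orthogonal to all of them, hence to
    the point mass at 1 in their span, although chi(1) = 1. *)
Lemma finite_chi_index : finite_set chi_index.
Proof.
have [chr chrP] := chars.
pose J := {d : 'I_(`|N|).+1 & 'I_d}.
pose f (j : J) : nat * (int -> R[i]) := (val (tag j), chr (tag j) (tagged j)).
apply: (@sub_finite_set _ _ [set f j | j in setT]); last first.
  by apply: finite_image; exact: finite_finset.
move=> [d chi] [/= dN Dc].
have d0 := d_gt0 dN.
have dN1 : (d < `|N|.+1)%N by rewrite ltnS dvdn_leq// absz_gt0.
have [cD cS] := chrP d d0.
suff [r chiE] : exists r, chi = chr d r.
  by exists (Tagged (fun d : 'I_(`|N|).+1 => 'I_d) (i := Ordinal dN1) r); rewrite // /f /= chiE.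
apply: contrapT => nex.
have [k kE] := cS (1 %% d)%N (ltn_pmod 1 d0) (etrans (coprime_modl 1 d) (coprime1n d)).
have o r : \sum_(m < d) chi m%:Z * conjc (chr d r m%:Z) = 0.
  apply: dirichlet_orthogonal => //; apply/eqP => e; apply: nex; by exists r.
have : \sum_(m < d) chi m%:Z * conjc (\sum_r k r * chr d r m%:Z) = 0.
  under eq_bigr do rewrite rmorph_sum mulr_sumr.
  rewrite exchange_big big1// => r _.
  under eq_bigr do rewrite rmorphM mulrCA.
  by rewrite -mulr_sumr o mulr0.
rewrite (bigD1 (Ordinal (ltn_pmod 1 d0)))//= kE eqxx big1 => [|m m1].
  rewrite -modz_nat (dirichlet_modz _ Dc) (dirichlet1 Dc) mul1r addr0 rmorph1 => /eqP.
  by rewrite oner_eq0.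
rewrite kE (_ : (_ == _ %[mod _])%Z = false) ?rmorph0 ?mulr0//.
apply: contraNF m1 => /eqP; rewrite !modz_nat modn_mod modn_small ?ltn_ord// => -[h].
by apply/eqP/val_inj.
Qed.

Definition chi_seq : seq (nat * (int -> R[i])) := finmap.enum_fset (fset_set chi_index).

Lemma mem_chi_seq p : (p \in chi_seq) = (p \in chi_index).
Proof. exact: in_fset_set finite_chi_index _. Qed.

(* With g = gcd(n, N) and d = |N|/g, the point mass at n is a combination of the
   chi(. d/N) for chi modulo d alone. *)
Lemma delta_chi_ratio : exists C : nat -> nat * (int -> R[i]) -> R[i],
  forall n m : 'I_`|N|, \sum_(p <- chi_seq) C n p * chi_ratio N p.1 p.2 m%:Z = (m == n)%:R.
Proof.
have [chr chrP] := chars.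
pose span (f : nat -> R[i]) := exists C : nat * (int -> R[i]) -> R[i],
  forall m, (m < `|N|)%N -> f m = \sum_(p <- chi_seq) C p * chi_ratio N p.1 p.2 m%:Z.
have spanX p : p \in chi_seq -> span (fun m => chi_ratio N p.1 p.2 m%:Z).
  move=> ps; exists (fun q => (q == p)%:R) => m _.
  have us : uniq chi_seq by exact: finmap.fset_uniq.
  rewrite (bigD1_seq p ps us) /= eqxx mul1r big1 ?addr0// => q /negbTE ->.
  by rewrite mul0r.
have spanS (I : finType) (k : I -> R[i]) (F : I -> nat -> R[i]) : (forall i, span (F i)) ->
    span (fun m => \sum_i k i * F i m).
  move=> /choice[C CE]; exists (fun p => \sum_i k i * C i p) => m mN.
  transitivity (\sum_i \sum_(p <- chi_seq) k i * (C i p * chi_ratio N p.1 p.2 m%:Z)).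
    by apply: eq_bigr => i _; rewrite CE// mulr_sumr.
  rewrite exchange_big; apply: eq_bigr => p _; rewrite mulr_suml.
  by apply: eq_bigr => i _; rewrite mulrA.
suff /choice[C CE] (n : nat) : exists C : nat * (int -> R[i]) -> R[i], (n < `|N|)%N ->
    forall m, (m < `|N|)%N -> \sum_(p <- chi_seq) C p * chi_ratio N p.1 p.2 m%:Z = (m == n)%:R.
  by exists C => n m; rewrite CE.
have [nN|] := ltnP n `|N|; last by exists (fun=> 0).
pose g := gcdn n `|N|.
have g0 : (0 < g)%N by rewrite gcdn_gt0 absz_gt0 N0 orbT.
have /dvdnP [d hd] : (g %| `|N|)%N by exact: dvdn_gcdr.
have hN : `|N|%N = (g * d)%N by rewrite mulnC.
have /dvdnP [n' hn] : (g %| n)%N by exact: dvdn_gcdl.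
have dN : (d %| `|N|)%N by rewrite hN dvdn_mull.
have d0 := d_gt0 dN.
have cn' : coprime n' d.
  by rewrite /coprime -(eqn_pmul2l g0) muln_gcdr muln1 -hN mulnC -hn.
have n'd : (n' < d)%N by rewrite -(ltn_pmul2l g0) -hN mulnC -hn.
have [cD cS] := chrP d d0.
(* At m = g m' the function chi(md/N) is chi(ep m'), so the point mass at n = g n' corresponds to
   the residue ep n' modulo d. *)
pose j := `|((ep * n'%:Z) %% d)%Z|%N.
have dz : d%:Z != 0 by rewrite -lt0n in d0 *; lia.
have jE : j%:Z = ((ep * n'%:Z) %% d)%Z by rewrite gez0_abs// modz_ge0.
have jd : (j < d)%N by rewrite -ltz_nat jE ltz_pmod.
have cep : coprimez ep d by rewrite /ep /coprimez /gcdz absz_sign gcd1n.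
have cj : coprime j d.
  by rewrite -[coprime j d]/(coprimez j d) jE /coprimez gcdz_modl -/(coprimez _ _) coprimezMl cep.
have [k kE] := cS j jd cj.
have [C CE] : span (fun m => \sum_r k r * chi_ratio N d (chr d r) m%:Z).
  apply: spanS => r; apply: (spanX (d, chr d r)); rewrite mem_chi_seq inE; split=> //=.
exists C => _ m mN; rewrite -CE//.
have [/dvdnP [m' mE]|gm] := boolP (g %| m)%N; last first.
  rewrite big1 => [|r _]; last by rewrite (chi_ratio_eq0 _ hN)// mulr0.
  by rewrite (_ : (m == n) = false)//; apply: contraNF gm => /eqP ->; rewrite hn dvdn_mull.
rewrite [in LHS]mE mulnC.
under eq_bigr => r _ do rewrite PoszM (chi_ratio_mul _ _ hN).
rewrite kE jE; congr (_%:R).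
rewrite mE hn eqn_pmul2r//.
rewrite -[(_ == _ %[mod _])%Z]/((_ %% _)%Z == (_ %% _)%Z) modz_mod.
have m'd : (m' < d)%N by rewrite -(ltn_pmul2l g0) -hN mulnC -mE.
rewrite -/(_ == _ %[mod _])%Z eqz_mod_dvd -mulrBr Gauss_dvdzr 1?coprimez_sym//.
by rewrite (@ord_dvd_eq R d%:Z dz (Ordinal m'd) (Ordinal n'd)).
Qed.

End ChiRatio.

(** * The Weil-Brezin map *)

Section BilateralSums.
Context {R : realType}.
Implicit Types (f g : int -> R[i]) (s t z : R[i]) (K : R) (l : int).

(** h + K/(n+1) decreases and h - K/(n+1) increases; both have the limit of h, whence the rate. *)
Lemma telescoping_cvg (h : nat -> R) K :
  (forall n, `|h n.+1 - h n| <= K * (n.+1%:R^-1 - n.+2%:R^-1)) ->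
  cvgn h /\ forall n, `|limn h - h n| <= K * n.+1%:R^-1.
Proof.
move=> hK.
pose a n := h n + K * n.+1%:R^-1; pose b n := h n - K * n.+1%:R^-1.
have an : nonincreasing_seq a.
  apply/nonincreasing_seqP => n; rewrite /a; have := hK n; rewrite mulrBr ler_norml => /andP[].
  move: (K * n.+1%:R^-1) (K * n.+2%:R^-1) => x y; lra.
have bn : nondecreasing_seq b.
  apply/nondecreasing_seqP => n; rewrite /b; have := hK n; rewrite mulrBr ler_norml => /andP[].
  move: (K * n.+1%:R^-1) (K * n.+2%:R^-1) => x y; lra.
have K0 : 0 <= K.
  have := le_trans (normr_ge0 _) (hK 0); rewrite pmulr_lge0// subr_gt0 ltf_pV2 ?posrE//.
  by rewrite ltr_nat.
have ba n : b n <= a n.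
  rewrite /a /b; have : 0 <= K * n.+1%:R^-1 by rewrite mulr_ge0// invr_ge0.
  by move: (K * n.+1%:R^-1) => x; lra.
have ha : (fun n => K * n.+1%:R^-1) @ \oo --> (0 : R).
  by rewrite -(mulr0 K); apply: cvgM; [exact: cvg_cst|exact: cvg_harmonic].
have cb : cvgn b.
  apply: nondecreasing_is_cvgn => //; exists (a 0%N) => _ [n _ <-].
  by apply: (le_trans (ba n)); apply: an.
have hb : h = b \+ (fun n => K * n.+1%:R^-1) by apply/funext => n; rewrite /b /= subrK.
have ch : h @ \oo --> limn b by rewrite hb -[X in _ --> X]addr0; exact: cvgD cb ha.
have ab : a = h \+ (fun n => K * n.+1%:R^-1) by [].
have ca : a @ \oo --> limn b by rewrite ab -[X in _ --> X]addr0; exact: cvgD ch ha.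
split; first by apply/cvg_ex; exists (limn b).
move=> n; rewrite (cvg_lim _ ch)//.
have h1 : b n <= limn b by exact: nondecreasing_cvgn_le.
have h2 : limn b <= a n.
  by rewrite -(cvg_lim (@Rhausdorff R) ca); apply: nonincreasing_cvgn_ge => //; apply/cvg_ex; exists (limn b).
by rewrite ler_norml; move: h1 h2; rewrite /a /b; move: (K * n.+1%:R^-1) => x h1 h2; apply/andP; split; lra.
Qed.

Lemma symm_psum0 f : symm_psum f 0 = f 0.
Proof. by rewrite /symm_psum muln0 big_ord1 subrr. Qed.

Lemma symm_psumS f M : symm_psum f M.+1 = symm_psum f M + (f M.+1%:Z + f (- M.+1%:Z)).
Proof.
rewrite /symm_psum (_ : (2 * M.+1).+1 = (2 * M).+3)%N; last by rewrite mulnS.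
rewrite big_ord_recl big_ord_recr /= addrCA.
congr (_ + _).
  by apply: eq_bigr => i _; congr f; rewrite /bump/=; lia.
by rewrite addrC; congr (_ + _); congr f; rewrite /bump/=; lia.
Qed.

Lemma symm_psumZD k f g M : symm_psum (fun l => k * f l + g l) M =
  k * symm_psum f M + symm_psum g M.
Proof. by rewrite /symm_psum mulr_sumr -big_split. Qed.

Lemma symm_psum_shift f M : symm_psum (fun l => f (l + 1)) M =
  symm_psum f M + (f (M%:Z + 1) - f (- M%:Z)).
Proof.
elim: M => [|M IH]; first by rewrite !symm_psum0 add0r oppr0 addrCA subrr addr0.
rewrite !symm_psumS {}IH.
have -> : - M.+1%:Z + 1 = - M%:Z :> int by lia.
have -> : M%:Z + 1 = M.+1%:Z :> int by lia.
ring.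
Qed.

(** [sumZ] has a value even when the partial sums diverge; this predicate records actual
    convergence, under which linearity holds. *)
Definition zlim f s : Prop :=
  (fun M => complex.Re (symm_psum f M)) @ \oo --> complex.Re s /\
  (fun M => complex.Im (symm_psum f M)) @ \oo --> complex.Im s.

Lemma zlim_sumZ f s : zlim f s -> sumZ f = s.
Proof.
move=> [h1 h2]; apply: complexE2; rewrite /sumZ /=.
  exact: (cvg_lim (@Rhausdorff R) h1).
exact: (cvg_lim (@Rhausdorff R) h2).
Qed.

Lemma zlimZD k f g s t : zlim f s -> zlim g t -> zlim (fun l => k * f l + g l) (k * s + t).
Proof.
move=> [f1 f2] [g1 g2]; split.
  under eq_fun do rewrite symm_psumZD cReD cReM.
  rewrite cReD cReM; apply: cvgD => //; apply: cvgB; apply: cvgM => //; exact: cvg_cst.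
under eq_fun do rewrite symm_psumZD cImD cImM.
rewrite cImD cImM; apply: cvgD => //; apply: cvgD; apply: cvgM => //; exact: cvg_cst.
Qed.

Lemma zlim0 : zlim (fun=> 0) 0.
Proof. by split; under eq_fun do rewrite /symm_psum big1//; exact: cvg_cst. Qed.

Lemma zlimZ k f s : zlim f s -> zlim (fun l => k * f l) (k * s).
Proof.
move=> /(zlimZD k)/(_ zlim0); rewrite addr0.
by rewrite (_ : (fun l => _) = (fun l => k * f l))//; apply/funext => l; rewrite addr0.
Qed.

Lemma zlim_sum (I : Type) (r : seq I) (F : I -> int -> R[i]) (S : I -> R[i]) :
  (forall i, zlim (F i) (S i)) -> zlim (fun l => \sum_(i <- r) F i l) (\sum_(i <- r) S i).
Proof.
move=> FS; elim: r => [|i r IH].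
  by rewrite big_nil; under eq_fun do rewrite big_nil; exact: zlim0.
rewrite big_cons; under eq_fun do rewrite big_cons.
rewrite -[S i]mul1r (_ : (fun l => _) = (fun l => 1 * F i l + \sum_(j <- r) F j l)).
  exact: zlimZD.
by apply/funext => l; rewrite mul1r.
Qed.

(* Quadratic decay, stated on squared moduli so that it is multiplicative. *)
Definition zdec K f : Prop := 0 <= K /\ forall l, sqmod (f l) * (1 + l%:~R ^+ 2) ^+ 2 <= K ^+ 2.

Lemma zdec_abs K f l : zdec K f ->
  `|complex.Re (f l)| * (1 + l%:~R ^+ 2) <= K /\ `|complex.Im (f l)| * (1 + l%:~R ^+ 2) <= K.
Proof.
move=> [K0 hK]; have p : 0 <= 1 + l%:~R ^+ 2 :> R by rewrite addr_ge0// sqr_ge0.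
suff h (x : R) : x ^+ 2 <= sqmod (f l) -> `|x| * (1 + l%:~R ^+ 2) <= K.
  by split; apply: h; rewrite /sqmod ?lerDl ?lerDr sqr_ge0.
move=> hx; rewrite -(@ler_pXn2r _ 2)// ?nnegrE//; last by rewrite mulr_ge0.
rewrite exprMn real_normK ?num_real//; apply: le_trans (hK l).
by rewrite ler_wpM2r// sqr_ge0.
Qed.

(** With x = M + 1, the inequality x (x + 1) <= 2 (1 + x^2) compares quadratic decay with a
    telescoping difference; each of the two terms contributes 2 K. *)
Let step (h : int -> R) K : (forall l, `|h l| * (1 + l%:~R ^+ 2) <= K) -> forall M : nat,
  `|h M.+1%:Z + h (- M.+1%:Z)| <= (4 * K) * (M.+1%:R^-1 - M.+2%:R^-1).
Proof.
move=> hK M.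
have m0 : 0 < M.+1%:R :> R by []. have m1 : M.+2%:R = M.+1%:R + 1 :> R by rewrite -natr1.
have -> : M.+1%:R^-1 - M.+2%:R^-1 = (M.+1%:R * M.+2%:R)^-1 :> R.
  rewrite m1; move: (M.+1%:R : R) m0 => x x0; field.
  by apply/andP; split; rewrite gt_eqF// addr_gt0.
rewrite ler_pdivlMr; last by rewrite mulr_gt0.
have h1 := hK M.+1%:Z; have h2 := hK (- M.+1%:Z).
rewrite mulrNz sqrrN -pmulrn in h2; rewrite -pmulrn in h1.
apply: (le_trans (ler_wpM2r _ (ler_normD _ _))); first by rewrite mulr_ge0.
rewrite m1; move: h1 h2 m0; set x := M.+1%:R; set p := `|h _|; set q := `|h _| => h1 h2 m0.
have p0 : 0 <= p by exact: normr_ge0. have q0 : 0 <= q by exact: normr_ge0.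
have : (p + q) * (x * (x + 1)) <= (p + q) * (2 * (1 + x ^+ 2)).
  apply: ler_wpM2l; first exact: addr_ge0.
  have := sqr_ge0 (x - 1); nra.
lra.
Qed.

Lemma zdec_sumZ K f : zdec K f -> zlim f (sumZ f) /\
  forall M, `|complex.Re (sumZ f - symm_psum f M)| <= 4 * K * M.+1%:R^-1 /\
            `|complex.Im (sumZ f - symm_psum f M)| <= 4 * K * M.+1%:R^-1.
Proof.
move=> fK.
have s1 := step (fun l => (zdec_abs l fK).1); have s2 := step (fun l => (zdec_abs l fK).2).
have t1 M : `|complex.Re (symm_psum f M.+1) - complex.Re (symm_psum f M)| <=
    4 * K * (M.+1%:R^-1 - M.+2%:R^-1).
  by rewrite symm_psumS cReD addrC addKr cReD.
have t2 M : `|complex.Im (symm_psum f M.+1) - complex.Im (symm_psum f M)| <=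
    4 * K * (M.+1%:R^-1 - M.+2%:R^-1).
  by rewrite symm_psumS cImD addrC addKr cImD.
have [c1 b1] := telescoping_cvg t1; have [c2 b2] := telescoping_cvg t2.
split; first by split; rewrite /sumZ.
by move=> M; rewrite /sumZ cReD cReN cImD cImN; split; [exact: b1|exact: b2].
Qed.

(** Peetre's inequality, by which quadratic decay survives translation. *)
Lemma sqr_shift_le (x y : R) : 1 + x ^+ 2 <= (2 + 2 * y ^+ 2) * (1 + (x + y) ^+ 2).
Proof. by have := sqr_ge0 (x + y + y); have := mulr_ge0 (sqr_ge0 y) (sqr_ge0 (x + y)); nra. Qed.

Lemma zdec_shift K f (n : int) : zdec K f -> zdec ((2 + 2 * n%:~R ^+ 2) * K) (fun l => f (l + n)).
Proof.
move=> [K0 hK]; have n0 : 0 <= n%:~R ^+ 2 :> R by exact: sqr_ge0.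
split; first by rewrite mulr_ge0//; lra.
move=> l; rewrite exprMn.
have le : (1 + l%:~R ^+ 2) ^+ 2 <= (2 + 2 * n%:~R ^+ 2) ^+ 2 * (1 + (l + n)%:~R ^+ 2) ^+ 2 :> R.
  have q (x : R) : 0 <= 1 + x ^+ 2 by rewrite addr_ge0// sqr_ge0.
  rewrite -exprMn; apply: lerXn2r; rewrite ?nnegrE; [exact: q|apply: mulr_ge0; [lra|exact: q]|].
  by rewrite intrD; exact: sqr_shift_le.
apply: (le_trans (ler_wpM2l (sqmod_ge0 _) le)).
by rewrite mulrCA ler_wpM2l ?sqr_ge0.
Qed.

(** A shift by 1 only exchanges an end term of each symmetric partial sum, and the end terms tend to
    0. *)
Let zlim_shift1 K f s : zdec K f -> zlim f s -> zlim (fun l => f (l + 1)) s.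
Proof.
move=> fK [f1 f2].
have small (h : int -> R) : (forall l, `|h l| * (1 + l%:~R ^+ 2) <= K) ->
    (fun M : nat => h (M%:Z + 1) - h (- M%:Z)) @ \oo --> (0 : R).
  move=> hK; have hb (l : int) (m : nat) : `|l|%N = m -> `|h l| <= K * (4 * m.+1%:R^-1).
    move=> lm; have := hK l.
    have -> : l%:~R ^+ 2 = m%:R ^+ 2 :> R.
      by rewrite -lm pmulrn -[in RHS]real_normK ?num_real// -intr_norm abszE normr_id intr_norm real_normK ?num_real.
    rewrite mulrCA mulrA ler_pdivlMr// => le.
    have : m.+1%:R <= 4 * (1 + m%:R ^+ 2) :> R.
      by rewrite -natr1; have := sqr_ge0 (m%:R - 1 : R); nra.
    move=> /(ler_wpM2l (normr_ge0 (h l))); lra.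
  have k0 : (fun M => 8 * K * M.+1%:R^-1) @ \oo --> (0 : R).
    by rewrite -(mulr0 (8 * K)); apply: cvgM; [exact: cvg_cst|exact: cvg_harmonic].
  have kn : (fun M => - (8 * K * M.+1%:R^-1)) @ \oo --> (0 : R).
    by rewrite -[X in _ --> X]oppr0; exact: cvgN.
  apply: (squeeze_cvgr _ kn k0).
  apply: nearW => M; have h1 := hb (M%:Z + 1) M.+1 (ltac:(lia)).
    have h2 := hb (- M%:Z) M (ltac:(lia)).
    have K0 : 0 <= K by have := hK 0; have := normr_ge0 (h 0); nra.
    have le : K * (4 * M.+2%:R^-1) <= K * (4 * M.+1%:R^-1).
      apply: ler_wpM2l => //; apply: ler_wpM2l => //.
      by rewrite lef_pV2 ?posrE// ler_nat.
    rewrite -ler_norml; apply: (le_trans (ler_normB _ _)).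
    by move: h1 h2 le; move: (M.+1%:R^-1 : R) (M.+2%:R^-1 : R) => x y; lra.
split.
  under eq_fun do rewrite symm_psum_shift cReD cReD cReN.
  by rewrite -[complex.Re s]addr0; apply: cvgD => //; exact: (small _ (fun l => (zdec_abs l fK).1)).
under eq_fun do rewrite symm_psum_shift cImD cImD cImN.
by rewrite -[complex.Im s]addr0; apply: cvgD => //; exact: (small _ (fun l => (zdec_abs l fK).2)).
Qed.

Lemma sumZ_shift K f (n : int) : zdec K f -> sumZ (fun l => f (l + n)) = sumZ f.
Proof.
have S1 K' g : zdec K' g -> sumZ (fun l => g (l + 1)) = sumZ g.
  by move=> gK; apply: zlim_sumZ; apply: (zlim_shift1 gK); exact: (zdec_sumZ gK).1.
have Sn K' g (k : nat) : zdec K' g -> sumZ (fun l => g (l + k%:Z)) = sumZ g.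
  move=> gK; elim: k => [|k IH]; first by congr sumZ; apply/funext => l; rewrite addr0.
  rewrite -IH -(S1 _ _ (zdec_shift k gK)); congr sumZ; apply/funext => l; congr g; lia.
move=> fK; case: n => k; first exact: Sn fK.
rewrite -(Sn _ _ k.+1 (zdec_shift (Negz k) fK)); congr sumZ; apply/funext => l; congr f.
by rewrite NegzE addrK.
Qed.

End BilateralSums.

Section SquareShift.
Context {R : realType}.
Notation T := (measurableTypeR R).

(** Unlike [integral_sq_shift], this applies to the single terms of a theta series, which are
    periodic in the first variable only. *)
Lemma integral_sq_shift1 (f : T * T -> \bar R) (s : R) : measurable_fun setT f ->
  (forall x y, f ((x + 1)%R, y) = f (x, y)) ->
  (\int[leb2]_(z in sq) f ((z.1 + s)%R, z.2) = \int[leb2]_(z in sq) f z)%E.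
Proof.
move=> mf fp1; rewrite integralE [RHS]integralE; congr (_ - _)%E.
  have g1 x y : (f^\+ ((x + 1)%R, y) = f^\+ (x, y))%E by rewrite !funeposE fp1.
  rewrite -(@ge0_integral_sq_shift1 R _ (measurable_funepos mf) (fun x => funepos_ge0 f x) g1 s).
  by apply: eq_integral => z _; rewrite !funeposE.
have g1 x y : (f^\- ((x + 1)%R, y) = f^\- (x, y))%E by rewrite !funenegE fp1.
rewrite -(@ge0_integral_sq_shift1 R _ (measurable_funeneg mf) (fun x => funeneg_ge0 f x) g1 s).
by apply: eq_integral => z _; rewrite !funenegE.
Qed.

Lemma cint_sq_shift1 (F : T * T -> R[i]) (s : R) : cmeas F ->
  (forall x y, F (x + 1, y) = F (x, y)) ->
  cint leb2 sq (fun z => F (z.1 + s, z.2)) = cint leb2 sq F.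
Proof.
move=> [mr mi] F1; apply: complexE2; rewrite /= /Rintegral; congr fine.
  apply: (integral_sq_shift1 (f := fun z => (complex.Re (F z))%:E)).
    exact: (measurable_EFinP _ _).2 mr.
  by move=> x y; rewrite F1.
apply: (integral_sq_shift1 (f := fun z => (complex.Im (F z))%:E)).
  exact: (measurable_EFinP _ _).2 mi.
by move=> x y; rewrite F1.
Qed.

Lemma nrm2_sum_orthogonal d (S : measurableType d) (mu : {measure set S -> \bar R}) (D : set S)
    (F : nat -> S -> R[i]) (n : nat) : measurable D ->
  (forall i, sq_integrable mu D (F i)) ->
  (forall i j, i != j -> L2inner mu D (F i) (F j) = 0) ->
  nrm2 mu D (fun x => \sum_(i < n) F i x) = \sum_(i < n) nrm2 mu D (F i).
Proof.
move=> mD jF oF; elim: n => [|n IH].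
  rewrite big_ord0 -[RHS](_ : nrm2 mu D (fun=> 0) = 0).
    by apply: eq_nrm2 => x _; rewrite big_ord0.
  by rewrite /nrm2; under eq_integral do rewrite sqmod0; rewrite integral0.
have jS (m : nat) : sq_integrable mu D (fun x => \sum_(i < m) F i x) by exact: sqi_sum.
rewrite big_ord_recr /= -IH (@eq_nrm2 _ _ _ mu D _ (fun x => \sum_(i < n) F i x + F n x)); last first.
  by move=> x _; rewrite big_ord_recr.
rewrite nrm2D// (_ : L2inner _ _ _ _ = 0) ?mulr0 ?addr0//.
have h (m : nat) : (m <= n)%N -> L2inner mu D (fun x => \sum_(i < m) F i x) (F n) = 0.
  elim: m => [|m IHm] mn.
    rewrite L2innerE; transitivity (cint mu D (fun=> 0)); last exact: cint0.
    apply: eq_cint => x _.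
    by rewrite big_ord0 mul0r.
  rewrite (_ : (fun x => _) = (fun x : S => \sum_(i < m) F i x + F m x)); last first.
    by apply/funext => x; rewrite big_ord_recr.
  by rewrite L2innerDl// IHm ?(ltnW mn)// oF ?addr0// ltn_eqF.
exact: h.
Qed.

End SquareShift.

(** * Theta series of functions with quadratic decay *)

Section WeilBrezinTheta.
Context {R : realType}.
Notation T := (measurableTypeR R).
Notation nrm := (nrm2 leb2 sq).
Variable N : int.
Hypothesis N0 : N != 0.
Implicit Types (u v : R -> R[i]) (w : T * T) (l : int).

Let NR0 : N%:~R != 0 :> R. Proof. by rewrite intr_eq0. Qed.

(** What the theta series uses of a Schwartz function. *)
Definition decay (B : R) u : Prop :=
  [/\ cmeas (u : T -> R[i]), 0 <= B & forall x : R, sqmod (u x) * (1 + x ^+ 2) ^+ 2 <= B ^+ 2].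

Definition zk u w l : R[i] :=
  if (N %| l)%Z then u (l%:~R + N%:~R * w.2) * expi2pi (l%:~R * w.1 / N%:~R) else 0.

(* Summing over the multiples l of N instead of l = Nk lets [sumZ_shift] split a sum
   over Z into residue classes modulo N. *)
Definition WBtheta u w : R[i] := sumZ (zk u w).

Lemma zdec_zk B u w : decay B u -> zdec ((2 + 2 * (N%:~R * w.2) ^+ 2) * B) (zk u w).
Proof.
move=> [_ B0 hB]; split=> [|l]; first by rewrite mulr_ge0// addr_ge0// mulr_ge0// sqr_ge0.
rewrite exprMn /zk; case: ifP => _; last first.
  by rewrite sqmod0 mul0r mulr_ge0// sqr_ge0.
rewrite sqmodM sqmod_expi2pi mulr1.
set t := N%:~R * w.2.
have le : (1 + l%:~R ^+ 2) ^+ 2 <= (2 + 2 * t ^+ 2) ^+ 2 * (1 + (l%:~R + t) ^+ 2) ^+ 2.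
  have q (x : R) : 0 <= 1 + x ^+ 2 by rewrite addr_ge0// sqr_ge0.
  rewrite -exprMn; apply: lerXn2r; rewrite ?nnegrE; [exact: q| |exact: sqr_shift_le].
  by apply: mulr_ge0; [have := sqr_ge0 t; lra|exact: q].
apply: (le_trans (ler_wpM2l (sqmod_ge0 _) le)).
by rewrite mulrCA ler_wpM2l ?sqr_ge0.
Qed.

Lemma qper_WBtheta B u : decay B u -> qper 1 (WBtheta u).
Proof.
move=> dB; split=> b c; rewrite /WBtheta.
  congr sumZ; apply/funext => l; rewrite /zk /=; case: ifP => // /dvdzP [q ->].
  have e (x : R) : (q * N)%:~R * x / N%:~R = q%:~R * x by rewrite intrM; field.
  by rewrite !e mulrDr mulr1 expi2piDint.
have zd := zdec_zk (b, c) dB.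
(* Replacing l by l + N absorbs the step from c to c + 1 and leaves the phase e(-b). *)
rewrite -[in RHS](sumZ_shift N zd).
have zl := (zdec_sumZ (zdec_shift N zd)).1.
rewrite -(zlim_sumZ (zlimZ _ zl)); congr sumZ; apply/funext => l; rewrite /zk /=.
rewrite (rpredDr _ (dvdzz N)); case: ifP => _; last by rewrite mulr0.
rewrite mulrCA; congr (u _ * _); first by rewrite intrD; ring.
by rewrite -expi2piD; congr expi2pi; rewrite intrD -[1%:~R]/(1 : R); field.
Qed.

Lemma cmeas_zk B u l : decay B u -> cmeas (fun w => zk u w l).
Proof.
move=> [mu _ _]; rewrite /zk; have [_|_] := boolP (N %| l)%Z; last exact: cmeas_cst.
apply: cmeasM.
  apply: (cmeas_comp mu).
  exact: (measurable_funD (measurable_cst _) (measurable_funM (measurable_cst _) measurable_snd)).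
apply: cmeas_expi2pi.
exact: (measurable_funM (measurable_funM (measurable_cst _) measurable_fst) (measurable_cst _)).
Qed.

Lemma cmeas_psum B u M : decay B u -> cmeas (fun w => symm_psum (zk u w) M).
Proof. by move=> dB; apply: cmeas_sum => k; exact: (cmeas_zk _ dB). Qed.

Lemma cmeas_WBtheta B u : decay B u -> cmeas (WBtheta u).
Proof.
move=> dB; split.
  apply: (measurable_fun_cvg (h := fun M w => complex.Re (symm_psum (zk u w) M))).
    by move=> M; exact: (cmeas_psum M dB).1.
  by move=> w _; exact: (zdec_sumZ (zdec_zk w dB)).1.1.
apply: (measurable_fun_cvg (h := fun M w => complex.Im (symm_psum (zk u w) M))).
  by move=> M; exact: (cmeas_psum M dB).2.
by move=> w _; exact: (zdec_sumZ (zdec_zk w dB)).1.2.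
Qed.

(** The constant of [zdec_zk] made uniform on the square, where w.2 lies between 0 and 1. *)
Let bnd (B : R) : R := (2 + 2 * N%:~R ^+ 2) * B.

Let zdec_sq B u w : decay B u -> sq w -> zdec (bnd B) (zk u w).
Proof.
move=> dB [_]; rewrite /uI /= in_itv/= => /andP[w0 w1].
have [z0 zd] := zdec_zk w dB; have [_ B0 _] := dB.
have b0 : 0 <= bnd B by rewrite mulr_ge0// addr_ge0// mulr_ge0// sqr_ge0.
split=> // l; apply: (le_trans (zd l)); apply: lerXn2r; rewrite ?nnegrE//.
rewrite ler_wpM2r// lerD2l ler_pM2l// exprMn ler_piMr ?sqr_ge0//.
by rewrite exprn_ile1.
Qed.

(** The real and imaginary parts each contribute at most the square of 4 bnd / (M + 1), whence 32 =
    16 + 16; one factor 1 / (M + 1) is dropped. *)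
Lemma sqmod_WBtheta_psum B u w M : decay B u -> sq w ->
  sqmod (WBtheta u w - symm_psum (zk u w) M) <= 32 * bnd B ^+ 2 * M.+1%:R^-1.
Proof.
move=> dB sw; have [_ /(_ M) [h1 h2]] := zdec_sumZ (zdec_sq dB sw).
have i1 : M.+1%:R^-1 <= 1 :> R by rewrite invf_le1// ler1n.
have i0 : 0 <= M.+1%:R^-1 :> R by rewrite invr_ge0.
have sqb (x : R) : `|x| <= 4 * bnd B * M.+1%:R^-1 -> x ^+ 2 <= 16 * bnd B ^+ 2 * M.+1%:R^-1.
  move: (bnd B : R) => b hx; rewrite -real_normK ?num_real//.
  apply: (@le_trans _ _ ((4 * b * M.+1%:R^-1) ^+ 2)).
    by apply: lerXn2r; rewrite ?nnegrE// (le_trans _ hx).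
  rewrite !exprMn (_ : 4 ^+ 2 = 16 :> R); last by rewrite -natrX.
  apply: ler_wpM2l; first by rewrite mulr_ge0// sqr_ge0.
  by rewrite expr2 ler_piMr.
have := sqb _ h1; have := sqb _ h2; rewrite /sqmod /WBtheta.
move: (complex.Re _ ^+ 2) (complex.Im _ ^+ 2) (bnd B ^+ 2 : R) (M.+1%:R^-1 : R) => a b c e.
lra.
Qed.

Lemma integral_sqmod_le d (S : measurableType d) (mu : {measure set S -> \bar R}) (D : set S)
    (f : S -> R[i]) (K : R) : measurable D -> cmeas f ->
  (forall x, D x -> sqmod (f x) <= K) -> (\int[mu]_(x in D) (sqmod (f x))%:E <= K%:E * mu D)%E.
Proof.
move=> mD mf fK; rewrite -(integral_cst mu mD K%:E).
apply: ge0_le_integral => //.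
- by move=> x _; rewrite lee_fin sqmod_ge0.
- exact: measurable_funTS (cmeas_esqmod mf).
Qed.

Lemma sqi_bounded d (S : measurableType d) (mu : {measure set S -> \bar R}) (D : set S)
    (f : S -> R[i]) (K : R) : measurable D -> (mu D < +oo)%E -> cmeas f ->
  (forall x, D x -> sqmod (f x) <= K) -> sq_integrable mu D f.
Proof.
move=> mD Dfin mf fK; have [m1 m2] := mf; split=> //.
apply: (le_lt_trans (integral_sqmod_le mu mD mf fK)).
have [->|/set0P [x Dx]] := eqVneq D set0; first by rewrite measure0 mule0.
by apply: lte_mul_pinfty => //; rewrite lee_fin (le_trans (sqmod_ge0 _) (fK x Dx)).
Qed.

Let sqfin : (leb2 (sq : set (T * T)) < +oo)%E.
Proof. by rewrite leb2_sq ltry. Qed.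

Lemma nrm_bounded (f : T * T -> R[i]) (K : R) : cmeas f ->
  (forall w, sq w -> sqmod (f w) <= K) -> nrm f <= K.
Proof.
move=> mf fK; rewrite -lee_fin -nrm2E; last exact: (sqi_bounded measurable_sq sqfin mf fK).
have e := etrans (congr1 (fun x => K%:E * x)%E (@leb2_sq R)) (mule1 _).
by apply: (le_trans (integral_sqmod_le leb2 measurable_sq mf fK)); rewrite -[leRHS]e.
Qed.

Let sqi_psum B u M : decay B u -> sq_integrable leb2 sq (fun w => symm_psum (zk u w) M).
Proof.
move=> dB; apply: (sqi_sum measurable_sq) => k.
apply: (@sqi_bounded _ _ _ _ _ (bnd B ^+ 2) measurable_sq sqfin (cmeas_zk _ dB)) => w sw.
have [_ /(_ (k%:Z - M%:Z)) h] := zdec_sq dB sw; apply: le_trans h.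
rewrite ler_peMr ?sqmod_ge0//; apply: exprn_ege1.
by rewrite lerDl sqr_ge0.
Qed.

Lemma Zak_WBtheta B u : decay B u -> Qs 1 (WBtheta u).
Proof.
move=> dB; split; last exact: qper_WBtheta dB.
have j0 := sqi_psum 0 dB.
have j1 : sq_integrable leb2 sq (fun w => WBtheta u w - symm_psum (zk u w) 0).
  apply: (sqi_bounded measurable_sq sqfin).
    exact: (cmeasB (cmeas_WBtheta dB) (cmeas_psum 0 dB)).
  by move=> w sw; exact: (sqmod_WBtheta_psum 0 dB sw).
have := sqiD measurable_sq j1 j0.
by rewrite (_ : (fun w => _) = WBtheta u)//; apply/funext => w; rewrite subrK.
Qed.

Let zk_per1 u b c l : zk u (b + 1, c) l = zk u (b, c) l.
Proof.
rewrite /zk /=; case: ifP => // /dvdzP [q ->]; congr (_ * _).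
have e (x : R) : (q * N)%:~R * x / N%:~R = q%:~R * x by rewrite intrM; field.
by rewrite !e mulrDr mulr1 expi2piDint.
Qed.

Lemma sqi_zk B u l : decay B u -> sq_integrable leb2 sq (fun w => zk u w l).
Proof.
move=> dB; apply: (@sqi_bounded _ _ _ _ _ (bnd B ^+ 2) measurable_sq sqfin (cmeas_zk _ dB)) => w sw.
have [_ /(_ l) h] := zdec_sq dB sw; apply: le_trans h.
rewrite ler_peMr ?sqmod_ge0//; apply: exprn_ege1.
by rewrite lerDl sqr_ge0.
Qed.

(** Shifting the first variable by N / (2 (l - m)) preserves the integral and multiplies the
    integrand by e(1/2) = -1. *)
Lemma zk_orthogonal B u l m : decay B u -> l != m ->
  L2inner leb2 sq (fun w => zk u w l) (fun w => zk u w m) = 0.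
Proof.
move=> dB lm; rewrite L2innerE.
pose K w := zk u w l * conjc (zk u w m).
have mK : cmeas K by exact: (cmeasM (cmeas_zk l dB) (cmeasJ (cmeas_zk m dB))).
have iK : cinteg leb2 sq K by exact: (cinteg_mulJ measurable_sq (sqi_zk l dB) (sqi_zk m dB)).
have K1 x y : K (x + 1, y) = K (x, y) by rewrite /K !zk_per1.
have lm0 : (l - m)%:~R != 0 :> R by rewrite intr_eq0 subr_eq0.
have e1 : expi2pi ((1 : int)%:~R / 2%:Z%:~R) != 1 :> R[i] by apply: expi2pi_frac_neq1.
have := cint_sq_shift1 (N%:~R / (2 * (l - m)%:~R)) mK K1.
have -> : cint leb2 sq (fun z => K (z.1 + N%:~R / (2 * (l - m)%:~R), z.2)) =
    expi2pi ((1 : int)%:~R / 2%:Z%:~R) * cint leb2 sq K.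
  rewrite -(cintZ measurable_sq _ iK); apply: eq_cint => w _.
  rewrite /K /zk /=; case: ifP => _; last by rewrite !mul0r mulr0.
  case: ifP => _; last by rewrite conjc0 !mulr0.
  rewrite !cJM -!expi2piN mulrACA [in RHS]mulrACA [RHS]mulrCA; congr (_ * _).
  rewrite -!expi2piD; congr expi2pi.
  rewrite -[1%:~R]/(1 : R) -[2%:~R]/(2 : R); rewrite intrB in lm0 *.
  by field; rewrite NR0 lm0.
move/eqP; rewrite -subr_eq0 -{2}[cint _ _ _]mul1r -mulrBl mulf_eq0 subr_eq0.
by rewrite (negbTE e1) => /eqP.
Qed.

Let nrmzk u l := nrm (fun w => zk u w l).

Lemma nrm_psum B u M : decay B u ->
  nrm (fun w => symm_psum (zk u w) M) = \sum_(k < (2 * M).+1) nrmzk u (k%:Z - M%:Z).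
Proof.
move=> dB; apply: (nrm2_sum_orthogonal (F := fun k w => zk u w (k%:Z - M%:Z)) _ measurable_sq).
  by move=> k; exact: sqi_zk dB.
by move=> i j ij; apply: (zk_orthogonal dB); apply: contra ij => /eqP h; apply/eqP; lia.
Qed.

(** The indices N (k - K) lie between -M and M and are distinct; the other terms of the orthogonal
    sum have nonnegative norms. *)
Lemma sum_nrmzk_le_psum B u (K M : nat) : decay B u -> M = (`|N| * K)%N ->
  \sum_(k < 2 * K) nrmzk u (N * (k%:Z - K%:Z)) <= nrm (fun w => symm_psum (zk u w) M).
Proof.
move=> dB ME; rewrite (nrm_psum M dB).
have sM (k : 'I_(2 * K)) : (`|(N * (k%:Z - K%:Z) + M%:Z)%R| < (2 * M).+1)%N.
  by rewrite ME; have := ltn_ord k; case: N => n; nia.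
pose f (k : 'I_(2 * K)) : 'I_((2 * M).+1) := Ordinal (sM k).
have fE k : (f k)%:Z - M%:Z = N * (k%:Z - K%:Z).
  rewrite /= gez0_abs ?addrK// ME; have := ltn_ord k; case: N => n; nia.
have finj : injective f.
  move=> i j /(congr1 (fun k : 'I__ => (val k)%:Z - M%:Z)); rewrite !fE => /(mulfI N0) h.
  by move/addIr: h => -[h]; exact/val_inj.
rewrite [leRHS](bigID (fun i => i \in (f @: [set: 'I_(2 * K)])%SET)) /= -[leLHS]addr0; apply: lerD.
  rewrite big_imset; last by move=> i j _ _; exact: finj.
  rewrite le_eqVlt; apply/orP; left; apply/eqP; apply: eq_big => k; first by rewrite finset.in_setT.
  by move=> _; rewrite fE.
by apply: sumr_ge0 => k _; exact: nrm2_ge0.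
Qed.

(** By orthogonality the left side grows with [M], and the partial sums converge to the theta series
    uniformly on the square. *)
Lemma psum_le_WBtheta B u M : decay B u ->
  nrm (fun w => symm_psum (zk u w) M) <= nrm (WBtheta u).
Proof.
move=> dB; apply: (@ler_limit_young _ _ _ 0); first exact: nrm2_ge0.
move=> t t0 n; rewrite mul0r addr0.
have e0 : 0 < 4 * 2^-1 ^+ n :> R by rewrite mulr_gt0// exprn_gt0// invr_gt0.
pose C := 32 * bnd B ^+ 2.
have [M' MM' CM'] : exists2 M', (M <= M')%N & C * M'.+1%:R^-1 <= 4 * 2^-1 ^+ n.
  have : (fun M => C * M.+1%:R^-1) @ \oo --> (0 : R).
    by rewrite -(mulr0 C); apply: cvgM; [exact: cvg_cst|exact: cvg_harmonic].
  move/cvgrPdist_lt => /(_ _ e0) [k _ hk].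
  exists (maxn M k); first exact: leq_maxl.
  have := hk (maxn M k) (leq_maxr _ _); rewrite /= sub0r normrN => /ltW.
  by apply: le_trans; exact: ler_norm.
apply: (@le_trans _ _ (nrm (fun w => symm_psum (zk u w) M'))).
  elim: {CM'} M' MM' => [|M' IH]; first by rewrite leqn0 => /eqP ->.
  rewrite leq_eqVlt => /orP[/eqP -> //|]; rewrite ltnS => /IH h; apply: (le_trans h).
  rewrite !(nrm_psum _ dB).
  have := symm_psumS (fun l => (nrmzk u l)%:C) M'; rewrite /symm_psum => /(congr1 (@complex.Re R)).
  rewrite cReD !cRe_sum /= => ->; rewrite lerDl addr_ge0//; exact: nrm2_ge0.
have jd : sq_integrable leb2 sq (fun w => symm_psum (zk u w) M' - WBtheta u w).
  exact: (sqiB measurable_sq (sqi_psum _ dB) (Zak_WBtheta dB).1).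
have := nrm2_young measurable_sq t0 (Zak_WBtheta dB).1 jd.
rewrite (@eq_nrm2 _ _ _ leb2 sq _ (fun w => symm_psum (zk u w) M')); last first.
  by move=> w _; rewrite addrC subrK.
move/le_trans; apply; rewrite lerD2l; apply: ler_wpM2l; first by rewrite addr_ge0// invr_ge0 ltW.
rewrite nrm2_sym; apply: le_trans CM'; apply: nrm_bounded.
  exact: (cmeasB (cmeas_WBtheta dB) (cmeas_psum _ dB)).
by move=> w sw; exact: (sqmod_WBtheta_psum _ dB sw).
Qed.

Local Open Scope ereal_scope.

Lemma nrm_zk B u (k : int) : decay B u ->
  (nrmzk u (N * k))%:E = \int[leb]_(c in `[0%R, 1%R[) (sqmod (u (N%:~R * (c + k%:~R))%R))%:E.
Proof.
move=> dB; have [mu _ _] := dB.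
pose g (c : T) := (sqmod (u (N%:~R * (c + k%:~R))%R))%:E.
have mg : measurable_fun setT g.
  apply: cmeas_esqmod; apply: (cmeas_comp mu).
  exact: (measurable_funM (measurable_cst _) (measurable_funD (@measurable_id _ _ _) (measurable_cst _))).
have g0 c : 0 <= g c by rewrite lee_fin sqmod_ge0.
rewrite -(nrm2E (sqi_zk _ dB)).
transitivity (\int[leb2]_(w in sq) g w.2).
  apply: eq_integral => w _; rewrite /zk dvdz_mulr ?dvdzz// sqmodM sqmod_expi2pi mulr1.
  by rewrite /g intrM -mulrDr addrC.
have mg2 : measurable_fun setT (fun w : T * T => g w.2) by exact: (measurableT_comp mg measurable_snd).
rewrite (ge0_integral_setX2 leb leb measurable_uI measurable_uI mg2 (fun w => g0 _)).
transitivity (\int[leb]_(y in uI) g y).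
  apply: eq_integral => y _; apply: (etrans (integral_cst leb measurable_uI (g y))).
  exact: (etrans (congr1 (fun x => g y * x) (@leb_uI R)) (mule1 _)).
by rewrite /uI -integral_itv_bndo_bndc//; exact: measurable_funTS.
Qed.

Lemma integral_co_sum (h : T -> \bar R) (a : R) (n : nat) : measurable_fun setT h ->
  (forall x, 0 <= h x) ->
  \int[leb]_(z in `[a, (a + n%:R)%R[) h z = \sum_(k < n) \int[leb]_(z in `[0%R, 1%R[) h (z + (a + k%:R))%R.
Proof.
move=> mh h0; elim: n => [|n IH]; first by rewrite addr0 set_itvco0 integral_set0 big_ord0.
rewrite big_ord_recr /= -IH (@integral_co_split _ _ mh h0 a (a + n%:R)%R); last 2 first.
- by rewrite lerDl.
- by rewrite lerD2l ler_nat.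
congr (_ + _).
have := @ge0_integral_affine_itv R 1 (a + n%:R) 0 1 true true h ltr01 mh h0.
rewrite invr1 mul1e mulr0 add0r mul1r => e; rewrite -natr1 addrA [(a + n%:R + 1)%R]addrC -e.
by apply: eq_integral => z _; rewrite mul1r.
Qed.

(** After rescaling by [N], the integral over [k, k+1[ is the squared norm of the term of index N k.
    Finite sums of these stay below the norm of the theta series, and monotone convergence exhausts
    the line. *)
Lemma WBtheta_bessel B u : decay B u ->
  \int[leb]_x (sqmod (u x))%:E <= (`|N|%:R * nrm (WBtheta u))%:E.
Proof.
move=> dB; have [mu _ _] := dB.
pose h (c : T) := (sqmod (u (N%:~R * c)%R))%:E.
have mh : measurable_fun setT h.
  apply: cmeas_esqmod; apply: (cmeas_comp mu).
  exact: (measurable_funM (measurable_cst _) (@measurable_id _ _ _)).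
have h0 c : 0 <= h c by rewrite lee_fin sqmod_ge0.
have -> : \int[leb]_x (sqmod (u x))%:E = `|N|%:R%:E * \int[leb]_x h x.
  have := @ge0_integral_affine R (N%:~R) 0 (fun x => (sqmod (u x))%:E) NR0
    (cmeas_esqmod mu) (fun x => sqmod_ge0 _).
  under eq_integral do rewrite addr0.
  rewrite -/h => ->; rewrite muleA -EFinM.
  by rewrite pmulrn abszE intr_norm divff ?mul1e// normr_eq0.
rewrite EFinM; apply: lee_wpmul2l; first by rewrite lee_fin.
have hK (K : nat) : \int[leb]_(x in `[(- K%:R)%R, (K%:R : R)%R[) h x <= (nrm (WBtheta u))%:E.
  have e : (K%:R = - K%:R + (2 * K)%:R :> R)%R by rewrite mulSn mul1n natrD addKr.
  rewrite [X in `[_, X[%classic]e.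
  rewrite (integral_co_sum _ _ mh h0).
  apply: le_trans (_ : (\sum_(k < 2 * K) nrmzk u (N * (k%:Z - K%:Z)))%:E <= _).
    rewrite -sumEFin le_eqVlt; apply/orP; left; apply/eqP; apply: eq_bigr => k _.
    rewrite (nrm_zk _ dB); apply: eq_integral => c _.
    by rewrite /h; congr (sqmod (u (_ * (_ + _)%R)))%:E; rewrite intrB addrC.
  rewrite lee_fin; apply: (le_trans (sum_nrmzk_le_psum dB erefl)).
  exact: psum_le_WBtheta dB.
have nd : nondecreasing_seq (fun K : nat => `[(- K%:R)%R, K%:R[%classic : set T).
  move=> n m nm; rewrite subsetEset => x /=; rewrite !in_itv/= => /andP[x1 x2].
  have nm' : (n%:R <= m%:R :> R)%R by rewrite ler_nat.
  by rewrite (le_trans _ x1) ?lerN2//= (lt_le_trans x2).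
have := @ge0_nondecreasing_set_cvg_integral _ _ _ _ h leb nd (fun=> measurable_itv _)
  (fun=> measurable_funTS mh) (fun _ x _ => h0 x).
have -> : \bigcup_K `[(- K%:R)%R, K%:R[%classic = [set: T].
  rewrite -subTset => x _; exists (Num.truncn `|x|).+1 => //=.
  have := truncnS_gt `|x|%R; rewrite ltr_norml in_itv/= => /andP[/ltW -> ->] //.
move=> cv; rewrite -(cvg_lim _ cv)//; apply: lime_le; first exact: cvgP cv.
exact: nearW.
Qed.

End WeilBrezinTheta.

Section WeilBrezinMap.
Context {R : realType}.
Notation T := (measurableTypeR R).
Variable N : int.
Hypothesis N0 : N != 0.
Implicit Types (u v : R -> R[i]) (B : R).
Notation WBtheta := (WBtheta N).

Let NR0 : N%:~R != 0 :> R. Proof. by rewrite intr_eq0. Qed.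

Lemma WBtheta_lin (k : R[i]) B B' u v : decay B u -> decay B' v ->
  WBtheta (fun x => k * u x + v x) = fun w => k * WBtheta u w + WBtheta v w.
Proof.
move=> du dv; apply/funext => w; apply: zlim_sumZ.
have := zlimZD k (zdec_sumZ (zdec_zk N w du)).1 (zdec_sumZ (zdec_zk N w dv)).1.
rewrite (_ : (fun l => _) = zk N (fun x => k * u x + v x) w)//.
by apply/funext => l; rewrite /zk; case: ifP => _; ring.
Qed.

Lemma hact_WBtheta al ga B u : decay B u -> hact al ga 0 (WBtheta u) =
  WBtheta (fun x => expi2pi (x * al / N%:~R) * u (x + N%:~R * ga)).
Proof.
move=> du; apply/funext => -[b c]; rewrite /hact /=.
have zl := (zdec_sumZ (zdec_zk N (b + al, c + ga) du)).1.
rewrite -(zlim_sumZ (zlimZ _ zl)); congr sumZ; apply/funext => l; rewrite /zk /=.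
case: ifP => _; last by rewrite mulr0.
rewrite mulrCA -expi2piD [RHS]mulrAC -expi2piD mulrC; congr (expi2pi _ * u _); last by ring.
by field.
Qed.

Lemma chi_ratio_period d (chi : int -> R[i]) (n k : int) : dirichlet_character d chi ->
  chi_ratio N d chi (n + k * N) = chi_ratio N d chi n.
Proof.
move=> D; rewrite /chi_ratio.
have -> : (n + k * N) * d%:Z = (k * d%:Z) * N + n * d%:Z by ring.
rewrite (rpredDl _ (dvdz_mull _ (dvdzz N))); case: ifP => // _.
by rewrite divzMDl// -(dirichlet_modz _ D) modzMDl (dirichlet_modz _ D).
Qed.

(** [chi_ratio] depends only on the residue of the index modulo [N]. The terms of residue n form a
    theta series at the point (N a, c + n/N), reindexed by a shift by n, so each index l receives a
    nonzero summand from at most one n. *)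
Lemma WB_schwartzE d (chi : int -> R[i]) B u : dirichlet_character d chi -> decay B u ->
  WB_schwartz N d chi u =
  fun g => sqrtC (N%:~R / (totient d)%:R) * JX N (chi_ratio N d chi) (WBtheta u) g.
Proof.
move=> D du; apply/funext => -[[a c] z]; rewrite /WB_schwartz /JX /lift /= -mulrA.
congr (_ * (_ * _)); rewrite /ztheta.
set X := chi_ratio N d chi.
pose w (n : nat) : T * T := (N%:~R * a, c + n%:Z%:~R / N%:~R).
have zl (n : nat) : zlim (fun l => zk N u (w n) (l - n%:Z)) (WBtheta u (w n)).
  have zd := zdec_zk N (w n) du.
  by rewrite /WBtheta -(sumZ_shift (- n%:Z) zd); exact: (zdec_sumZ (zdec_shift (- n%:Z) zd)).1.
have zs := zlim_sum (index_enum 'I_`|N|)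
  (fun n : 'I_`|N| => zlimZ (X n%:Z * expi2pi (n%:Z%:~R * a)) (zl n)).
under [RHS]eq_bigr do rewrite /zterm mulrA.
rewrite -(zlim_sumZ zs); congr sumZ; apply/funext => l.
have Nz : (0 < `|N|)%N by rewrite absz_gt0.
have Nz' : `|N|%N%:Z != 0 by rewrite -lt0n in Nz *; lia.
have lN : (`|(l %% `|N|%N%:Z)%Z| < `|N|)%N.
  by rewrite -ltz_nat gez0_abs ?modz_ge0// ltz_pmod.
pose n0 := Ordinal lN.
have n0E : n0%:Z = (l %% `|N|%N%:Z)%Z by rewrite /= gez0_abs// modz_ge0.
have [k kE] : exists k, l = n0%:Z + k * N.
  exists ((l %/ `|N|%N%:Z)%Z * (-1) ^+ (N < 0)%R); rewrite n0E -mulrA -abszEsign.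
  by rewrite addrC -divz_eq.
have dv (n : 'I_`|N|) : (N %| l - n%:Z)%Z = (n == n0).
  rewrite kE addrAC (rpredDr _ (dvdz_mull _ (dvdzz N))) (@ord_dvd_eq R N N0).
  by rewrite eq_sym.
rewrite (bigD1 n0)// big1 => [|n nn]; last by rewrite /zk dv (negbTE nn) mulr0.
have XE : X l = X n0%:Z by rewrite /X [in LHS]kE chi_ratio_period.
rewrite [RHS]addr0 /zk dv eqxx XE; clearbody n0; rewrite /w /=.
rewrite -!mulrA; congr (_ * _); rewrite mulrCA -expi2piD; congr (u _ * expi2pi _).
  by rewrite intrB; field.
by rewrite intrB; field.
Qed.

End WeilBrezinMap.

(** * Schwartz functions of Gaussian type *)

Section SchwartzFunctions.
Context {R : realType}.
Notation T := (measurableTypeR R).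
Implicit Types (f g : R -> R) (u v : R -> R[i]).

Lemma derivable_measurable f : (forall x, derivable f x 1) -> measurable_fun (setT : set T) (f : T -> T).
Proof.
move=> df; apply: continuous_measurable_fun => x.
by apply/differentiable_continuous/derivable1_diffP.
Qed.

Lemma schwartz_decay u : schwartz u -> exists B, decay B u.
Proof.
move=> [[d1 b1] [d2 b2]].
have bd f : (forall k n : nat, exists B : R, forall x : R, `|x ^+ k * derive1n n f x| <= B) ->
    exists2 B, 0 <= B & forall x, `|f x| * (1 + x ^+ 2) <= B.
  move=> h; have [B0 h0] := h 0%N 0%N; have [B2 h2] := h 2%N 0%N.
  exists (B0 + B2); first by have := normr_ge0 (f 0); have := h0 0; rewrite expr0 mul1r /derive1n/=;
    have := h2 0; have := normr_ge0 (0 ^+ 2 * derive1n 0 f 0 : R); lra.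
  move=> x; have := h0 x; have := h2 x; rewrite /derive1n /= expr0 mul1r normrM normrX.
  by rewrite real_normK ?num_real//; lra.
have [B1 p1 h1] := bd _ b1; have [B2 p2 h2] := bd _ b2.
exists (B1 + B2); split.
- split; first exact: (derivable_measurable (d1 0%N)).
  exact: (derivable_measurable (d2 0%N)).
- exact: addr_ge0.
move=> x; have q : 0 <= 1 + x ^+ 2 by rewrite addr_ge0// sqr_ge0.
have sqb (a b : R) : 0 <= b -> `|a| * (1 + x ^+ 2) <= b -> a ^+ 2 * (1 + x ^+ 2) ^+ 2 <= b ^+ 2.
  move=> b0 h; rewrite -exprMn -real_normK ?num_real//; apply: lerXn2r; rewrite ?nnegrE//.
  by rewrite normrM (ger0_norm q).
have := sqb _ _ p1 (h1 x); have := sqb _ _ p2 (h2 x); rewrite /sqmod mulrDl.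
have := mulr_ge0 p1 p2; rewrite sqrrD; lra.
Qed.

(* A class of Schwartz functions that is stable under derivation and under the
   action of the Heisenberg group. *)
Inductive gaussian_class : (R -> R) -> Prop :=
| GaussianBase (w p s : R) : gaussian_class (fun x => cos (w * x + p) * expR (- (x + s) ^+ 2))
| GaussianMulX f : gaussian_class f -> gaussian_class (fun x => x * f x)
| GaussianLin (k : R) f g : gaussian_class f -> gaussian_class g ->
    gaussian_class (fun x => k * f x + g x).

Lemma gaussian_eq f g : gaussian_class f -> (forall x, g x = f x) -> gaussian_class g.
Proof. by move=> Gf gf; rewrite (funext gf). Qed.

Lemma gaussianZ (k : R) f : gaussian_class f -> gaussian_class (fun x => k * f x).
Proof. by move=> Gf; apply: (gaussian_eq (GaussianLin (k - 1) Gf Gf)) => x; ring. Qed.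

Lemma gaussian_translate (t : R) f : gaussian_class f -> gaussian_class (fun x => f (x + t)).
Proof.
elim=> [w p s|{}f Gf IH|k {}f g Gf IHf Gg IHg].
- apply: (gaussian_eq (GaussianBase w (w * t + p) (t + s))) => x.
  by rewrite mulrDr !addrA.
- by apply: (gaussian_eq (GaussianLin t IH (GaussianMulX IH))) => x; ring.
- exact: GaussianLin.
Qed.

(** cos A cos B = (cos (A + B) + cos (A - B)) / 2. The phase [p] of [GaussianBase] also supplies
    sines, as cosines shifted by pi / 2. *)
Lemma gaussian_modulate (a b : R) f : gaussian_class f ->
  gaussian_class (fun x => cos (a * x + b) * f x).
Proof.
elim=> [w p s|{}f Gf IH|k {}f g Gf IHf Gg IHg].
- apply: (gaussian_eq (gaussianZ 2^-1 (GaussianLin 1 (GaussianBase (w + a) (p + b) s)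
    (GaussianBase (w - a) (p - b) s)))) => x.
  have -> : (w + a) * x + (p + b) = (w * x + p) + (a * x + b) by ring.
  have -> : (w - a) * x + (p - b) = (w * x + p) - (a * x + b) by ring.
  by rewrite (cosD (w * x + p)) (cosB (w * x + p)); field.
- by apply: (gaussian_eq (GaussianMulX IH)) => x; ring.
- by apply: (gaussian_eq (GaussianLin k IHf IHg)) => x; ring.
Qed.

Lemma gaussian_derive f : gaussian_class f ->
  exists2 g, gaussian_class g & forall x : R, is_derive x (1 : R) f (g x).
Proof.
elim=> [w p s|{}f Gf [g Gg gP]|k {}f g Gf [f' Gf' fP] Gg [g' Gg' gP]].
- have G := GaussianBase w p s; have G' := GaussianBase w (p + pi / 2) s.
  exists (fun x => w * (cos (w * x + (p + pi / 2)) * expR (- (x + s) ^+ 2)) +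
      ((-2) * (x * (cos (w * x + p) * expR (- (x + s) ^+ 2))) +
       (-2 * s) * (cos (w * x + p) * expR (- (x + s) ^+ 2)))).
    exact: (GaussianLin w G' (GaussianLin (-2) (GaussianMulX G) (gaussianZ (-2 * s) G))).
  move=> x.
  have dl : is_derive x 1 (fun y : R => w * y + p) w.
    apply: (is_derive_eq (is_deriveD (is_deriveZ w (is_derive_id (x : R) (1 : R))) (is_derive_cst p x 1))).
    by rewrite addr0 /GRing.scale /= mulr1.
  have dq : is_derive x 1 (fun y : R => - (y + s) ^+ 2) (- (2 * (x + s))).
    apply: (is_derive_eq (is_deriveN (is_deriveX 2 (is_deriveD (is_derive_id (x : R) (1 : R)) (is_derive_cst s x 1))))).
    by rewrite -[LHS]/(- (2 * (x + s) ^+ 1 * (1 + 0))); ring.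
  have dc := @is_derive1_comp R cos (fun y => w * y + p) x _ _ (is_derive_cos _) dl.
  have de := @is_derive1_comp R expR (fun y => - (y + s) ^+ 2) x _ _ (is_derive_expR _) dq.
  apply: (is_derive_eq (is_deriveM dc de)).
  by rewrite [w * x + (_ + _)]addrA cosDpihalf /GRing.scale /=; ring.
- exists (fun x => f x + x * g x).
    by apply: (gaussian_eq (GaussianLin 1 Gf (GaussianMulX Gg))) => x; rewrite mul1r.
  move=> x; apply: (is_derive_eq (is_deriveM (is_derive_id (x : R) (1 : R)) (gP x))).
  by rewrite /GRing.scale /=; ring.
- exists (fun x => k * f' x + g' x); first exact: GaussianLin.
  move=> x; exact: (is_deriveD (is_deriveZ k (fP x)) (gP x)).
Qed.

Lemma gaussian_bounded f : gaussian_class f -> forall k, exists B, forall x, `|x ^+ k * f x| <= B.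
Proof.
elim=> [w p s|{}f Gf IH|c {}f g Gf IHf Gg IHg] k.
(* [C0] is such that |x| <= C0 (1 + y^2 / k1), and 1 + y^2 / k1 <= exp (y^2 / k1) gives |x|^k <=
   C0^k exp (y^2). Taking k + 1 instead of k for [k1] covers k = 0. *)
- pose k1 : R := k.+1%:R; pose C0 := 2 * (1 + `|s|) * k1.
  have k1p : 1 <= k1 by rewrite ler1n.
  exists (C0 ^+ k) => x.
  rewrite mulrA normrM (ger0_norm (expR_ge0 _)) expRN ler_pdivrMr ?expR_gt0//.
  rewrite normrM; apply: (@le_trans _ _ (`|x ^+ k|)).
    by rewrite ler_piMr// ler_norml cos_geN1 cos_le1.
  set y := x + s; pose e := 1 + y ^+ 2 / k1.
  have e1 : 1 <= e by rewrite lerDl divr_ge0 ?sqr_ge0//; lra.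
  have xe : `|x| <= C0 * e.
    have xy : `|x| <= `|y| + `|s|.
      by rewrite (_ : x = y - s) ?ler_normB//; rewrite /y addrK.
    have ke : k1 * e = k1 + y ^+ 2 by rewrite /e; field; rewrite gt_eqF//; lra.
    rewrite /C0 -mulrA ke; apply: (le_trans xy).
    have : y ^+ 2 = `|y| ^+ 2 by rewrite real_normK ?num_real.
    move=> ->; have := normr_ge0 y; have := normr_ge0 s; move: `|y| `|s| => a b b0 a0.
    have := mulr_ge0 b0 (sqr_ge0 (a - 1)); have := sqr_ge0 (a - 1); nra.
  have C00 : 0 <= C0 by rewrite !mulr_ge0.
  apply: (@le_trans _ _ ((C0 * e) ^+ k)).
    by rewrite normrX; apply: lerXn2r; rewrite ?nnegrE// mulr_ge0//; lra.
  rewrite exprMn ler_wpM2l ?exprn_ge0//.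
  have -> : y ^+ 2 = k.+1%:R * (y ^+ 2 / k1) by rewrite -/k1; field; rewrite gt_eqF//; lra.
  rewrite expRM_natl; apply: (@le_trans _ _ (e ^+ k.+1)).
    by rewrite exprS ler_peMl// exprn_ge0//; lra.
  by apply: lerXn2r; rewrite ?nnegrE ?expR_ge0 ?expR_ge1Dx//; lra.
- have [B hB] := IH k.+1; exists B => x.
  by have := hB x; rewrite exprSr mulrA.
- have [B hB] := IHf k; have [B' hB'] := IHg k; exists (`|c| * B + B') => x.
  rewrite (_ : _ * _ = c * (x ^+ k * f x) + x ^+ k * g x); last by ring.
  apply: (le_trans (ler_normD _ _)); rewrite normrM; apply: lerD => //.
  by rewrite ler_wpM2l.
Qed.

Lemma gaussian_schwartz f : gaussian_class f -> real_schwartz f.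
Proof.
move=> Gf; have Gn n : gaussian_class (derive1n n f).
  elim: n => [|n IH] //; rewrite derive1nS; have [g Gg gP] := gaussian_derive IH.
  by apply: (gaussian_eq Gg) => x; rewrite derive1E; case: (gP x).
split=> [n x|k n].
  by have [g _ gP] := gaussian_derive (Gn n); case: (gP x).
exact: gaussian_bounded.
Qed.

Definition cgaussian u : Prop :=
  gaussian_class (fun x => complex.Re (u x)) /\ gaussian_class (fun x => complex.Im (u x)).

Lemma cgaussian_schwartz u : cgaussian u -> schwartz u.
Proof. by move=> [h1 h2]; split; exact: gaussian_schwartz. Qed.

Lemma cgaussian_decay u : cgaussian u -> exists B, decay B u.
Proof. by move=> /cgaussian_schwartz/schwartz_decay. Qed.

Lemma cgaussian_lin (k : R[i]) u v : cgaussian u -> cgaussian v -> cgaussian (fun x => k * u x + v x).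
Proof.
move=> [ru iu] [rv iv]; split.
  apply: (gaussian_eq (GaussianLin (complex.Re k) ru (GaussianLin (- complex.Im k) iu rv))) => x.
  by rewrite cReD cReM; ring.
apply: (gaussian_eq (GaussianLin (complex.Re k) iu (GaussianLin (complex.Im k) ru iv))) => x.
by rewrite cImD cImM; ring.
Qed.

Lemma cgaussian_act (al t : R) u : cgaussian u ->
  cgaussian (fun x => expi2pi (x * al) * u (x + t)).
Proof.
move=> [/(gaussian_translate t) ru /(gaussian_translate t) iu].
have md b f := @gaussian_modulate (2 * pi * al) b f.
have a x : 2 * pi * (x * al) = 2 * pi * al * x + 0 by ring.
have s x : - sin (2 * pi * (x * al)) = cos (2 * pi * al * x + pi / 2).
  by rewrite cosDpihalf; congr (- sin _); ring.
split.
  apply: (gaussian_eq (GaussianLin 1 (md 0 _ ru) (md (pi / 2) _ iu))) => x.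
  by rewrite cReM /= -s a; ring.
apply: (gaussian_eq (GaussianLin 1 (md 0 _ iu) (gaussianZ (-1) (md (pi / 2) _ ru)))) => x.
by rewrite cImM /= -s a; ring.
Qed.

Lemma cgaussian_gauss : cgaussian (fun x => (expR (- x ^+ 2))%:C).
Proof.
have G := GaussianBase 0 0 0; split.
  by apply: (gaussian_eq G) => x; rewrite mul0r !addr0 cos0 mul1r.
by apply: (gaussian_eq (GaussianLin (-1) G G)) => x /=; ring.
Qed.

End SchwartzFunctions.

(** * The image of the Weil-Brezin map *)

Section WeilBrezinImage.
Context {R : realType}.
Notation T := (measurableTypeR R).
Notation nrm := (nrm2 leb2 sq).
Notation nrmc := (nrm2 haar cube).
Notation nrmR := (nrm2 (@leb R) setT).
Notation Zak := (Qs (R:=R) 1).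
Variable N : int.
Hypothesis N0 : N != 0.
Variables (d : nat) (chi : int -> R[i]).
Hypotheses (dN : (d %| `|N|)%N) (Dchi : dirichlet_character d chi).
Notation WBtheta := (WBtheta N).
Notation X := (chi_ratio N d chi).

Let NR0 : N%:~R != 0 :> R. Proof. by rewrite intr_eq0. Qed.

Let kappa : R[i] := sqrtC (N%:~R / (totient d)%:R).

Let kappa0 : kappa != 0.
Proof.
rewrite sqrtC_eq0 mulf_neq0// ?intr_eq0// invr_eq0 pnatr_eq0 -lt0n totient_gt0.
by apply: dvdn_gt0 dN; rewrite absz_gt0.
Qed.

Lemma VX_scale (k : R[i]) F : VX N X F -> VX N X (fun g => k * F g).
Proof.
move=> VF; have := VX_lin k VF (VX0 N X).
by rewrite (_ : (fun g => _) = fun g => k * F g)//; apply/funext => g; rewrite addr0.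
Qed.

Lemma Zak_scale (k : R[i]) th : Zak th -> Zak (fun z => k * th z).
Proof.
move=> Zth; have := Qs_lin k Zth (Qs0 1).
by rewrite (_ : (fun g => _) = fun g => k * th g)//; apply/funext => g; rewrite addr0.
Qed.

Lemma VX_WB_schwartz B u : decay B u -> VX N X (WB_schwartz N d chi u).
Proof.
move=> du; rewrite (WB_schwartzE N0 Dchi du); apply: VX_scale; apply: VX_JX => //.
exact: Zak_WBtheta du.
Qed.

Lemma HNd_VX : HNd N d chi `<=` VX N X.
Proof.
move=> F [f [_ LF [u [su _ cF]]]].
have [_ _ _ cl] := VX_closed N0 (znorm_chi_ratio_gt0 N0 dN Dchi).
apply: (cl _ _ _ LF cF) => k.
by have [B dB] := schwartz_decay (su k); exact: VX_WB_schwartz dB.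
Qed.

Lemma sqi_decay B u : decay B u -> sq_integrable leb setT (u : T -> R[i]).
Proof.
move=> du; have [[m1 m2] _ _] := du; split=> //.
by apply: le_lt_trans (WBtheta_bessel N0 du) _; exact: ltry.
Qed.

Lemma nrmR_le B u : decay B u -> nrmR u <= `|N|%:R * nrm (WBtheta u).
Proof.
move=> du; rewrite -lee_fin -(nrm2E (sqi_decay du)); exact: WBtheta_bessel du.
Qed.

Let gauss : R -> R[i] := fun x => (expR (- x ^+ 2))%:C.

(** If the theta function had norm 0, so would the Gaussian by the Bessel inequality; but its square
    is at least exp(-1)^2 on [0, 1]. *)
Let nrm_gauss : nrm (WBtheta gauss) != 0.
Proof.
have [B du] := cgaussian_decay (@cgaussian_gauss R).
apply/eqP => n0; have := WBtheta_bessel N0 du; rewrite n0 mulr0; apply/negP; rewrite -ltNge.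
pose c : R := expR (-1) ^+ 2.
have c0 : 0 < c by rewrite exprn_gt0// expR_gt0.
have mu : measurable_fun setT (fun x : T => (sqmod (gauss x))%:E).
  by have [mu _ _] := du; exact: cmeas_esqmod.
apply: (@lt_le_trans _ _ (\int[leb]_(x in uI) (sqmod (gauss x))%:E)%E); last first.
  apply: ge0_subset_integral => //; first exact: measurable_uI.
  by move=> x _; rewrite lee_fin sqmod_ge0.
apply: (@lt_le_trans _ _ (\int[leb]_(x in uI) (cst c%:E x))%E).
  apply: (@lt_le_trans _ _ (c%:E * 1)%E); first by rewrite mule1 lte_fin.
  by rewrite (integral_cst leb measurable_uI) -[X in (_ <= _ * X)%E](esym (@leb_uI R)).
apply: ge0_le_integral.
- exact: measurable_uI.
- by move=> x _; rewrite lee_fin ltW.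
- exact: measurable_cst.
- exact: measurable_funTS mu.
move=> x; rewrite /uI /= in_itv/= => /andP[x0 x1]; rewrite lee_fin /gauss /sqmod /= expr0n addr0.
apply: lerXn2r; rewrite ?nnegrE ?expR_ge0// ler_expR lerN2.
by rewrite exprn_ile1.
Qed.

Lemma gaussian_WBtheta_dense th (e : R) : Zak th -> 0 < e ->
  exists2 u, cgaussian u & nrm (fun z => th z - WBtheta u z) < e.
Proof.
move=> Zth e0.
pose S : set (T * T -> R[i]) := [set s | exists2 u : R -> R[i], cgaussian u & s = WBtheta u].
have SZ : S `<=` Zak.
  by move=> _ [u /cgaussian_decay [B du] ->]; exact: Zak_WBtheta du.
have S0 : S (WBtheta gauss) by exists gauss => //; exact: cgaussian_gauss.
have SD k f g : S f -> S g -> S (fun z => k * f z + g z).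
  move=> [u cu ->] [v cv ->]; exists (fun x => k * u x + v x); first exact: cgaussian_lin.
  have [B du] := cgaussian_decay cu; have [B' dv] := cgaussian_decay cv.
  by rewrite (WBtheta_lin N k du dv).
have Sh al ga s : S s -> S (hact al ga 0 s).
  move=> [u cu ->]; have [B du] := cgaussian_decay cu; rewrite (hact_WBtheta N0 al ga du).
  exists (fun x => expi2pi (x * al / N%:~R) * u (x + N%:~R * ga)) => //.
  have := cgaussian_act (al / N%:~R) (N%:~R * ga) cu.
  by rewrite (_ : (fun x => _) = (fun x => expi2pi (x * al / N%:~R) * u (x + N%:~R * ga)))//;
    apply/funext => x; rewrite mulrA.
have [s [u cu ->] le] := Zak_density SZ S0 nrm_gauss SD Sh Zth e0.
by exists u.
Qed.

Let two_step_le (a p q x y : R) : a <= 2 * p + 2 * q -> p < y -> q < x -> y <= x -> a <= 4 * x.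
Proof. lra. Qed.

Lemma VX_HNd : VX N X `<=` HNd N d chi.
Proof.
move=> F [mF [th Zth FJ]].
have LF : L2H F by apply: L2H_heq FJ _ => //; exact: L2H_JX.
(* [WB_schwartz] carries the factor [kappa], so the theta functions must approximate [th] divided by
   it. *)
pose eta z := kappa^-1 * th z.
have Zeta : Zak eta by exact: Zak_scale.
have Nn : 0 < `|N|%:R :> R by rewrite ltr0n absz_gt0.
(* By [nrm2_tri] consecutive theta functions are within 4 e n in squared norm, and [nrmR_le] costs a
   factor |N|; so the [u n] are within 4^-n. *)
pose e n : R := 4^-1 ^+ n / (4 * `|N|%:R).
have e0 n : 0 < e n by rewrite divr_gt0 ?exprn_gt0 ?mulr_gt0.
have /choice[u uP] n : exists u, cgaussian u /\ nrm (fun z => eta z - WBtheta u z) < e n.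
  by have [u cu le] := gaussian_WBtheta_dense Zeta (e0 n); exists u.
have /choice[B du] n := cgaussian_decay (uP n).1.
have Zu n : Zak (WBtheta (u n)) := Zak_WBtheta N0 (du n).
have step n : nrmR (fun x => u n.+1 x - u n x) <= 4^-1 ^+ n.
  have cd := cgaussian_lin (-1) (uP n).1 (uP n.+1).1.
  have [B' dd] := cgaussian_decay cd.
  rewrite (@eq_nrm2 _ _ _ leb setT _ (fun x => -1 * u n x + u n.+1 x)); last first.
    by move=> x _; ring.
  apply: (le_trans (nrmR_le dd)); rewrite (WBtheta_lin N (-1) (du n) (du n.+1)).
  rewrite (@eq_nrm2 _ _ _ leb2 sq _ (fun z => WBtheta (u n.+1) z - WBtheta (u n) z)); last first.
    by move=> x _; ring.
  have := nrm2_tri measurable_sq (Zu n.+1).1 Zeta.1 (Zu n).1.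
  rewrite (nrm2_sym leb2 sq (WBtheta (u n.+1)) eta) => tri.
  have h1 := (uP n).2; have h2 := (uP n.+1).2.
  have e1 : e n.+1 <= e n.
    by rewrite /e exprS -mulrA ler_piMl ?(ltW (e0 _))// invf_le1// ler1n.
  have -> : 4^-1 ^+ n = `|N|%:R * (4 * e n) by rewrite /e; field; rewrite gt_eqF.
  apply: ler_wpM2l; first exact: ltW.
  exact: (two_step_le tri h2 h1 e1).
have [f jf fP] := L2_complete measurableT (fun n => sqi_decay (du n)) step.
exists f; split=> //; exists u; split.
- by move=> k; exact: cgaussian_schwartz (uP k).1.
- apply: ((L2cvgP measurableT (fun n => sqi_decay (du n)) jf).2).
  apply/cvgrPdist_lt => r r0; have [k _ hk] := half_pow_lt 4 r0.
  exists k => // n /= kn; rewrite sub0r normrN ger0_norm ?nrm2_ge0// nrm2_sym.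
  by apply: (le_lt_trans (fP n)); exact: hk.
have VW n : VX N X (WB_schwartz N d chi (u n)) := VX_WB_schwartz (du n).
apply: ((L2cvgP measurable_cube (fun n => (VX_L2H N0 (VW n)).1) LF.1).2).
have E n : nrmc (fun g => WB_schwartz N d chi (u n) g - F g) =
    znorm N X * sqmod kappa * nrm (fun z => eta z - WBtheta (u n) z).
  transitivity (nrmc (fun g => JX N X (fun z => kappa * WBtheta (u n) z) g - JX N X th g)).
    apply: nrmc_heq.
    - exact: (cmeasB (L2H_cmeas (VX_L2H N0 (VW n))) mF).
    - exact: (cmeasB (cmeas_JX N0 X (Zak_scale kappa (Zu n))) (cmeas_JX N0 X Zth)).
    apply: (aeS FJ) => g ->; congr (_ - _).
    rewrite (WB_schwartzE N0 Dchi (du n)) /JX /lift /ztheta mulrCA mulr_sumr; congr (_ * _).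
    by apply: eq_bigr => j _; rewrite /zterm -/kappa mulrCA; congr (_ * _); rewrite mulrCA.
  rewrite JX_sub nrm2_JX//; last by apply: Zak_sub => //; exact: Zak_scale.
  rewrite -mulrA -(nrm2Z measurable_sq _ (Zak_sub Zeta (Zu n)).1); congr (_ * _).
  rewrite nrm2_sym; apply: eq_nrm2 => z _; rewrite /eta mulrBr mulrA divff ?mul1r//.
have K0 : 0 < znorm N X * sqmod kappa.
  by rewrite mulr_gt0 ?sqmod_gt0// znorm_chi_ratio_gt0.
rewrite (funext E) -(mulr0 (znorm N X * sqmod kappa)).
apply: cvgM; first exact: cvg_cst.
apply/cvgrPdist_lt => r r0; have [k _ hk] := half_pow_lt 1 r0.
exists k => // n /= kn; rewrite sub0r normrN ger0_norm ?nrm2_ge0//.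
apply: (lt_trans (uP n).2); apply: le_lt_trans (hk n kn); rewrite mul1r.
apply: (@le_trans _ _ (4^-1 ^+ n)).
  rewrite /e ler_pdivrMr ?mulr_gt0// ler_peMr ?exprn_ge0 ?invr_ge0//.
  by rewrite -natrM ler1n muln_gt0 absz_gt0.
by apply: lerXn2r; rewrite ?nnegrE ?invr_ge0// lef_pV2 ?posrE// ler_nat.
Qed.

Lemma HNdE : HNd N d chi = VX N X.
Proof. by apply/seteqP; split; [exact: HNd_VX|exact: VX_HNd]. Qed.

End WeilBrezinImage.

Theorem theorem5p5 (R : realType) (N : int) (N_neq0 : N != 0) :
  orthogonal_direct_sum (@HN R N)
    [set p : nat * (int -> R[i]) |
       (p.1 %| `|N|)%N /\ dirichlet_character p.1 p.2]
    (fun p => HNd N p.1 p.2) /\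
  (forall (d : nat) (chi : int -> R[i]),
     (d %| `|N|)%N -> dirichlet_character d chi ->
     [/\ rho_invariant (HNd N d chi),
         irreducible_rep (HNd N d chi) &
         has_central_character (HNd N d chi)
           (fun z => expi2pi (N%:~R * z))]).
Proof.
have XP d (chi : int -> R[i]) (dN : (d %| `|N|)%N) (D : dirichlet_character d chi) :
  0 < znorm N (chi_ratio N d chi) by exact: znorm_chi_ratio_gt0.
split; last first.
  move=> d chi dN D; rewrite (HNdE N_neq0 dN D); split.
  - exact: VX_rho.
  - exact: (VX_irreducible N_neq0 (XP _ _ dN D)).
  - exact: VX_central.
have finA := @finite_chi_index R N N_neq0.
split.
- exact: finA.
- by move=> p [pN Dp]; rewrite (HNdE N_neq0 pN Dp); exact: (VX_closed N_neq0 (XP _ _ pN Dp)).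
- move=> p q [pN Dp] [qN Dq] pq F G.
  rewrite (HNdE N_neq0 pN Dp) (HNdE N_neq0 qN Dq); apply: (VX_orthogonal N_neq0).
  exact: zdot_chi_ratio_eq0.
(* The functions chi(nd/N) span the point masses, which is the hypothesis under which [HN_sum]
   describes [HN]. *)
have [C CE] := @delta_chi_ratio R N N_neq0.
have HNs := @HN_sum R N N_neq0 _ _ (fun p => chi_ratio N p.1 p.2) C CE.
have memA p : (p \in chi_seq N) <-> (p.1 %| `|N|)%N /\ @dirichlet_character R p.1 p.2.
  by rewrite (mem_chi_seq N_neq0) inE.
have fsE (f : nat * (int -> R[i]) -> heis R -> R[i]) g :
  \sum_(p \in chi_index N) f p g = \sum_(p <- chi_seq N) f p g by rewrite fsbig_finite.
apply/seteqP; split=> F.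
  move=> HF; have LF : L2H F by case: HF.
  split=> //; have [f [fV Ff]] := (HNs F (L2H_cmeas LF)).1 HF.
  exists f; split.
    by move=> p Ap; have [pN Dp] := Ap; rewrite (HNdE N_neq0 pN Dp); apply: fV; exact/memA.
  by apply: (aeS Ff) => g ->; rewrite -fsE.
move=> [LF [f [fV Ff]]]; apply: (HNs F (L2H_cmeas LF)).2; exists f; split.
  by move=> p /memA Ap; have [pN Dp] := Ap; rewrite -(HNdE N_neq0 pN Dp); exact: fV.
by apply: (aeS Ff) => g ->; rewrite -fsE.
Qed.
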